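(* Let $f\in\mathrm{Aut}(\mathbb{Q},<)$. The conjugacy class of $f$ is non-Haar null if and only if $\mathrm{fix}(f)$ is finite and for each pair of orbitals $O_1,O_2\in\mathcal{O}^*_f$ with $O_1<O_2$ such that $s_f(O_1)=s_f(O_2)=1$ or $s_f(O_1)=s_f(O_2)=-1$, there exists an orbital $O_3\in\mathcal{O}^*_f$ with $O_1<O_3<O_2$ and $s_f(O_3)\neq s_f(O_1)$. Moreover, every non-Haar null conjugacy class is compact biter, and those non-Haar null conjugacy classes whose elements have no fixed points are compact catchers.
   Context: $\mathrm{Aut}(\mathbb{Q},<)$ is the group of order-preserving bijections of $\mathbb{Q}$ with the topology of pointwise convergence (a Polish group); $\mathrm{fix}(f)$ is the set of fixed points of $f$. For $f$, the set of orbitals is $\mathcal{O}^*_f=\{\mathrm{conv}(\{f^n(r):n\in\mathbb{Z}\}): r\in\mathbb{Q}\}$ (convex hulls relative to $\mathbb{Q}$); orbitals partition $\mathbb{Q}$, and for distinct orbitals $O_1<O_2$ means $p_1<p_2$ for some (equivalently all) $p_1\in O_1,p_2\in O_2$. The parity $s_f(O)$ is $0$ if $O$ is a singleton fixed point, $1$ if $f(p)>p$ for $p\in O$, and $-1$ if $f(p)<p$ for $p\in O$. For a Polish group $G$, a Borel set $B\subseteq G$ is Haar null if there is a Borel probability measure $\mu$ on $G$ with $\mu(gBh)=0$ for all $g,h\in G$; an arbitrary set is Haar null if contained in a Borel Haar null set. A set $A\subseteq G$ is compact catcher if for every compact $K\subseteq G$ there exist $g,h\in G$ with $gKh\subseteq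 A$; it is compact biter if for every non-empty compact $K\subseteq G$ there exist an open $U$ and $g,h\in G$ with $U\cap K\neq\emptyset$ and $g(U\cap K)h\subseteq A$. *)

(* Defs.v *)
From HB Require Import structures.
From mathcomp Require Import all_boot all_order all_algebra.
From mathcomp Require Import all_classical all_reals all_analysis.

Set Implicit Arguments.
Unset Strict Implicit.
Unset Printing Implicit Defensive.

Import Order.TTheory GRing.Theory Num.Theory.

Local Open Scope classical_set_scope.
Local Open Scope ring_scope.

HB.mixin Record isTopGroup G of PointedTopological G & Group G := {
  mulg_continuous : continuous (fun p : G * G => (p.1 * p.2)%g) ;
  invg_continuous : continuous (fun x : G => (x^-1)%g)
}.

#[short(type="topGroupType")]
HB.structure Definition TopGroup :=
  {G of isTopGroup G & PointedTopological G & Group G}.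

Section HaarNull.
Variable G : topGroupType.
Implicit Types A B K : set G.

Definition translate (g h : G) A : set G := [set (g * x * h)%g | x in A].

Definition borel : set (set G) := <<s @open G >>.

Definition borel_haar_null (R : realType) B : Prop :=
  borel B /\
  exists mu : probability (g_sigma_algebraType (@open G)) R,
    forall g h : G, mu (translate g h B) = 0%E.

Definition haar_null (R : realType) A : Prop :=
  exists B, borel_haar_null R B /\ A `<=` B.

Definition compact_catcher A : Prop :=
  forall K, compact K -> exists g h : G, translate g h K `<=` A.

Definition compact_biter A : Prop :=
  forall K, K !=set0 -> compact K ->
    exists (U : set G) (g h : G),
      [/\ open U, U `&` K !=set0 & translate g h (U `&` K) `<=` A].

Definition conjugacy_class (x : G) : set G :=
  [set (x ^ y)%g | y in [set: G]].

End HaarNull.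

Definition zexpg (G : groupType) (x : G) (n : int) : G :=
  match n with Posz k => (x ^+ k)%g | Negz k => (x ^- k.+1)%g end.

Record autQ := AutQ {
  autQ_fun :> rat -> rat ;
  autQ_homo : {homo autQ_fun : x y / x < y} ;
  autQ_bij : bijective autQ_fun
}.

HB.instance Definition _ := gen_eqMixin autQ.
HB.instance Definition _ := gen_choiceMixin autQ.

Lemma autQ_ext (f g : autQ) : f =1 g -> f = g.
Proof.
case: f g => [f fh fb] [g gh gb] /= /funext fg.
by case: _ / fg in gh gb *; congr AutQ; exact: Prop_irrelevance.
Qed.

Definition autQ_one : autQ :=
  @AutQ idfun (fun _ _ => id) (Bijective (fun _ => erefl) (fun _ => erefl)).

Definition autQ_mul (f g : autQ) : autQ :=
  @AutQ (f \o g) (fun x y xy => autQ_homo f (autQ_homo g xy))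
    (bij_comp (autQ_bij f) (autQ_bij g)).

Lemma autQ_inv_ex (f : autQ) : exists g : autQ, cancel f g /\ cancel g f.
Proof.
have [g fK gK] := autQ_bij f.
suff gh : {homo g : x y / x < y} by exists (AutQ gh (Bijective gK fK)).
move=> x y xy; rewrite ltNge; apply/negP; rewrite le_eqVlt => /predU1P[e|yx].
  by move: xy; rewrite -(gK x) -(gK y) e ltxx.
by have := autQ_homo f yx; rewrite !gK => /(lt_trans xy); rewrite ltxx.
Qed.

Definition autQ_inv (f : autQ) : autQ := projT1 (cid (autQ_inv_ex f)).

Lemma autQ_invK (f : autQ) : cancel f (autQ_inv f).
Proof. by rewrite /autQ_inv; case: cid => g []. Qed.

Lemma autQ_Kinv (f : autQ) : cancel (autQ_inv f) f.
Proof. by rewrite /autQ_inv; case: cid => g []. Qed.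

Lemma autQ_mulA : associative autQ_mul.
Proof. by move=> f g h; exact: autQ_ext. Qed.

Lemma autQ_mul1 : left_id autQ_one autQ_mul.
Proof. by move=> f; exact: autQ_ext. Qed.

Lemma autQ_mulr1 : right_id autQ_one autQ_mul.
Proof. by move=> f; exact: autQ_ext. Qed.

Lemma autQ_mulV : left_inverse autQ_one autQ_inv autQ_mul.
Proof. by move=> f; apply: autQ_ext => x; exact: autQ_invK. Qed.

Lemma autQ_mulrV : right_inverse autQ_one autQ_inv autQ_mul.
Proof. by move=> f; apply: autQ_ext => x; exact: autQ_Kinv. Qed.

HB.instance Definition _ := isGroup.Build autQ
  autQ_mulA autQ_mul1 autQ_mulr1 autQ_mulV autQ_mulrV.

HB.instance Definition _ := isPointed.Build autQ autQ_one.

(* Pointwise convergence is with respect to the discrete topology on Q, not to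
   the order topology that rat carries by default. *)
HB.instance Definition _ := Topological.copy autQ
  (initial_topology
    (autQ_fun : autQ -> {ptws rat -> discrete_topology rat})).

Lemma cvg_autQP (F : set_system autQ) (f : autQ) : Filter F ->
  F --> f <-> forall q : rat, F [set g : autQ | g q = f q].
Proof.
move=> FF; split=> [Ff q|Ff].
  apply: Ff; set P := ({ptws rat -> discrete_topology rat} : Type).
  exists [set g : autQ | g q = f q]; split => //=.
  exists ((fun h : P => h q) @^-1` [set f q]) => //.
  by apply: open_comp; [move=> h _; exact: proj_continuous|exact: discrete_open].
move=> U [_ [[W oW <-] Wf] /filterS]; apply; rewrite /= in Wf.
suff : autQ_fun @ F --> (autQ_fun f : {ptws rat -> discrete_topology rat}).
  by apply; exact: open_nbhs_nbhs.
apply/cvg_sup => q V [_ [[B oB <-] /= Bf] /filterS]; apply.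
suff : F (autQ_fun @^-1` (fun h => B (h q))) by [].
by apply: filterS (Ff q) => g; rewrite /preimage /= => ->.
Qed.

Lemma autQ_near (f : autQ) (q : rat) : nbhs f [set g : autQ | g q = f q].
Proof. by have /cvg_autQP : nbhs f --> f by []. Qed.

Lemma autQ_mul_continuous :
  continuous (fun p : autQ * autQ => (p.1 * p.2)%g).
Proof.
move=> [f g]; apply/cvg_autQP => q.
exists ([set f' : autQ | f' (g q) = f (g q)], [set g' : autQ | g' q = g q]).
  by split; exact: autQ_near.
by move=> [f' g'] [/= ff gg]; rewrite /= gg ff.
Qed.

Lemma autQ_inv_continuous : continuous (fun f : autQ => (f^-1)%g).
Proof.
move=> f; apply/cvg_autQP => [|q]; first exact/fmap_filter/nbhs_filter.
apply: filterS (autQ_near f (autQ_inv f q)) => g /=.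
by rewrite autQ_Kinv => gq; rewrite -[in LHS]gq; exact: autQ_invK.
Qed.

HB.instance Definition _ :=
  isTopGroup.Build autQ autQ_mul_continuous autQ_inv_continuous.

Definition fixed_points (f : autQ) : set rat := [set x | f x = x].

Definition convex_hull (S : set rat) : set rat := smallest (@is_interval rat) S.

Definition orbitals (f : autQ) : set (set rat) :=
  [set convex_hull [set zexpg f n r | n in [set: int]] | r in [set: rat]].

Definition orbital_lt (O1 O2 : set rat) : Prop :=
  O1 <> O2 /\ exists p1 p2, [/\ O1 p1, O2 p2 & p1 < p2].

(* On an orbital O of f exactly one of the three cases of the parity holds, so
   the last branch is the case where f p < p for all p in O. *)
Definition parity (f : autQ) (O : set rat) : int :=
  if `[< exists p, O = [set p] /\ f p = p >] then 0
  else if `[< forall p, O p -> p < f p >] then 1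
  else -1.

(* Main.v *)
From HB Require Import structures.
Require Import Defs.
From mathcomp Require Import all_boot all_order all_algebra.
From mathcomp Require Import all_classical all_reals all_analysis.
From mathcomp Require Import lra zify ring.

(** Call [p] and [q] equivalent when they lie in the same orbital of [f]. Two
    automorphisms are conjugate as soon as a relation matches their orbitals in
    an order- and sign-preserving way, and when same-sign orbitals of [f] are
    separated by a different sign the orbitals are visible from the sign of
    [f p - p] alone.

    Catching. Let [K] be finite-valued (each [k q] and each inverse image takes
    finitely many values over [K]; compact sets are), and suppose that all [k]
    in [K] agree on the fixed points of [f]. One builds [phi] by finite
    approximations such that every [k] in [K] crosses [phi] with the sign
    pattern of [f]; then [phi^-1 * k] is conjugate to [f] for all [k] in [K].
    Every probability measure charges a finite-valued set, hence the class is
    not Haar null; the same construction gives biters and catchers.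

    Haar nullness. A random back-and-forth construction chooses its i-th point
    uniformly among many points of a descending staircase. A fixed [psi] passes
    between the chosen point and the next one for at most one choice, so by
    Borel-Cantelli this happens only finitely often, almost surely. This rules
    out infinitely many fixed points of [psi^-1 * kappa], and also invariant
    cuts near which [psi^-1 * kappa] has constant sign. *)

Set Implicit Arguments.
Unset Strict Implicit.
Unset Printing Implicit Defensive.

Import Order.TTheory GRing.Theory Num.Theory.

Local Open Scope classical_set_scope.
Local Open Scope ring_scope.

(** * Orbitals and conjugacy *)

(** One [phi] has to serve all maps of [K] at once, and these cross it at different places. Hence
    the points of the approximations carry labels that depend on the map; finiteness of the values
    leaves gaps in which new points can be placed. Finite-valued sets take the place of compact ones
    because a probability measure yields them directly. In the null direction the dangerous cut
    depends on the automorphism compared with the random one, and there are uncountably many of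
    these, so the construction cannot aim at it. What it secures, for all cuts at once, is a
    dichotomy: while no comparison map passes between a chosen point and its alternative, one of the
    two graph points next to the cut stays forever, whereas a cut of the forbidden kind has no
    largest point below it and no smallest above it. A target has a prescribed coordinate and cannot
    respect what its neighbours protect; it is therefore flanked by two points that can. Conjugacy
    invariance turns a two-sided translate of [kappa] into [psi^-1 * kappa], and negative signs are
    reached by inverting. *)

Lemma autQ_le_mono (f : autQ) : {mono f : x y / x <= y}.
Proof. exact: le_mono (@autQ_homo f). Qed.

Lemma autQ_lt_mono (f : autQ) : {mono f : x y / x < y}.
Proof. exact: leW_mono (@autQ_le_mono f). Qed.

Lemma autQ_inj (f : autQ) : injective f.
Proof. exact: bij_inj (autQ_bij f). Qed.

Lemma autQK (f : autQ) : cancel f (f^-1)%g.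
Proof. exact: autQ_invK. Qed.

Lemma autQVK (f : autQ) : cancel (f^-1)%g f.
Proof. exact: autQ_Kinv. Qed.

Lemma autQM (f g : autQ) x : (f * g)%g x = f (g x).
Proof. by []. Qed.

Lemma autQ_eqV (f : autQ) x y : ((f^-1)%g y = x) <-> (f x = y).
Proof. by split=> [<-|<-]; rewrite ?autQVK ?autQK. Qed.

Lemma autQ_ltV (f : autQ) x y : ((f^-1)%g y < x) = (y < f x).
Proof. by rewrite -(autQ_lt_mono f) autQVK. Qed.

Lemma autQ_gtV (f : autQ) x y : (x < (f^-1)%g y) = (f x < y).
Proof. by rewrite -(autQ_lt_mono f) autQVK. Qed.

Lemma autQ_leV (f : autQ) x y : ((f^-1)%g y <= x) = (y <= f x).
Proof. by rewrite -(autQ_le_mono f) autQVK. Qed.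

Lemma autQ_geV (f : autQ) x y : (x <= (f^-1)%g y) = (f x <= y).
Proof. by rewrite -(autQ_le_mono f) autQVK. Qed.

(** The conjugator, [phi] and the random map all arise as such graphs. Functionality and injectivity
    follow from the order condition by trichotomy. *)
Lemma graph_autQ (H : rat -> rat -> Prop) :
  (forall x, exists y, H x y) -> (forall y, exists x, H x y) ->
  (forall x y x' y', H x y -> H x' y' -> (x < x') = (y < y')) ->
  exists h : autQ, forall x y, H x y <-> h x = y.
Proof.
move=> Hl Hr Hm.
have [h hP] := choice Hl; have [h' h'P] := choice Hr.
have Hf x y y' : H x y -> H x y' -> y = y'.
  move=> Hy Hy'; apply/eqP; rewrite eq_le !leNgt.
  by rewrite -(Hm _ _ _ _ Hy Hy') -(Hm _ _ _ _ Hy' Hy) ltxx.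
have Hi x x' y : H x y -> H x' y -> x = x'.
  move=> Hy Hy'; apply/eqP; rewrite eq_le !leNgt.
  by rewrite (Hm _ _ _ _ Hy Hy') (Hm _ _ _ _ Hy' Hy) ltxx.
have hh : {homo h : x y / x < y} by move=> x y; rewrite (Hm _ _ _ _ (hP x) (hP y)).
have hb : bijective h.
  exists h' => x; first exact: Hi (h'P _) (hP _).
  exact: Hf (hP _) (h'P _).
by exists (AutQ hh hb) => x y /=; split=> [/(Hf _ _ _ (hP x))|<-].
Qed.

Section IntegerPowers.
Variable G : groupType.
Implicit Types (x : G) (n m : int).

Lemma zexpgS x n : zexpg x (n + 1) = (x * zexpg x n)%g.
Proof.
case: n => [k|[|k]].
- by rewrite -PoszD addn1 /= expgS.
- by rewrite NegzE addNr /= expg1 mulgV.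
- rewrite (_ : Negz k.+1 + 1 = Negz k); last by rewrite !NegzE; lia.
  by rewrite /= (expgS x k.+1) expgSr -expgSr invgM mulgA -[in LHS](mul1g (x ^- k.+1)%g)
       -(mulgV x) -?mulgA -!invgM -?expgSr -?expgS.
Qed.

Lemma zexpgP x n : zexpg x (n - 1) = (x^-1 * zexpg x n)%g.
Proof. by rewrite -[in RHS](subrK 1 n) zexpgS mulKg. Qed.

Lemma zexpgD x m n : zexpg x (m + n) = (zexpg x m * zexpg x n)%g.
Proof.
elim: m => [|k IH|k IH]; first by rewrite add0r /= mul1g.
- by rewrite intS -addrA addrC zexpgS IH [1 + _]addrC zexpgS mulgA.
- by rewrite intS opprD -addrA addrC zexpgP IH [-1 + _]addrC zexpgP mulgA.
Qed.

Lemma zexpgV x n : zexpg (x^-1)%g n = zexpg x (- n).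
Proof.
elim: n => [//|k IH|k IH].
- by rewrite intS addrC zexpgS IH opprD -zexpgP.
- by rewrite opprK [in LHS]intS opprD addrC zexpgP invgK IH opprK intS addrC zexpgS.
Qed.

End IntegerPowers.

(** Membership of [q] in the convex hull of the orbit of [p]. The two exponents are free, so that
    one formula covers both directions of motion. *)
Definition same_orbital (f : autQ) (p q : rat) : Prop :=
  exists i j : int, zexpg f i p <= q <= zexpg f j p.

Definition sg_at (f : autQ) (p : rat) : int := sgz (f p - p).

Lemma sg_at0 (f : autQ) p : (sg_at f p = 0) <-> (f p = p).
Proof.
rewrite /sg_at; split=> [/eqP|->]; last by rewrite subrr sgz0.
by rewrite sgz_eq0 subr_eq0 => /eqP.
Qed.

Lemma sg_at1 (f : autQ) p : (sg_at f p == 1) = (p < f p).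
Proof. by rewrite /sg_at sgz_cp0 subr_gt0. Qed.

Lemma sg_atN1 (f : autQ) p : (sg_at f p == -1) = (f p < p).
Proof. by rewrite /sg_at sgz_cp0 subr_lt0. Qed.

Lemma sg_at_eq (f g : autQ) p q : (p < f p) = (q < g q) -> (f p < p) = (g q < q) ->
  sg_at f p = sg_at g q.
Proof.
rewrite -!sg_at1 -!sg_atN1 /sg_at.
by case: (sgzP (f p - p)); case: (sgzP (g q - q)).
Qed.

Lemma sg_at_ltP f p :
  [\/ sg_at f p = 1 /\ p < f p, sg_at f p = -1 /\ f p < p
    | sg_at f p = 0 /\ f p = p].
Proof.
case: (ltgtP p (f p)) => [h|h|h]; last by constructor 3; split=> //; apply/sg_at0.
- by constructor 1; split=> //; apply/eqP; rewrite sg_at1.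
- by constructor 2; split=> //; apply/eqP; rewrite sg_atN1.
Qed.

Section Orbitals.
Variable f : autQ.
Implicit Types p q r : rat.

Lemma zexpgDE m n p : zexpg f (m + n) p = zexpg f m (zexpg f n p).
Proof. by rewrite zexpgD. Qed.

Lemma zexpgSE n p : zexpg f (n + 1) p = f (zexpg f n p).
Proof. by rewrite zexpgS. Qed.

Lemma zexpgSrE n p : zexpg f (n + 1) p = zexpg f n (f p).
Proof. by rewrite zexpgDE /= expg1. Qed.

Lemma same_orbital_refl p : same_orbital f p p.
Proof. by exists 0, 0; rewrite /= lexx. Qed.

Lemma same_orbital_sym p q : same_orbital f p q -> same_orbital f q p.
Proof.
move=> [i [j /andP[iq qj]]]; exists (- j), (- i).
rewrite -(autQ_le_mono (zexpg f j)) -zexpgDE subrr qj /=.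
by rewrite -(autQ_le_mono (zexpg f i)) -zexpgDE subrr.
Qed.

Lemma same_orbital_trans q p r :
  same_orbital f p q -> same_orbital f q r -> same_orbital f p r.
Proof.
move=> [i [j /andP[iq qj]]] [k [l /andP[kr rl]]]; exists (k + i), (l + j).
rewrite !zexpgDE (le_trans _ kr) ?autQ_le_mono//=.
by rewrite (le_trans rl) ?autQ_le_mono.
Qed.

Lemma same_orbital_zexp n p : same_orbital f p (zexpg f n p).
Proof. by exists n, n; rewrite lexx. Qed.

Lemma same_orbital_step p : same_orbital f p (f p).
Proof. by exact: (same_orbital_zexp 1). Qed.

Lemma same_orbital_convex p q r :
  same_orbital f p r -> p <= q <= r -> same_orbital f p q.
Proof.
move=> [i [j /andP[_ rj]]] /andP[pq qr]; exists 0, j.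
by rewrite /= pq (le_trans qr).
Qed.

Lemma same_orbital_fix p q : f p = p -> same_orbital f p q -> q = p.
Proof.
move=> fp [i [j]]; have fixn n : zexpg f n p = p.
  elim: n => [//|k IH|k IH]; first by rewrite intS addrC zexpgSE IH.
  apply: (@autQ_inj f); rewrite -zexpgSE (_ : - k.+1%:Z + 1 = - k%:Z); last by lia.
  by rewrite IH fp.
by rewrite !fixn => /le_anti.
Qed.

Lemma zexpg_mono_ge p : p <= f p -> forall n m : int, n <= m ->
  zexpg f n p <= zexpg f m p.
Proof.
move=> fp n m; rewrite -subr_ge0 -{2}(subrK n m); case: (m - n) => // k _.
elim: k => [|k IH]; first by rewrite add0r.
rewrite intS -addrA addrC zexpgSrE (le_trans IH)//.
by rewrite autQ_le_mono.
Qed.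

(* If [p < f p] then the powers of [f] move [p] upwards only, so a fixed point
   or a point moved downwards cannot be reached from [p]. *)
Lemma same_orbital_gt p q : p < f p -> same_orbital f p q -> q < f q.
Proof.
move=> fp [i [j /andP[iq qj]]]; rewrite ltNge; apply/negP => fq.
have fn (k : nat) : zexpg f k%:Z q <= q.
  elim: k => [//|k IH]; rewrite intS addrC zexpgSrE.
  by apply: le_trans IH; rewrite autQ_le_mono.
have h : zexpg f 1 (zexpg f j p) <= zexpg f (`|j - i| + 1)%N%:Z (zexpg f i p).
  by rewrite -!zexpgDE; apply: zexpg_mono_ge; [exact: ltW|lia].
have : zexpg f 1 (zexpg f j p) <= q.
  apply: le_trans (fn (`|j - i| + 1)%N); apply: le_trans h _.
  by rewrite autQ_le_mono.
rewrite -zexpgDE addrC zexpgSrE leNgt => /negP; apply.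
by apply: le_lt_trans qj _; rewrite autQ_lt_mono.
Qed.

End Orbitals.

Lemma same_orbitalV f p q : same_orbital (f^-1)%g p q <-> same_orbital f p q.
Proof.
split=> -[i [j h]]; exists (- i), (- j); first by rewrite -!zexpgV.
by rewrite !zexpgV !opprK.
Qed.

Lemma same_orbital_lt (f : autQ) p q : f p < p -> same_orbital f p q -> f q < q.
Proof.
move=> fp /same_orbitalV h; rewrite -autQ_gtV.
by apply: same_orbital_gt h; rewrite autQ_gtV.
Qed.

Lemma same_orbital_sg f p q : same_orbital f p q -> sg_at f p = sg_at f q.
Proof.
move=> h; case: (sg_at_ltP f p) => -[-> fp].
- by apply/esym/eqP; rewrite sg_at1; exact: same_orbital_gt h.
- by apply/esym/eqP; rewrite sg_atN1; exact: same_orbital_lt h.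
- by rewrite (same_orbital_fix fp h); apply/esym/sg_at0.
Qed.

(** Orbitals are convex: if the order were exchanged, [p] or [q'] would lie between two points of
    the other orbital. *)
Lemma same_orbital_sep f p q p' q' : same_orbital f p p' ->
  same_orbital f q q' -> ~ same_orbital f p q -> p < q -> p' < q'.
Proof.
move=> pp' qq' npq pq; rewrite ltNge; apply/negP => q'p'; apply: npq.
have [q'p|/ltW pq'] := leP q' p.
  apply/same_orbital_sym/(same_orbital_trans qq').
  apply: (same_orbital_convex (same_orbital_sym qq')).
  by rewrite q'p (ltW pq).
apply: same_orbital_trans (same_orbital_sym qq').
by apply: (same_orbital_convex pp'); rewrite pq'.
Qed.

(** Pointwise form of the condition on orbitals. A different sign already forces [r] into a third
    orbital, because the sign is constant on orbitals. *)
Definition sign_alternating (f : autQ) : Prop := forall p q, p < q ->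
  ~ same_orbital f p q -> sg_at f p = sg_at f q -> sg_at f p != 0 ->
  exists r, [/\ p < r, r < q & sg_at f r != sg_at f p].

(** * Isomorphisms between single orbitals *)

Section FundamentalDomain.
Variables (f : autQ) (p0 : rat) (fp0 : p0 < f p0).

Lemma fundamental_domain q : same_orbital f p0 q ->
  exists n r, [/\ p0 <= r, r < f p0 & q = zexpg f n r].
Proof.
move=> [i [j /andP[iq qj]]].
(* [i] and [j] need not be ordered, hence the distance; the extra step makes the bound strict, so
   that induction on the number of steps above [i] can start. *)
have {qj}: q < zexpg f (i + (`|j - i| + 1)%N%:Z) p0.
  apply: le_lt_trans qj _.
  have : zexpg f (j + 1) p0 <= zexpg f (i + (`|j - i| + 1)%N%:Z) p0.
    by apply: zexpg_mono_ge; [exact: ltW|lia].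
  by apply: lt_le_trans; rewrite zexpgSrE autQ_lt_mono.
elim: (_ + 1)%N => [|d IH].
  by rewrite addr0 ltNge iq.
have [h _|h] := ltP q (zexpg f (i + d%:Z) p0); first exact: IH.
rewrite intS (addrC 1) addrA zexpgSrE => h'.
exists (i + d%:Z), (zexpg f (- (i + d%:Z)) q).
rewrite -!zexpgDE addrN; split=> //.
  by rewrite -(autQ_le_mono (zexpg f (i + d%:Z))) -zexpgDE addrN.
by rewrite -(autQ_lt_mono (zexpg f (i + d%:Z))) -zexpgDE addrN.
Qed.

(** The translates of the domain are stacked in the order of the exponents, so [(n, r)] is ordered
    lexicographically. The formula does not mention [f], which is why matching coordinates preserves
    the order. *)
Lemma fundamental_domain_ltE n m r s :
  p0 <= r -> r < f p0 -> p0 <= s -> s < f p0 ->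
  (zexpg f n r < zexpg f m s) = ((n < m) || (n == m) && (r < s)).
Proof.
have lt_nm k l x y : k < l -> x < f p0 -> p0 <= y -> zexpg f k x < zexpg f l y.
  move=> kl xf py; have : zexpg f k x < zexpg f (k + 1) p0.
    by rewrite zexpgSrE autQ_lt_mono.
  move=> /lt_le_trans; apply; apply: (@le_trans _ _ (zexpg f l p0)).
    by apply: zexpg_mono_ge; [exact: ltW|lia].
  by rewrite autQ_le_mono.
move=> pr rf ps sf; case: (ltgtP n m) => [h|h|->] /=.
- by rewrite lt_nm.
- by apply/negbTE; rewrite -leNgt ltW// lt_nm.
- by rewrite autQ_lt_mono.
Qed.

End FundamentalDomain.

Definition orbital_iso (f f' : autQ) (p0 x0 : rat) (H : rat -> rat -> Prop) :=
  [/\ forall q, same_orbital f p0 q -> exists y, H q y,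
      forall y, same_orbital f' x0 y -> exists q, H q y,
      forall q y, H q y -> same_orbital f p0 q /\ same_orbital f' x0 y,
      forall q y q' y', H q y -> H q' y' -> (q < q') = (y < y') &
      forall q y, H q y -> H (f q) (f' y)].

(* Match the fundamental domains [p0, f p0[ and [x0, f' x0[ by an affine map
   and extend equivariantly. *)
Lemma orbital_iso_gt (f f' : autQ) p0 x0 : p0 < f p0 -> x0 < f' x0 ->
  exists H, orbital_iso f f' p0 x0 H.
Proof.
move=> fp fx; pose d := f p0 - p0; pose d' := f' x0 - x0.
have d0 : 0 < d by rewrite subr_gt0.
have d'0 : 0 < d' by rewrite subr_gt0.
pose A r := x0 + (r - p0) / d * d'; pose A' y := p0 + (y - x0) / d' * d.
have AK y : A (A' y) = y by rewrite /A /A'; field; rewrite !gt_eqF.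
have Ag r : p0 <= r -> x0 <= A r.
  by move=> h; rewrite /A lerDl mulr_ge0 ?(ltW d'0)// divr_ge0 ?subr_ge0// ltW.
have Al r : r < f p0 -> A r < f' x0.
  move=> h; rewrite /A -ltrBrDl -/d' gtr_pMl// ltr_pdivrMr// mul1r.
  by rewrite /d ltrD2r.
have A'g y : x0 <= y -> p0 <= A' y.
  by move=> h; rewrite /A' lerDl mulr_ge0 ?(ltW d0)// divr_ge0 ?subr_ge0// ltW.
have A'l y : y < f' x0 -> A' y < f p0.
  move=> h; rewrite /A' -ltrBrDl -/d gtr_pMl// ltr_pdivrMr// mul1r.
  by rewrite /d' ltrD2r.
have Am r s : (A r < A s) = (r < s).
  by rewrite /A ltrD2l ltr_pM2r// ltr_pM2r ?invr_gt0// ltrD2r.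
exists (fun q y => exists n r, [/\ p0 <= r, r < f p0, q = zexpg f n r
                                & y = zexpg f' n (A r)]); split.
- move=> q /(fundamental_domain fp)[n [r [h1 h2 ->]]].
  by exists (zexpg f' n (A r)), n, r.
- move=> y /(fundamental_domain fx)[n [r [h1 h2 ->]]].
  by exists (zexpg f n (A' r)), n, (A' r); rewrite A'g// A'l// AK.
- move=> q y [n [r [h1 h2 -> ->]]]; split; (apply: same_orbital_trans;
    last exact: same_orbital_zexp); apply: same_orbital_convex.
  + exact: same_orbital_step.
  + by rewrite h1 ltW.
  + exact: same_orbital_step.
  + by rewrite Ag// ltW// Al.
- move=> q y q' y' [n [r [h1 h2 -> ->]]] [m [s [h3 h4 -> ->]]].
  rewrite (fundamental_domain_ltE fp)// (fundamental_domain_ltE fx) ?Ag ?Al//.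
  by rewrite Am.
- move=> q y [n [r [h1 h2 -> ->]]]; exists (n + 1), r.
  by rewrite !zexpgSE.
Qed.

(** The sign is the only invariant of a single orbital. Downward orbitals are upward orbitals of the
    inverses. *)
Lemma orbital_iso_ex f f' p0 x0 : sg_at f p0 = sg_at f' x0 ->
  exists H, orbital_iso f f' p0 x0 H.
Proof.
case: (sg_at_ltP f p0) => -[->] fp; case: (sg_at_ltP f' x0) => -[->] fx// _.
- exact: orbital_iso_gt.
- have [||H [H1 H2 H3 H4 H5]] := @orbital_iso_gt (f^-1)%g (f'^-1)%g p0 x0.
  + by rewrite autQ_gtV.
  + by rewrite autQ_gtV.
  exists H; split=> //.
  + by move=> q /same_orbitalV; exact: H1.
  + by move=> q /same_orbitalV; exact: H2.
  + by move=> q y /H3[] /same_orbitalV h /same_orbitalV.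
  (* Equivariance is available for the inverses only: it is applied at [f q], and functionality of
     [H] gives the partner of [f q]. *)
  + move=> q y Hqy.
    have [x Hx] : exists x, H (f q) x.
      apply: H1; have [h _] := H3 _ _ Hqy; apply: (same_orbital_trans h).
      by apply/same_orbitalV; exact: same_orbital_step.
    suff -> : f' y = x by [].
    apply/autQ_eqV; have := H5 _ _ Hx; rewrite autQK => Hq.
    apply/eqP; rewrite eq_le !leNgt -(H4 _ _ _ _ Hqy Hq).
    by rewrite -(H4 _ _ _ _ Hq Hqy) ltxx.
- exists (fun q y => q = p0 /\ y = x0); split.
  + by move=> q /(same_orbital_fix fp) ->; exists x0.
  + by move=> q /(same_orbital_fix fx) ->; exists p0.
  + by move=> q y [-> ->]; split; exact: same_orbital_refl.
  + by move=> q y q' y' [-> ->] [-> ->]; rewrite !ltxx.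
  + by move=> q y [-> ->]; rewrite fp fx.
Qed.

(** * Conjugacy from a matching of orbitals *)

Section ConjugacyCriterion.
Variables (f f' : autQ) (rho : rat -> rat -> Prop).
Hypothesis f_alt : sign_alternating f.
Hypothesis rho_l : forall x, exists p, rho x p.
Hypothesis rho_r : forall p, exists x, rho x p.
Hypothesis rho_sg : forall x p, rho x p -> sg_at f' x = sg_at f p.
Hypothesis rho_le : forall x p y q, rho x p -> rho y q -> x <= y ->
  p < q \/ same_orbital f p q.
Hypothesis rho_same : forall x p y q, rho x p -> rho y q -> x < y ->
  same_orbital f p q -> same_orbital f' x y.

Let rho_lt x p y q : rho x p -> rho y q -> ~ same_orbital f p q -> p < q ->
  x < y.
Proof.
move=> xp yq npq pq; rewrite ltNge; apply/negP => /(rho_le yq xp)[qp|].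
  by move: (lt_trans pq qp); rewrite ltxx.
by move=> /same_orbital_sym.
Qed.

(** [rho x p] matches the orbital of [x] under [f'] with that of [p] under [f]. The direction from
    left to right is where alternation enters: a point [r] of another sign between [p] and [q] has a
    partner between [x] and [y], which convexity would put into their common orbital. *)
Let rho_sameE x p y q : rho x p -> rho y q ->
  same_orbital f' x y <-> same_orbital f p q.
Proof.
move=> xp yq; split; last first.
  case: (ltgtP x y) => [xy|yx|->] h.
  - exact: rho_same xy h.
  - by apply/same_orbital_sym/(rho_same yq xp) => //; exact: same_orbital_sym.
  - exact: same_orbital_refl.
move: x p y q xp yq.
suff wl x p y q : rho x p -> rho y q -> p < q -> same_orbital f' x y ->
    same_orbital f p q.
  move=> x p y q xp yq h; case: (ltgtP p q) => [pq|qp|->].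
  - exact: (wl x p y q).
  - by apply/same_orbital_sym/(wl y q x p) => //; exact: same_orbital_sym.
  - exact: same_orbital_refl.
move=> xp yq pq xy; apply: contrapT => npq.
have xlty := rho_lt xp yq npq pq.
have sxy := same_orbital_sg xy; rewrite (rho_sg xp) (rho_sg yq) in sxy.
have [sp0|sp0] := eqVneq (sg_at f p) 0.
  have fx : f' x = x by apply/sg_at0; rewrite (rho_sg xp).
  by move: xlty; rewrite (same_orbital_fix fx xy) ltxx.
have [r [pr rq rp]] := f_alt pq npq sxy sp0.
have [z zr] := rho_r r.
have npr : ~ same_orbital f p r by move=> /same_orbital_sg e; rewrite e eqxx in rp.
have nrq : ~ same_orbital f r q.
  by move=> /same_orbital_sg e; rewrite e sxy eqxx in rp.
have xz := rho_lt xp zr npr pr; have zy := rho_lt zr yq nrq rq.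
have /same_orbital_sg : same_orbital f' x z.
  by apply: (same_orbital_convex xy); rewrite !ltW.
by rewrite (rho_sg xp) (rho_sg zr) => e; rewrite e eqxx in rp.
Qed.

(** Isomorphisms of matched orbitals are glued. The choice must depend on the orbital only, so one
    representative per orbital of [f] and one partner [X] of it are fixed. *)
Lemma conjugacy_criterion : conjugacy_class f f'.
Proof.
(* [xget] depends on the set alone, so [rep] is constant on orbitals. *)
pose rep p := xget (0 : rat) [set q | same_orbital f p q].
have repP p : same_orbital f p (rep p).
  by rewrite /rep; apply: xgetPex; exists p; exact: same_orbital_refl.
have rep_eq p q : same_orbital f p q -> rep p = rep q.
  move=> pq; congr xget; apply/seteqP; split=> r /=; last exact: same_orbital_trans.
  exact/same_orbital_trans/same_orbital_sym.
have [X XP] := choice rho_r.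
have [Hs HsP] := choice (fun p => orbital_iso_ex (esym (rho_sg (XP p)))).
pose H q y := Hs (rep q) q y.
have Hm x y x' y' : H x y -> H x' y' -> x < x' -> y < y'.
  move=> h h' xx'; have [_ _ K1 K2 _] := HsP (rep x).
  have [_ _ K3 _ _] := HsP (rep x').
  have [s|ns] := pselect (same_orbital f x x').
    have h2 : Hs (rep x) x' y' by rewrite (rep_eq _ _ s).
    by rewrite -(K2 _ _ _ _ h h2).
  have [_ hy] := K1 _ _ h; have [_ hy'] := K3 _ _ h'.
  have nrr : ~ same_orbital f (rep x) (rep x').
    move=> r; apply: ns; apply: (same_orbital_trans (repP x)).
    exact/(same_orbital_trans r)/same_orbital_sym.
  apply: (same_orbital_sep hy hy').
    by move=> /(rho_sameE (XP _) (XP _)).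
  apply: rho_lt (XP _) (XP _) nrr _.
  exact: same_orbital_sep (repP x) (repP x') ns xx'.
have Hrep q y p : Hs (rep p) q y -> rep q = rep p.
  have [_ _ K _ _] := HsP (rep p); move=> /K[h _].
  by rewrite -(rep_eq _ _ h); apply/esym/rep_eq.
have [h hP] : exists h : autQ, forall x y, H x y <-> h x = y.
  apply: graph_autQ.
  - move=> q; have [K _ _ _ _] := HsP (rep q).
    by apply: K; apply/same_orbital_sym/repP.
  - move=> y; have [p yp] := rho_l y.
    have [_ K _ _ _] := HsP (rep p).
    have [|q Hq] := K y.
      apply/(rho_sameE (XP _) yp)/same_orbital_sym; exact: repP.
    by exists q; rewrite /H (Hrep _ _ _ Hq).
  - move=> x y x' y' h h'; apply/idP/idP; first exact: Hm h h'.
    case: (ltgtP x x') => // [/(Hm _ _ _ _ h' h) yy' /(lt_trans yy')|e].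
      by rewrite ltxx.
    have [_ _ _ K2 _] := HsP (rep x); rewrite /H -e in h'.
    by rewrite -(K2 _ _ _ _ h h') ltxx.
have e : (f' * h = h * f)%g.
  apply: autQ_ext => q; rewrite !autQM; apply/esym/hP.
  have [_ _ _ _ K] := HsP (rep q).
  rewrite /H (rep_eq (f q) q); last exact/same_orbital_sym/same_orbital_step.
  by apply: K; apply/hP.
exists (h^-1)%g => //; rewrite /conjg invgK mulgA -e mulgK//.
Qed.

End ConjugacyCriterion.

(** * Catching finite-valued sets *)

(** Finitely many values leave room just to the right of [a]. Together with [sep_left] and the
    bounds inside open intervals this is how finiteness of value sets is exploited. *)
Lemma sep_right (a b : rat) (vs : seq rat) : a < b ->
  exists c : rat, [/\ a < c, c < b & forall v : rat, v \in vs -> a < v -> c < v].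
Proof.
move=> ab; elim: vs => [|v vs [c [ac cb cP]]].
  by exists ((a + b) / 2%:R); split=> //; lra.
have [av|va] := ltP a v; last first.
  exists c; split=> // w; rewrite inE => /predU1P[->|]; last exact: cP.
  by rewrite ltNge va.
exists ((a + Num.min c v) / 2%:R).
have h1 : a < Num.min c v by rewrite lt_min ac av.
have : Num.min c v <= c by rewrite ge_min lexx.
have : Num.min c v <= v by rewrite ge_min lexx orbT.
move: (Num.min c v) h1 => m h1 h2 h3; split; [lra|lra|move=> w].
rewrite inE => /predU1P[->|wv aw]; first lra.
by have := cP _ wv aw; lra.
Qed.

Lemma sep_left (a b : rat) (vs : seq rat) : a < b ->
  exists c : rat, [/\ a < c, c < b & forall v : rat, v \in vs -> v < b -> v < c].
Proof.
move=> ab; have [|c [h1 h2 h3]] := @sep_right (- b) (- a) (map -%R vs).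
  by rewrite ltrN2.
exists (- c); split; [lra|lra|move=> v vvs vb].
by rewrite -ltrN2 opprK; apply: h3; [exact: map_f|rewrite ltrN2].
Qed.

(** Convexity and absence of end points are stated inside [X], so the ends may be irrational or
    infinite. *)
Definition open_interval (X : set rat) :=
  [/\ X !=set0, forall x y z, X x -> X z -> x <= y <= z -> X y,
      forall x, X x -> exists2 y, X y & y < x &
      forall x, X x -> exists2 y, X y & x < y].

Lemma open_interval_ub X (vs : seq rat) : open_interval X ->
  exists2 u : rat, X u & forall v : rat, v \in vs -> X v -> v < u.
Proof.
move=> [[x0 Xx0] _ _ nub]; elim: vs => [|v vs [u Xu uP]]; first by exists x0.
have [Xv|nXv] := pselect (X v); last first.
  by exists u => // w; rewrite inE => /predU1P[->|/uP].
have [v' Xv' vv'] := nub _ Xv.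
exists (Num.max u v'); first by rewrite maxEle; case: ifP.
move=> w; rewrite inE => /predU1P[-> _|wvs Xw]; first by rewrite lt_max vv' orbT.
by rewrite lt_max uP.
Qed.

Lemma open_interval_lb X (vs : seq rat) : open_interval X ->
  exists2 u : rat, X u & forall v : rat, v \in vs -> X v -> u < v.
Proof.
move=> [[x0 Xx0] _ nlb _]; elim: vs => [|v vs [u Xu uP]]; first by exists x0.
have [Xv|nXv] := pselect (X v); last first.
  by exists u => // w; rewrite inE => /predU1P[->|/uP].
have [v' Xv' vv'] := nlb _ Xv.
exists (Num.min u v'); first by rewrite minEle; case: ifP.
move=> w; rewrite inE => /predU1P[-> _|wvs Xw]; first by rewrite gt_min vv' orbT.
by rewrite gt_min uP.
Qed.

Definition finite_valued (K : set autQ) := forall q, exists vs : seq rat,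
  forall k, K k -> k q \in vs /\ (k^-1)%g q \in vs.

(* A point [(px, pu)] of the graph of [phi]. The label [pl k] is a point of [Q]
   whose orbital under [f] is to correspond to the orbital of [px] under
   [phi^-1 * k]; the sign [s] of the label tells on which side of [pu] the value
   [k px] lies. Between consecutive points a map [k] either clears the box that
   they span, keeping its label, or crosses the box from one sign to the other. *)
Record cpt := CPt {px : rat; pu : rat; pl : autQ -> rat}.
HB.instance Definition _ := gen_eqMixin cpt.

Section ChainDefs.
Variables (X Y P : set rat) (s : rat -> bool) (K : set autQ).

Definition cok e := [/\ X (px e), Y (pu e) & forall k, K k -> P (pl e k) /\
  (if s (pl e k) then pu e < k (px e) else k (px e) < pu e)].

Definition cclear k e e' := pl e k = pl e' k /\
  (if s (pl e k) then pu e' < k (px e) else k (px e') < pu e).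

Definition ctrav p q k e e' :=
  [/\ pl e k = p, pl e' k = q, p < q & s q = ~~ s p].

(** The pair [p], [q] is chosen before [k]: all maps crossing the box do so with the same two
    labels, so a missing label can be inserted for all of them with finitely many points. *)
Definition cstep e e' := [/\ px e < px e', pu e < pu e' & exists p q,
  forall k, K k -> cclear k e e' \/ ctrav p q k e e'].

Definition cstepb e e' := `[< cstep e e' >].

Definition cmid e mid e' :=
  path cstepb e (rcons mid e') /\ forall d, d \in mid -> cok d.

(** Steps whose crossings all go from positive to negative. The opposite direction is reduced to
    this one by exchanging the coordinates. *)
Definition pstep p q e e' := [/\ px e < px e', pu e < pu e' &
  forall k, K k -> cclear k e e' \/
    [/\ pl e k = p, pl e' k = q, p < q, s p = true & s q = false]].

Lemma cclear_sub k e e' d d' : cclear k e e' -> pl d k = pl e k ->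
  pl d' k = pl e k -> px e <= px d -> px d' <= px e' -> pu e <= pu d ->
  pu d' <= pu e' -> cclear k d d'.
Proof.
move=> [le h] ld ld' x1 x2 u1 u2; split; first by rewrite ld ld'.
rewrite ld; case: ifP h => _ h.
  by rewrite (le_lt_trans u2)// (lt_le_trans h)// autQ_le_mono.
by rewrite (le_lt_trans _ (lt_le_trans h u1))// autQ_le_mono.
Qed.

Lemma cclear_pt k e e' d : cclear k e e' -> pl d k = pl e k ->
  px e <= px d -> px d <= px e' -> pu e <= pu d -> pu d <= pu e' ->
  if s (pl d k) then pu d < k (px d) else k (px d) < pu d.
Proof.
move=> cl ld x1 x2 u1 u2.
by have [_] := cclear_sub cl ld ld x1 x2 u1 u2.
Qed.

End ChainDefs.

(** * Inserting a coordinate into a box *)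

Section PositiveStep.
Variables (X Y P : set rat) (s : rat -> bool) (K : set autQ).
Hypothesis X_int : open_interval X.
Hypothesis Y_int : open_interval Y.
Hypothesis K_fin : finite_valued K.

Local Notation cok := (cok X Y P s K).
Local Notation cstep := (cstep s K).
Local Notation cstepb := (cstepb s K).
Local Notation cclear := (cclear s).
Local Notation cmid := (cmid X Y P s K).
Local Notation pstep := (pstep s K).

Let Xbt e e' (x : rat) : cok e -> cok e' -> px e < x -> x < px e' -> X x.
Proof.
move=> [Xe _ _] [Xe' _ _] h1 h2; have [_ c _ _] := X_int.
by apply: (c _ _ _ Xe Xe'); rewrite !ltW.
Qed.

Let Ybt e e' (x : rat) : cok e -> cok e' -> pu e < x -> x < pu e' -> Y x.
Proof.
move=> [_ Xe _] [_ Xe' _] h1 h2; have [_ c _ _] := Y_int.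
by apply: (c _ _ _ Xe Xe'); rewrite !ltW.
Qed.

(** The new point gets a height [c] just above [pu e], below every value at [px e] that exceeds
    [pu e]. Positive maps then clear the first box, and the crossing is left to the second. *)
Lemma insert_px_pos p q e e' (x : rat) : cok e -> cok e' -> pstep p q e e' ->
  px e < x -> x < px e' -> exists2 mid, cmid e mid e' &
    exists2 d, d \in mid & px d = x.
Proof.
move=> oke oke' [xx uu tr] ex xe'.
have [vs vsP] := K_fin (px e).
have [c [uc cu cP]] := sep_right vs uu.
have [_ _ okl] := oke; have [_ _ okl'] := oke'.
have ltx (k : autQ) : k (px e) < k x by rewrite autQ_lt_mono.
have ltx' (k : autQ) : k x < k (px e') by rewrite autQ_lt_mono.
pose d := CPt x c (pl e); exists [:: d]; last by exists d => //; rewrite inE.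
have trc k : K k -> pl e k = p -> s p = true -> c < k (px e).
  move=> Kk pe sp; apply: cP; first by have [] := vsP _ Kk.
  by have [_] := okl _ Kk; rewrite pe sp.
split; last first.
  move=> d'; rewrite inE => /eqP ->; split; [exact: Xbt oke oke' ex xe'|
    exact: Ybt oke oke' uc cu|move=> k Kk].
  split; first by have [] := okl _ Kk.
  have [cl|[pe _ _ sp _]] := tr _ Kk.
    by apply: (cclear_pt cl); rewrite //= ltW.
  by rewrite /= pe sp (lt_trans (trc _ Kk pe sp)).
rewrite /= andbT; apply/andP; split; apply/asboolP; split => //.
(* No map crosses this box, so the pair of labels is arbitrary. *)
- exists 0, 0 => k Kk; left.
  have [cl|[pe _ _ sp _]] := tr _ Kk.
    by apply: (cclear_sub cl); rewrite //= ltW.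
  by split=> //=; rewrite pe sp (trc _ Kk pe).
- exists p, q => k Kk; have [cl|[pe pe' pq sp sq]] := tr _ Kk; [left|right].
    by apply: (cclear_sub cl); rewrite //= ?ltW//; have [->] := cl.
  by split=> //; rewrite sp sq.
Qed.

(** The level [u] is met by different maps at different abscissas, so the label [L] at height [u]
    depends on the side on which the map lies there. The flanking points, with heights near [pu e]
    and [pu e'], let a crossing map cross in just one of the two middle boxes. *)
Lemma insert_pu_pos p q e e' (u : rat) : cok e -> cok e' -> pstep p q e e' ->
  pu e < u -> u < pu e' -> exists2 mid, cmid e mid e' &
    exists2 d, d \in mid & pu d = u.
Proof.
move=> oke oke' [xx uu tr] eu ue'.
have [_ _ okl] := oke; have [_ _ okl'] := oke'.
have [vs1 vs1P] := K_fin (px e); have [vs2 vs2P] := K_fin (px e').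
have [vs3 vs3P] := K_fin u.
have [v [ev vu vP]] := sep_right vs1 eu.
have [v' [uv' v'e' v'P]] := sep_left vs2 ue'.
have [y' [ey' y'e' y'P]] := sep_right vs3 xx.
have [z [ez zy' _]] := sep_right [::] ey'.
have [y [ey yz _]] := sep_right [::] ez.
(* No preimage of [u] lies between [px e] and [y'], so no map takes the value [u] on the stretch
   from [y] to [y']: it is above or below throughout. *)
have dich k : K k -> (u < k y) \/ (k y' < u).
  move=> Kk; have [_ h] := vs3P _ Kk.
  have [/(y'P _ h)|] := ltP (px e) ((k^-1)%g u).
    by rewrite autQ_gtV; right.
  by rewrite autQ_leV => h'; left; rewrite (le_lt_trans h')// autQ_lt_mono.
have kyz (k : autQ) : k y < k z by rewrite autQ_lt_mono.
have kzy' (k : autQ) : k z < k y' by rewrite autQ_lt_mono.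
have key (k : autQ) : k (px e) < k y by rewrite autQ_lt_mono.
have ky'e' (k : autQ) : k y' < k (px e') by rewrite autQ_lt_mono.
have vk k : K k -> pl e k = p -> s p = true -> v < k (px e).
  move=> Kk pe sp; apply: vP; first by have [] := vs1P _ Kk.
  by have [_] := okl _ Kk; rewrite pe sp.
have v'k k : K k -> pl e' k = q -> s q = false -> k (px e') < v'.
  move=> Kk pe sp; apply: v'P; first by have [] := vs2P _ Kk.
  by have [_] := okl' _ Kk; rewrite pe sp.
pose L (k : autQ) := if u < k z then pl e k else pl e' k.
pose d1 := CPt y v (pl e); pose d2 := CPt z u L; pose d3 := CPt y' v' (pl e').
have Lcl k : cclear k e e' -> L k = pl e k.
  by move=> [h _]; rewrite /L -h if_same.
exists [:: d1; d2; d3]; last by exists d2 => //; rewrite !inE eqxx orbT.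
split; last first.
  move=> d; rewrite !inE => /or3P[] /eqP ->; split=> /=.
  - by apply: Xbt oke oke' _ _; lra.
  - by apply: Ybt oke oke' _ _; lra.
  - move=> k Kk; split; first by have [] := okl _ Kk.
    have [cl|[pe _ _ sp _]] := tr _ Kk.
      by apply: (cclear_pt (d := d1) cl) => //=; lra.
    by rewrite pe sp (lt_trans (vk _ Kk pe sp)).
  - by apply: Xbt oke oke' _ _; lra.
  - by apply: Ybt oke oke' _ _; lra.
  - move=> k Kk; split.
      by rewrite /L; case: ifP; [have [] := okl _ Kk|have [] := okl' _ Kk].
    have [cl|[pe pe' _ sp sq]] := tr _ Kk.
      by apply: (cclear_pt (d := d2) cl) => //=; [exact: Lcl|lra|lra|lra|lra].
    rewrite /L pe pe'; have [h|h] := dich _ Kk.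
      by rewrite (lt_trans h)// sp.
    have h' := lt_trans (kzy' k) h.
    by rewrite ltNge (ltW h') /= sq.
  - by apply: Xbt oke oke' _ _; lra.
  - by apply: Ybt oke oke' _ _; lra.
  - move=> k Kk; split; first by have [] := okl' _ Kk.
    have [cl|[_ pe' _ _ sq]] := tr _ Kk.
      by apply: (cclear_pt (d := d3) cl) => //=; [by have [->] := cl|lra|lra|lra|lra].
    by rewrite pe' sq (lt_trans _ (v'k _ Kk pe' sq)).
rewrite /= andbT; apply/and4P; split; apply/asboolP; split => //=.
- exists 0, 0 => k Kk; left.
  have [cl|[pe _ _ sp _]] := tr _ Kk.
    by apply: (cclear_sub cl) => //=; lra.
  by split=> //=; rewrite pe sp (vk _ Kk pe).
- exists p, q => k Kk; have [cl|[pe pe' pq sp sq]] := tr _ Kk.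
    by left; apply: (cclear_sub cl) => //=; [exact: Lcl|lra|lra|lra|lra].
  have [h|h] := dich _ Kk.
    by left; split; rewrite /= ?pe ?sp// /L (lt_trans h)// pe.
  right; split; rewrite /= ?sp ?sq// /L.
  by rewrite ltNge (ltW (lt_trans (kzy' k) h)).
- exists p, q => k Kk; have [cl|[pe pe' pq sp sq]] := tr _ Kk.
    left; apply: (cclear_sub cl) => //=; [exact: Lcl|by have [->] := cl|lra|lra|lra|lra].
  have [h|h] := dich _ Kk.
    by right; split; rewrite /= ?sp ?sq// /L (lt_trans h).
  have Lq : L k = q by rewrite /L ltNge (ltW (lt_trans (kzy' k) h)).
  by left; split=> /=; rewrite Lq ?pe' ?sq.
- exists 0, 0 => k Kk; left.
  have [cl|[pe pe' _ sp sq]] := tr _ Kk.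
    by apply: (cclear_sub cl) => //=; first [lra|by have [->] := cl].
  by split=> //=; rewrite pe' sq (v'k _ Kk pe').
Qed.

End PositiveStep.

(** * Inserting labels into a crossing *)

Section InsertLabels.
Variables (X Y P : set rat) (s : rat -> bool) (K : set autQ).
Hypothesis X_int : open_interval X.
Hypothesis Y_int : open_interval Y.
Hypothesis K_fin : finite_valued K.

Local Notation cok := (cok X Y P s K).
Local Notation cstepb := (cstepb s K).
Local Notation cclear := (cclear s).
Local Notation cmid := (cmid X Y P s K).

(* A crossing [p+ -> q-] is refined to [p+ -> r1- -> r2+ -> q-]. The maps that
   cross the box are treated one value of [k (px e)] at a time, from the largest
   value down: maps sharing the value [v] at [px e] stay close to [v] just to
   the right of [px e], which leaves room for the zigzag. *)
Lemma insert_labels_pos p q r1 r2 : s p -> ~~ s r1 -> s r2 -> ~~ s q ->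
  p < r1 -> r1 < r2 -> r2 < q -> P r1 -> P r2 ->
  forall (vs : seq rat), sorted >%R vs -> forall e e', cok e -> cok e' ->
  px e < px e' -> pu e < pu e' ->
  (forall k, K k -> cclear k e e' \/
     [/\ pl e k = p, pl e' k = q & k (px e) \in vs]) ->
  exists2 mid, cmid e mid e' & forall k, K k -> cclear k e e' \/
    (exists2 d, d \in mid & pl d k = r1) /\ (exists2 d, d \in mid & pl d k = r2).
Proof.
move=> sp /negbTE sr1 sr2 /negbTE sq pr1 r12 r2q Pr1 Pr2.
have pq : p < q by lra.
elim=> [|v vs IH] srt e e' oke oke' xx uu tr.
  have cl k : K k -> cclear k e e' by move=> /tr[|[]].
  exists [::] => [|k /cl]; last by left.
  split=> //=; rewrite andbT; apply/asboolP; split=> //.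
  by exists 0, 0 => k /cl; left.
have [[k1 [Kk1 ncl1 k1v]]|nk1] := pselect (exists k,
    [/\ K k, ~ cclear k e e' & k (px e) = v]); last first.
  apply: IH => //; first exact: path_sorted srt.
  move=> k Kk; have [|[pe pe']] := tr _ Kk; first by left.
  rewrite inE => /predU1P[kv|]; last by right.
  by left; apply: contrapT => ncl; apply: nk1; exists k.
have vsv w : w \in vs -> w < v.
  move: srt; rewrite /= path_sortedE; last by move=> a b c /= h /lt_trans; apply.
  by case/andP => /allP h _ /h.
have [Xe _ okl] := oke; have [Xe' _ okl'] := oke'.
have Xbt (x : rat) : px e < x -> x < px e' -> X x.
  by move=> h1 h2; have [_ c _ _] := X_int; apply: (c _ _ _ Xe Xe'); rewrite !ltW.
have Ybt (x : rat) : pu e < x -> x < pu e' -> Y x.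
  move=> h1 h2; have [_ c _ _] := Y_int.
  have [_ Ye _] := oke; have [_ Ye' _] := oke'.
  by apply: (c _ _ _ Ye Ye'); rewrite !ltW.
have signs k : K k -> pl e k = p -> pl e' k = q ->
    pu e < k (px e) /\ k (px e') < pu e'.
  move=> Kk pe pe'; have [_] := okl _ Kk; have [_] := okl' _ Kk.
  by rewrite pe pe' sp sq.
have [uv vu'] : pu e < v /\ v < pu e'.
  have [//|[pe pe' _]] := tr _ Kk1; have [h1 h2] := signs _ Kk1 pe pe'.
  by rewrite -k1v; split=> //; rewrite (lt_trans _ h2)// autQ_lt_mono.
(* [w] separates [v] from the smaller listed values, and [T] is so close to [px e] that maps with
   such a value are still below [w] there. For the maps with value [v] the choices are nested: [s2]
   before [b], which must stay below [k s2]; [b] before [a]; and [a] before [s1], since [k s1] must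
   stay below [a]. *)
have [w [uw wv wP]] := sep_left vs uv.
have [wi wiP] := K_fin w.
have [T [eT Te' TP]] := sep_right wi xx.
have [vs' vs'P] := K_fin (px e').
have [W [vW Wu' WP]] := sep_left vs' vu'.
have [s2 [es2 s2T _]] := sep_right [::] eT.
have [vs2 vs2P] := K_fin s2.
have [b [vb bW bP]] := sep_right vs2 vW.
have [a [va ab _]] := sep_right [::] vb.
have [ai aiP] := K_fin a.
have [s1 [es1 s12 s1P]] := sep_right ai es2.
have [t [et ts1 _]] := sep_right [::] es1.
have s2e' := lt_trans s2T Te'; have s1e' := lt_trans s12 s2e'.
have te' := lt_trans ts1 s1e'; have ua := lt_trans uv va.
have ub := lt_trans uv vb; have uW := lt_trans uv vW.
have bu' := lt_trans bW Wu'; have au' := lt_trans ab bu'.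
have wu' := lt_trans wv vu'; have wa := lt_trans wv va.
have wb := lt_trans wv vb; have wW := lt_trans wv vW.
pose l1 (k : autQ) := if w < k (px e) then pl e k else pl e' k.
pose l2 (k : autQ) := if `[< cclear k e e' >] then pl e k else
  if w < k (px e) then r1 else q.
pose l3 (k : autQ) := if `[< cclear k e e' >] then pl e k else
  if w < k (px e) then r2 else q.
pose d1 := CPt t w l1; pose d2 := CPt s1 a l2; pose d3 := CPt s2 b l3.
pose d4 := CPt T W (pl e').
have lcl k : cclear k e e' -> [/\ pl d1 k = pl e k, pl d2 k = pl e k,
    pl d3 k = pl e k & pl d4 k = pl e k].
  move=> cl; rewrite /= /l1 /l2 /l3; have [<- _] := cl.
  by rewrite if_same !asboolT.
(* Maps with value [v] carry the labels [p], [r1], [r2], [q] at the four points. Maps with a smaller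
   value lie below all four and carry [q] throughout, hence cross between [e] and [d1], where the
   induction hypothesis takes over. *)
have triP k : K k -> [\/ cclear k e e',
   [/\ pl e k = p, pl e' k = q, [/\ pl d1 k = p, pl d2 k = r1, pl d3 k = r2
     & pl d4 k = q], k (px e) = v & [/\ k s1 < a, b < k s2, w < k t, k T < W
     & k (px e') < W]] |
   [/\ pl e k = p, pl e' k = q, [/\ pl d1 k = q, pl d2 k = q, pl d3 k = q
     & pl d4 k = q], k (px e) \in vs & [/\ [/\ k t < w, k s1 < w, k s2 < w & k T < w],
       [/\ k s1 < a, k s2 < a, k s2 < b, k T < b & k T < W] & k (px e') < W]]].
  move=> Kk; have [cl|ncl] := pselect (cclear k e e'); first by constructor 1.
  have [//|[pe pe' kvs]] := tr _ Kk; have [ku ku'] := signs _ Kk pe pe'.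
  have kW : k (px e') < W by apply: WP => //; have [] := vs'P _ Kk.
  have kTe' : k T < k (px e') by rewrite autQ_lt_mono.
  rewrite /= /l1 /l2 /l3 !asboolF//.
  move: kvs; rewrite inE => /predU1P[kv|kvs]; [constructor 2|constructor 3].
    rewrite kv wv; split=> //; split=> //; last by rewrite (lt_trans kTe').
    - rewrite -autQ_gtV; apply: s1P; first by have [] := aiP _ Kk.
      by rewrite autQ_gtV kv.
    - by apply: bP; [have [] := vs2P _ Kk|rewrite -kv autQ_lt_mono].
    - by rewrite (lt_trans wv)// -kv autQ_lt_mono.
  have kw := wP _ kvs (vsv _ kvs).
  have kT : k T < w.
    rewrite -autQ_gtV; apply: TP; first by have [] := wiP _ Kk.
    by rewrite autQ_gtV.
  have k2 : k s2 < w by rewrite (lt_trans _ kT)// autQ_lt_mono.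
  have k1' : k s1 < w by rewrite (lt_trans _ k2)// autQ_lt_mono.
  have kt : k t < w by rewrite (lt_trans _ k1')// autQ_lt_mono.
  rewrite ltNge (ltW kw) /=; split=> //; split=> //; split=> //;
    by [exact: lt_trans wa|exact: lt_trans wb|exact: lt_trans wW].
have okd d : d \in [:: d1; d2; d3; d4] -> cok d.
  move=> dd; split; first by move: dd; rewrite !inE => /or4P[] /eqP -> /=;
    apply: Xbt.
    by move: dd; rewrite !inE => /or4P[] /eqP -> /=; apply: Ybt.
  move=> k Kk; have [Pe _] := okl _ Kk; have [Pe' _] := okl' _ Kk.
  case: (triP _ Kk) => [cl|[pe pe' [m1 m2 m3 m4] kv [h1 h2 h3 h4 h5]]
     |[pe pe' [m1 m2 m3 m4] kvs [[g1 g2 g3 g4] [h1 h2 h3 h4 h5] h6]]].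
  - have [m1 m2 m3 m4] := lcl _ cl.
    by move: dd; rewrite !inE => /or4P[] /eqP ->;
      (split; first by rewrite ?m1 ?m2 ?m3 ?m4);
      apply: (cclear_pt cl) => //=; exact: ltW.
  - rewrite pe in Pe; rewrite pe' in Pe'.
    by move: dd; rewrite !inE => /or4P[] /eqP ->;
      rewrite ?m1 ?m2 ?m3 ?m4 ?sp ?sq ?sr1 ?sr2.
  - rewrite pe in Pe; rewrite pe' in Pe'.
    by move: dd; rewrite !inE => /or4P[] /eqP ->;
      rewrite ?m1 ?m2 ?m3 ?m4 ?sp ?sq ?sr1 ?sr2.
have [|||||mid [pmid okmid] midP] := IH _ e d1 oke.
- exact: path_sorted srt.
- by apply: okd; rewrite !inE eqxx.
- by [].
- by [].
- move=> k Kk.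
  case: (triP _ Kk) => [cl|[pe _ [m1 _ _ _] kv _]|[pe _ [m1 _ _ _] kvs _]].
  + have [m1 _ _ _] := lcl _ cl; left.
    by apply: (cclear_sub cl) => //=; exact: ltW.
  + by left; split; rewrite ?m1 pe ?sp ?kv.
  + by right.
exists (mid ++ [:: d1; d2; d3; d4]).
  split; last by move=> d; rewrite mem_cat => /orP[/okmid|/okd].
  rewrite rcons_cat /= -cat_rcons cat_path pmid last_rcons /= andbT.
  apply/and4P; split; apply/asboolP; split => //=.
  - exists p, r1 => k Kk.
    case: (triP _ Kk) => [cl|[pe _ [m1 m2 _ _] kv _]|[pe _ [m1 m2 _ _] kvs [[g1 g2 g3 g4] [h1 h2 h3 h4 h5] h6]]].
    + have [m1 m2 _ _] := lcl _ cl; left.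
      by apply: (cclear_sub cl) => //=; exact: ltW.
    + by right; split; rewrite ?sp ?sr1.
    + by left; split; rewrite ?m1 ?m2 ?sq.
  - exists r1, r2 => k Kk.
    case: (triP _ Kk) => [cl|[pe _ [_ m1 m2 _] kv _]|[pe _ [_ m1 m2 _] kvs [[g1 g2 g3 g4] [h1 h2 h3 h4 h5] h6]]].
    + have [_ m1 m2 _] := lcl _ cl; left.
      by apply: (cclear_sub cl) => //=; exact: ltW.
    + by right; split; rewrite ?sr2 ?sr1.
    + by left; split; rewrite ?m1 ?m2 ?sq.
  - exists r2, q => k Kk.
    case: (triP _ Kk) => [cl|[pe _ [_ _ m1 m2] kv _]|[pe _ [_ _ m1 m2] kvs [[g1 g2 g3 g4] [h1 h2 h3 h4 h5] h6]]].
    + have [_ _ m1 m2] := lcl _ cl; left.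
      by apply: (cclear_sub cl) => //=; exact: ltW.
    + by right; split; rewrite ?sr2 ?sq.
    + by left; split; rewrite ?m1 ?m2 ?sq.
  - exists 0, 0 => k Kk; left.
    case: (triP _ Kk) => [cl|[pe pe' _ kv [_ _ _ _ h]]|[pe pe' _ kvs [_ _ h]]].
    + have [_ _ _ m] := lcl _ cl.
      apply: (cclear_sub cl) => //=; by [exact: ltW|have [->] := cl].
    + by split=> //=; rewrite pe' sq.
    + by split=> //=; rewrite pe' sq.
move=> k Kk.
case: (triP _ Kk) => [cl|[pe _ [_ m2 m3 _] kv _]|[pe _ [m1 _ _ _] kvs _]].
- by left.
- right; split; [exists d2|exists d3] => //;
    by rewrite mem_cat !inE eqxx ?orbT.
- right; have [[h _]|[[d dm dl] [d' dm' dl']]] := midP _ Kk.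
    by rewrite pe m1 in h; move: pq; rewrite h ltxx.
  by split; [exists d|exists d'] => //; rewrite mem_cat ?dm ?dm'.
Qed.

End InsertLabels.

(** * Exchange of the two coordinates *)

Section Transposition.

(** Since [u < k x] holds exactly if [k^-1 u < x], transposing the plane and inverting the maps
    complements all signs. Left and right are kept, so each statement for positive labels yields the
    one for negative labels. *)
Definition cpt_tr (e : cpt) := CPt (pu e) (px e) (fun k => pl e (k^-1)%g).
Definition set_inv (K : set autQ) : set autQ := [set k | K (k^-1)%g].

Lemma cpt_trK : involutive cpt_tr.
Proof.
by case=> x u l; rewrite /cpt_tr /=; congr CPt; apply/funext => k; rewrite invgK.
Qed.

Lemma set_invK : involutive set_inv.
Proof. by move=> K; apply/funext => k; rewrite /set_inv /= invgK. Qed.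

Lemma finite_valued_inv K : finite_valued K -> finite_valued (set_inv K).
Proof.
move=> h q; have [vs vsP] := h q; exists vs => k /vsP.
by rewrite invgK => -[].
Qed.

Variables (X Y P : set rat) (s : rat -> bool) (K : set autQ).

Lemma cok_tr e : cok X Y P s K e -> cok Y X P (negb \o s) (set_inv K) (cpt_tr e).
Proof.
move=> [Xe Ye h]; split=> // k /h[Pl]; split=> //=.
by case: (s (pl e _)) b => /=; rewrite ?autQ_gtV ?autQ_ltV.
Qed.

Lemma cclear_tr k e e' : cclear s (k^-1)%g e e' ->
  cclear (negb \o s) k (cpt_tr e) (cpt_tr e').
Proof.
move=> [h1]; split=> //=.
by case: (s (pl e _)) b => /=; rewrite ?autQ_gtV ?autQ_ltV.
Qed.

Lemma cstep_tr e e' : cstep s K e e' ->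
  cstep (negb \o s) (set_inv K) (cpt_tr e) (cpt_tr e').
Proof.
move=> [xx uu [p [q h]]]; split=> //; exists p, q => k /h[/cclear_tr|]; first by left.
by case=> h1 h2 h3 h4; right; split=> //=; rewrite h4.
Qed.

End Transposition.

Lemma cstep_trb s K : {homo cpt_tr : e e' / cstepb s K e e' >->
  cstepb (negb \o s) (set_inv K) e e'}.
Proof. by move=> e e' /asboolP h; apply/asboolP; exact: cstep_tr. Qed.

Lemma negb_negb (s : rat -> bool) : negb \o (negb \o s) = s.
Proof. by apply/funext => x /=; rewrite negbK. Qed.

Lemma cok_untr X Y P s K e : cok Y X P (negb \o s) (set_inv K) e ->
  cok X Y P s K (cpt_tr e).
Proof. by move=> /cok_tr; rewrite negb_negb set_invK. Qed.

Lemma cstep_untr s K e e' : cstep (negb \o s) (set_inv K) e e' ->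
  cstep s K (cpt_tr e) (cpt_tr e').
Proof. by move=> /cstep_tr; rewrite negb_negb set_invK. Qed.

Lemma cmid_tr X Y P s K e mid e' :
  cmid Y X P (negb \o s) (set_inv K) (cpt_tr e) mid (cpt_tr e') ->
  cmid X Y P s K e (map cpt_tr mid) e'.
Proof.
move=> [pm okm]; split.
  have := homo_path (@cstep_trb (negb \o s) (set_inv K)) pm.
  by rewrite negb_negb set_invK map_rcons !cpt_trK.
move=> d /mapP[d' /okm /cok_tr]; rewrite negb_negb set_invK => h -> //.
Qed.

Section Insertion.
Variables (X Y P : set rat) (s : rat -> bool) (K : set autQ).
Hypothesis X_int : open_interval X.
Hypothesis Y_int : open_interval Y.
Hypothesis K_fin : finite_valued K.

Local Notation cok := (cok X Y P s K).
Local Notation cstep := (cstep s K).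
Local Notation cmid := (cmid X Y P s K).

Lemma cstep_pstep e e' : cstep e e' -> (exists p q, pstep s K p q e e') \/
  (exists p q, pstep (negb \o s) (set_inv K) p q (cpt_tr e) (cpt_tr e')).
Proof.
move=> [xx uu [p [q h]]]; case sp : (s p).
  left; exists p, q; split=> // k /h[|[? ? ? sq]]; first by left.
  by right; split=> //; rewrite sq sp.
right; exists p, q; split=> // k /h[/cclear_tr|[? ? ? sq]]; first by left.
by right; split=> //=; rewrite ?sq ?sp.
Qed.

Lemma insert_px e e' (x : rat) : cok e -> cok e' -> cstep e e' ->
  px e < x -> x < px e' -> exists2 mid, cmid e mid e' &
    exists2 d, d \in mid & px d = x.
Proof.
move=> oke oke' /cstep_pstep[[p [q h]]|[p [q h]]] ex xe'.
  exact: insert_px_pos h ex xe'.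
have [mid mP [d dm dx]] := insert_pu_pos Y_int X_int (finite_valued_inv K_fin)
  (cok_tr oke) (cok_tr oke') h ex xe'.
exists (map cpt_tr mid); first exact: cmid_tr mP.
by exists (cpt_tr d); rewrite ?map_f.
Qed.

Lemma insert_pu e e' (u : rat) : cok e -> cok e' -> cstep e e' ->
  pu e < u -> u < pu e' -> exists2 mid, cmid e mid e' &
    exists2 d, d \in mid & pu d = u.
Proof.
move=> oke oke' /cstep_pstep[[p [q h]]|[p [q h]]] ex xe'.
  exact: insert_pu_pos h ex xe'.
have [mid mP [d dm dx]] := insert_px_pos Y_int X_int (finite_valued_inv K_fin)
  (cok_tr oke) (cok_tr oke') h ex xe'.
exists (map cpt_tr mid); first exact: cmid_tr mP.
by exists (cpt_tr d); rewrite ?map_f.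
Qed.

End Insertion.

Section InsertLabel.
Variable E : rat -> rat -> Prop.
Hypothesis E_sym : forall p q, E p q -> E q p.

Definition alternating_on (P : set rat) (s : rat -> bool) := forall p q,
  P p -> P q -> p < q -> ~ E p q -> s p = s q ->
  exists r, [/\ p < r, r < q, P r & s r = ~~ s p].

(** The zigzag needs a negative and then a positive label between [p] and [q]. One of them is [r];
    alternation supplies the other, between [p] and [r] if [r] is positive and between [r] and [q]
    if it is negative. *)
Let insert_label_pos X Y P s K p q r e e' :
  open_interval X -> open_interval Y -> finite_valued K -> alternating_on P s ->
  P p -> P q -> P r -> p < r -> r < q -> ~ E p r -> ~ E r q ->
  cok X Y P s K e -> cok X Y P s K e' -> s p -> s q = ~~ s p ->
  pstep s K p q e e' -> exists2 mid, cmid X Y P s K e mid e' &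
    forall k, K k -> pl e k < r -> r < pl e' k ->
      exists2 d, d \in mid & E (pl d k) r \/ pl d k = r.
Proof.
move=> X_int Y_int K_fin alt Pp Pq Pr pr rq nEp nEq oke oke' sp sq [xx uu tr].
have [r1 [r2 [[sr1 sr2 Pr1 Pr2] [pr1 r12 r2q] rr]]] : exists r1 r2,
    [/\ [/\ ~~ s r1, s r2, P r1 & P r2], [/\ p < r1, r1 < r2 & r2 < q] &
      r = r1 \/ r = r2].
  case sr : (s r).
    have [|r1 [h1 h2 h3 h4]] := alt _ _ Pp Pr pr nEp; first by rewrite sp sr.
    by exists r1, r; rewrite h4 sp; split=> //; right.
  have [|r2 [h1 h2 h3 h4]] := alt _ _ Pr Pq rq nEq; first by rewrite sq sp sr.
  by exists r, r2; rewrite h4 sr; split=> //; left.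
have [vs vsP] := K_fin (px e).
have nsq : ~~ s q by rewrite sq sp.
have [||mid mP mL] := insert_labels_pos X_int Y_int K_fin sp sr1 sr2 nsq pr1 r12 r2q Pr1
  Pr2 (vs := rev (sort <=%R (undup vs))) _ oke oke' xx uu.
- rewrite rev_sorted; apply: (@sub_sorted _ <%R) => //.
  by rewrite sort_lt_sorted undup_uniq.
- move=> k Kk; have [|[? ? ? ? ?]] := tr _ Kk; [by left|right].
  by split=> //; rewrite mem_rev mem_sort mem_undup; have [] := vsP _ Kk.
exists mid => // k Kk e_r r_e'.
have [[h _]|[[d1 dm1 dl1] [d2 dm2 dl2]]] := mL _ Kk.
  by move: (lt_trans e_r r_e'); rewrite h ltxx.
by case: rr => ->; [exists d1|exists d2] => //; right.
Qed.

(** A label is skipped only by maps that cross the box, and they all cross from [p] to [q]. If [r]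
    is equivalent to [p] or [q], an end point already carries it; otherwise the zigzag applies,
    after transposition if [p] is negative. *)
Lemma insert_label X Y P s K r e e' :
  open_interval X -> open_interval Y -> finite_valued K -> alternating_on P s ->
  P r -> cok X Y P s K e -> cok X Y P s K e' -> cstep s K e e' ->
  exists2 mid, cmid X Y P s K e mid e' &
    forall k, K k -> pl e k < r -> r < pl e' k ->
      exists2 d, d \in e :: rcons mid e' & E (pl d k) r \/ pl d k = r.
Proof.
move=> X_int Y_int K_fin alt Pr oke oke' st.
have triv Q : Q -> (Q -> forall k, K k -> pl e k < r -> r < pl e' k ->
      exists2 d, d \in [:: e; e'] & E (pl d k) r \/ pl d k = r) ->
   exists2 mid, cmid X Y P s K e mid e' &
    forall k, K k -> pl e k < r -> r < pl e' k ->
      exists2 d, d \in e :: rcons mid e' & E (pl d k) r \/ pl d k = r.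
  move=> HQ H; exists [::]; last exact: H.
  by split=> //=; rewrite andbT; apply/asboolP.
have [xx uu [p [q h]]] := st.
have [[k0 [Kk0 h1 h2]]|nk] := pselect (exists k, [/\ K k, pl e k < r & r < pl e' k]);
    last first.
  by apply: (triv True) => // _ k Kk er re'; exfalso; apply: nk; exists k.
have trk k : K k -> pl e k < r -> r < pl e' k -> ctrav s p q k e e'.
  move=> Kk er re'; have [[h3 _]|//] := h _ Kk.
  by move: (lt_trans er re'); rewrite h3 ltxx.
have [pe pe' pq sq] := trk _ Kk0 h1 h2; rewrite pe in h1; rewrite pe' in h2.
have [Epr|nEpr] := pselect (E p r).
  apply: (triv (E p r)) => // _ k Kk er re'.
  by exists e; rewrite ?inE ?eqxx; [|left; have [->] := trk _ Kk er re'].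
have [Erq|nErq] := pselect (E r q).
  apply: (triv (E r q)) => // _ k Kk er re'.
  exists e'; rewrite ?inE ?eqxx ?orbT//.
  by left; apply: E_sym; have [_ ->] := trk _ Kk er re'.
have Pp : P p by rewrite -pe; have [_ _ /(_ _ Kk0)[]] := oke.
have Pq : P q by rewrite -pe'; have [_ _ /(_ _ Kk0)[]] := oke'.
have wk mid k : (exists2 d, d \in mid & E (pl d k) r \/ pl d k = r) ->
    exists2 d, d \in e :: rcons mid e' & E (pl d k) r \/ pl d k = r.
  by move=> [d dm dE]; exists d => //; rewrite inE mem_rcons inE dm !orbT.
case sp : (s p).
  have [|mid mP mL] := insert_label_pos (s := s) X_int Y_int K_fin alt Pp Pq Pr h1 h2 nEpr nErq
    oke oke' sp sq.
    split=> // k /h[|[]]; first by left.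
    by right; split=> //; rewrite sq sp.
  by exists mid => // k Kk er re'; apply/wk/mL.
have alt' : alternating_on P (negb \o s).
  move=> a b Pa Pb ab nab /= /negb_inj sab; have [c [? ? ? sc]] := alt _ _ Pa Pb ab nab sab.
  by exists c; split=> //=; rewrite sc.
have [|||mid mP mL] := insert_label_pos (s := negb \o s) Y_int X_int
  (finite_valued_inv K_fin) alt' Pp Pq Pr h1 h2 nEpr nErq (cok_tr oke) (cok_tr oke').
- by rewrite /= sp.
- by rewrite /= sq.
- split=> // k /h[/cclear_tr|[]]; first by left.
  by right; split=> //=; rewrite ?sq ?sp.
exists (map cpt_tr mid); first exact: cmid_tr mP.
move=> k Kk er re'; apply: wk.
have [|||d dm dE] := mL (k^-1)%g.
- by rewrite /set_inv /= invgK.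
- by rewrite /= invgK.
- by rewrite /= invgK.
by exists (cpt_tr d) => //; rewrite map_f.
Qed.

End InsertLabel.

Section Reach.
Variables (X Y P : set rat) (s : rat -> bool) (K : set autQ).

Local Notation cok := (cok X Y P s K).
Local Notation cstep := (cstep s K).
Local Notation cmid := (cmid X Y P s K).

Lemma cmid_nil e e' : cmid e [::] e' <-> cstep e e'.
Proof.
split=> [[/= /andP[/asboolP]]//|h]; split=> //=.
by rewrite andbT; apply/asboolP.
Qed.

Lemma cmid_cons e d mid e' :
  cmid e (d :: mid) e' <-> [/\ cstep e d, cok d & cmid d mid e'].
Proof.
split=> [[/= /andP[/asboolP h1 h2] h3]|[h1 h2 [h3 h4]]].
  split=> //; first by apply: h3; rewrite inE eqxx.
  by split=> // c cm; apply: h3; rewrite inE cm orbT.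
split; first by rewrite /= h3 andbT; apply/asboolP.
by move=> c; rewrite inE => /predU1P[->|/h4].
Qed.

Lemma cmid_cat e m1 d m2 e' : cmid e m1 d -> cok d -> cmid d m2 e' ->
  cmid e (m1 ++ d :: m2) e'.
Proof.
move=> [h1 h2] okd [h3 h4]; split.
  by rewrite rcons_cat /= -cat_rcons cat_path h1 last_rcons.
by move=> c; rewrite mem_cat inE => /or3P[/h2|/eqP ->|/h4].
Qed.

(* Discrete intermediate value principle: every consecutive pair is refined, and
   any [t] between the end values of [g] is caught by one of the pairs. *)
Lemma refine_all (I : Type) (Z : I -> cpt -> cpt -> cpt -> Prop) :
  (forall d d', cok d -> cok d' -> cstep d d' -> exists2 mid, cmid d mid d' &
     forall i, exists2 c, c \in d :: rcons mid d' & Z i d d' c) ->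
  forall mid e e', cok e -> cok e' -> cmid e mid e' ->
  exists mid', [/\ cmid e mid' e', {subset mid <= mid'} &
    forall i (g : cpt -> rat) t, g e <= t -> t <= g e' -> exists d d' c,
      [/\ g d <= t, t <= g d', c \in e :: rcons mid' e' & Z i d d' c]].
Proof.
move=> HZ; elim=> [|d mid IH] e e' oke oke'.
  move=> /cmid_nil /(HZ _ _ oke oke')[mid mP hZ]; exists mid; split=> //.
  by move=> i g t h1 h2; have [c cm cZ] := hZ i; exists e, e', c.
move=> /cmid_cons[st okd mP].
have [m1 m1P hZ] := HZ _ _ oke okd st.
have [m2 [m2P sub IHZ]] := IH _ _ okd oke' mP.
exists (m1 ++ d :: m2); split.
- exact: cmid_cat.
- move=> c; rewrite mem_cat !inE => /predU1P[->|/sub ->]; rewrite ?eqxx ?orbT//.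
- move=> i g t h1 h2; have [h|h] := leP t (g d).
    have [c cm cZ] := hZ i; exists e, d, c; split=> //; move: cm.
    rewrite !inE mem_rcons rcons_cat mem_cat mem_rcons !inE.
    by case/or3P => ->; rewrite ?orbT.
  have [d1 [d2 [c [g1 g2 cm cZ]]]] := IHZ i g t (ltW h) h2.
  exists d1, d2, c; split=> //; move: cm.
  by rewrite !inE mem_rcons rcons_cat /= mem_cat !inE mem_rcons !inE =>
    /or3P[] ->; rewrite ?orbT.
Qed.

End Reach.

Definition cconst (K : set autQ) e p := forall k, K k -> pl e k = p.

Lemma cconst_tr K e p : cconst K e p -> cconst (set_inv K) (cpt_tr e) p.
Proof. by move=> h k Kk; apply: h. Qed.

Lemma cconst_untr K e p : cconst (set_inv K) e p -> cconst K (cpt_tr e) p.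
Proof. by move=> /cconst_tr; rewrite set_invK. Qed.

(** * Prolonging a chain at its ends *)

Section EndMoves.
Variables (X Y P : set rat) (s : rat -> bool) (K : set autQ).
Hypothesis X_int : open_interval X.
Hypothesis Y_int : open_interval Y.
Hypothesis K_fin : finite_valued K.
Hypothesis KXY : forall k, K k -> forall x, X x <-> Y (k x).

Local Notation cok := (cok X Y P s K).
Local Notation cstep := (cstep s K).

Let X_conv x y z : X x -> X z -> x <= y <= z -> X y.
Proof. by move=> ? ? ?; have [_ c _ _] := X_int; exact: (c x y z). Qed.

Let Y_conv x y z : Y x -> Y z -> x <= y <= z -> Y y.
Proof. by move=> ? ? ?; have [_ c _ _] := Y_int; exact: (c x y z). Qed.

(** Take any abscissa [x] to the right and then a height above the finitely many values there. *)
Lemma right_change_pos e p q : cok e -> cconst K e p -> s p -> s q = ~~ s p ->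
  p < q -> P q -> exists e', [/\ cok e', cstep e e' & cconst K e' q].
Proof.
move=> [Xe Ye okl] ep sp sq pq Pq.
have [_ _ _ nub] := X_int; have [x Xx ex] := nub _ Xe.
have [vs vsP] := K_fin x.
have [u Yu uP] := open_interval_ub (pu e :: vs) Y_int.
exists (CPt x u (fun=> q)); split=> //.
  split=> // k Kk; split=> //=; rewrite sq sp /=; apply: uP.
    by rewrite inE; have [->] := vsP _ Kk; rewrite orbT.
  exact/KXY.
split=> //=; first by apply: uP; rewrite ?inE ?eqxx.
by exists p, q => k Kk; right; split=> //=; rewrite ep.
Qed.

(** The order of choice is opposite to that on the right: first a height [u], then an abscissa to
    the left of all preimages of [u]. *)
Lemma left_change_pos e p q : cok e -> cconst K e p -> s p -> s q = ~~ s p ->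
  q < p -> P q -> exists e', [/\ cok e', cstep e' e & cconst K e' q].
Proof.
move=> [Xe Ye okl] ep sp sq pq Pq.
have [_ _ nlb _] := Y_int; have [u Yu ue] := nlb _ Ye.
have [vs vsP] := K_fin u.
have [x Xx xP] := open_interval_lb (px e :: vs) X_int.
exists (CPt x u (fun=> q)); split=> //.
  split=> // k Kk; split=> //=; rewrite sq sp /=; rewrite -autQ_gtV; apply: xP.
    by rewrite inE; have [_ ->] := vsP _ Kk; rewrite orbT.
  by apply/(KXY Kk); rewrite autQVK.
split=> //=; first by apply: xP; rewrite ?inE ?eqxx.
by exists q, p => k Kk; right; split=> //=; rewrite ?ep// sq negbK.
Qed.

(** One box would not do: all maps must clear it, while its top is to pass [us]. So first move far
    to the right at a height just above [pu e], beyond all preimages of [U], and then climb to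
    [U]. *)
Lemma right_extend_pos e p xs us : cok e -> cconst K e p -> s p -> P p ->
  X xs -> Y us -> exists d e', [/\ cok d, cok e', cstep e d, cstep d e' &
    [/\ cconst K e' p, xs < px e' & us < pu e']].
Proof.
move=> [Xe Ye okl] ep sp Pp Xxs Yus.
have [U YU UP] := open_interval_ub [:: us; pu e] Y_int.
have uU : pu e < U by apply: UP; rewrite ?inE ?eqxx ?orbT.
have [wi wiP] := K_fin U.
have [x' Xx' x'P] := open_interval_ub [:: xs, px e & wi] X_int.
have ex' : px e < x' by apply: x'P; rewrite ?inE ?eqxx ?orbT.
have [_ _ _ nub] := X_int; have [x'' Xx'' x''x'] := nub _ Xx'.
have [vs vsP] := K_fin (px e).
have [u1 [eu1 u1U u1P]] := sep_right vs uU.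
have u1k k : K k -> u1 < k (px e).
  move=> Kk; apply: u1P; first by have [] := vsP _ Kk.
  by have [_] := okl _ Kk; rewrite ep// sp.
have Uk k : K k -> U < k x'.
  move=> Kk; rewrite -autQ_ltV; apply: x'P.
    by rewrite !inE; have [_ ->] := wiP _ Kk; rewrite !orbT.
  by apply/(KXY Kk); rewrite autQVK.
have Yu1 : Y u1 by apply: Y_conv Ye YU _; rewrite !ltW.
exists (CPt x' u1 (fun=> p)), (CPt x'' U (fun=> p)); split=> /=.
- split=> // k Kk; split=> //=.
  by rewrite sp (lt_trans (u1k _ Kk))// autQ_lt_mono.
- by split=> // k Kk; split=> //=; rewrite sp (lt_trans (Uk _ Kk))// autQ_lt_mono.
- split=> //; exists 0, 0 => k Kk; left; split; rewrite /= ?ep//.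
  by rewrite sp u1k.
- by split=> //; exists 0, 0 => k Kk; left; split; rewrite //= sp Uk.
- split=> //; last by apply: UP; rewrite ?inE ?eqxx.
  by rewrite (lt_trans _ x''x')//; apply: x'P; rewrite ?inE ?eqxx.
Qed.

(** Going left, first drop below the values at [x2] while moving only to [x1], near enough to [px e]
    for the maps to stay above [pu e]; then move left to [x2]. *)
Lemma left_extend_pos e p xs us : cok e -> cconst K e p -> s p -> P p ->
  X xs -> Y us -> exists d e', [/\ cok d, cok e', cstep e' d, cstep d e &
    [/\ cconst K e' p, px e' < xs & pu e' < us]].
Proof.
move=> [Xe Ye okl] ep sp Pp Xxs Yus.
have [x2 Xx2 x2P] := open_interval_lb [:: xs; px e] X_int.
have x2e : x2 < px e by apply: x2P; rewrite ?inE ?eqxx ?orbT.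
have [vs vsP] := K_fin x2.
have [u1 Yu1 u1P] := open_interval_lb [:: us, pu e & vs] Y_int.
have u1e : u1 < pu e by apply: u1P; rewrite ?inE ?eqxx ?orbT.
have [_ _ nlb _] := Y_int; have [u2 Yu2 u2u1] := nlb _ Yu1.
have [wi wiP] := K_fin (pu e).
have [x1 [x2x1 x1e x1P]] := sep_left wi x2e.
have ek k : K k -> pu e < k x1.
  move=> Kk; rewrite -autQ_ltV; apply: x1P; first by have [] := wiP _ Kk.
  by rewrite autQ_ltV; have [_] := okl _ Kk; rewrite ep// sp.
have uk k : K k -> u1 < k x2.
  move=> Kk; apply: u1P.
    by rewrite !inE; have [->] := vsP _ Kk; rewrite !orbT.
  exact/KXY.
have Xx1 : X x1 by apply: X_conv Xx2 Xe _; rewrite !ltW.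
exists (CPt x1 u1 (fun=> p)), (CPt x2 u2 (fun=> p)); split=> /=.
- split=> // k Kk; split=> //=.
  by rewrite sp (lt_trans _ (ek _ Kk)).
- by split=> // k Kk; split=> //=; rewrite sp (lt_trans u2u1)// uk.
- by split=> //; exists 0, 0 => k Kk; left; split; rewrite //= sp uk.
- split=> //; exists 0, 0 => k Kk; left; split; rewrite /= ?ep//.
  by rewrite sp ek.
- split=> //; first by apply: x2P; rewrite ?inE ?eqxx.
  by rewrite (lt_trans u2u1)//; apply: u1P; rewrite ?inE ?eqxx.
Qed.

End EndMoves.

Section Ends.
Variables (X Y P : set rat) (s : rat -> bool) (K : set autQ).
Hypothesis X_int : open_interval X.
Hypothesis Y_int : open_interval Y.
Hypothesis K_fin : finite_valued K.
Hypothesis KXY : forall k, K k -> forall x, X x <-> Y (k x).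

Local Notation cok := (cok X Y P s K).
Local Notation cstep := (cstep s K).
Local Notation cmid := (cmid X Y P s K).

Let KYX k : set_inv K k -> forall y, Y y <-> X (k y).
Proof. by move=> Kk y; rewrite (KXY Kk) autQK. Qed.

Let K_fin' := finite_valued_inv K_fin.

Lemma right_change e p q : cok e -> cconst K e p -> s q = ~~ s p ->
  p < q -> P q -> exists e', [/\ cok e', cstep e e' & cconst K e' q].
Proof.
move=> oke ep sq pq Pq; case sp : (s p).
  by apply: right_change_pos ep _ sq pq Pq => //; rewrite sp.
have [||e' [h1 h2 h3]] := right_change_pos (s := negb \o s) Y_int X_int K_fin' KYX (cok_tr oke)
  (cconst_tr ep) _ _ pq Pq; rewrite /= ?sq ?sp//.
exists (cpt_tr e'); split; [exact: cok_untr| |exact: cconst_untr].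
by rewrite -(cpt_trK e); exact: cstep_untr.
Qed.

Lemma left_change e p q : cok e -> cconst K e p -> s q = ~~ s p ->
  q < p -> P q -> exists e', [/\ cok e', cstep e' e & cconst K e' q].
Proof.
move=> oke ep sq pq Pq; case sp : (s p).
  by apply: left_change_pos ep _ sq pq Pq => //; rewrite sp.
have [||e' [h1 h2 h3]] := left_change_pos (s := negb \o s) Y_int X_int K_fin' KYX (cok_tr oke)
  (cconst_tr ep) _ _ pq Pq; rewrite /= ?sq ?sp//.
exists (cpt_tr e'); split; [exact: cok_untr| |exact: cconst_untr].
by rewrite -(cpt_trK e); exact: cstep_untr.
Qed.

Lemma right_extend e p xs us : cok e -> cconst K e p -> P p ->
  X xs -> Y us -> exists d e', [/\ cok d, cok e', cstep e d, cstep d e' &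
    [/\ cconst K e' p, xs < px e' & us < pu e']].
Proof.
move=> oke ep Pp Xxs Yus; case sp : (s p).
  by apply: right_extend_pos ep _ Pp Xxs Yus => //; rewrite sp.
have [|d [e' [h1 h2 h3 h4 [h5 h6 h7]]]] := right_extend_pos (s := negb \o s) Y_int X_int K_fin' KYX
  (cok_tr oke) (cconst_tr ep) _ Pp Yus Xxs; first by rewrite /= sp.
exists (cpt_tr d), (cpt_tr e'); split.
- exact: cok_untr.
- exact: cok_untr.
- by rewrite -(cpt_trK e); exact: cstep_untr.
- exact: cstep_untr.
- by split=> //; exact: cconst_untr.
Qed.

Lemma left_extend e p xs us : cok e -> cconst K e p -> P p ->
  X xs -> Y us -> exists d e', [/\ cok d, cok e', cstep e' d, cstep d e &
    [/\ cconst K e' p, px e' < xs & pu e' < us]].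
Proof.
move=> oke ep Pp Xxs Yus; case sp : (s p).
  by apply: left_extend_pos ep _ Pp Xxs Yus => //; rewrite sp.
have [|d [e' [h1 h2 h3 h4 [h5 h6 h7]]]] := left_extend_pos (s := negb \o s) Y_int X_int K_fin' KYX
  (cok_tr oke) (cconst_tr ep) _ Pp Yus Xxs; first by rewrite /= sp.
exists (cpt_tr d), (cpt_tr e'); split.
- exact: cok_untr.
- exact: cok_untr.
- exact: cstep_untr.
- by rewrite -(cpt_trK e); exact: cstep_untr.
- by split=> //; exact: cconst_untr.
Qed.

Variable E : rat -> rat -> Prop.
Hypothesis E_sym : forall p q, E p q -> E q p.
Hypothesis alt : alternating_on E P s.

(** A label change must reverse the sign. If [r] has the sign of [p], alternation inserts a label of
    the other sign and two changes lead to [r]. *)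
Lemma right_end e p xs us r : cok e -> cconst K e p -> P p -> X xs -> Y us ->
  P r -> exists e' p' mid, [/\ cok e', cmid e mid e', cconst K e' p' &
    [/\ P p', xs < px e', us < pu e' & r <= p' \/ E p' r]].
Proof.
move=> oke ep Pp Xxs Yus Pr.
have fin e1 p1 : cok e1 -> cconst K e1 p1 -> P p1 -> r <= p1 \/ E p1 r ->
    exists e' p' mid, [/\ cok e', cmid e1 mid e', cconst K e' p' &
    [/\ P p', xs < px e', us < pu e' & r <= p' \/ E p' r]].
  move=> ok1 c1 P1 r1.
  have [d [e' [h1 h2 h3 h4 [h5 h6 h7]]]] := right_extend ok1 c1 P1 Xxs Yus.
  exists e', p1, [:: d]; split=> //; apply/cmid_cons; split=> //.
  exact/cmid_nil.
have app e1 : cok e1 -> cstep e e1 -> (exists e' p' mid,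
    [/\ cok e', cmid e1 mid e', cconst K e' p' &
    [/\ P p', xs < px e', us < pu e' & r <= p' \/ E p' r]]) ->
    exists e' p' mid, [/\ cok e', cmid e mid e', cconst K e' p' &
    [/\ P p', xs < px e', us < pu e' & r <= p' \/ E p' r]].
  move=> ok1 st [e' [p' [mid [h1 h2 h3 h4]]]]; exists e', p', (e1 :: mid).
  by split=> //; apply/cmid_cons.
have [rp|pr] := leP r p; first by apply: (fin e p) => //; left.
have [Epr|nEpr] := pselect (E p r); first by apply: (fin e p) => //; right.
have [srp|srp] := boolP (s r == ~~ s p).
  have [e1 [h1 h2 h3]] := right_change oke ep (eqP srp) pr Pr.
  by apply: (app e1) => //; apply: (fin e1 r) => //; left.
have spr : s p = s r by move: srp; case: (s p); case: (s r).
have [r' [pr' r'r Pr' sr']] := alt Pp Pr pr nEpr spr.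
have [e1 [h1 h2 h3]] := right_change oke ep sr' pr' Pr'.
have sr : s r = ~~ s r' by rewrite sr' negbK.
have [e2 [h4 h5 h6]] := right_change h1 h3 sr r'r Pr.
apply: (app e1) => //.
have [|e' [p' [mid [g1 g2 g3 g4]]]] := fin e2 r h4 h6 Pr; first by left.
exists e', p', (e2 :: mid); split=> //.
by apply/cmid_cons.
Qed.

Lemma left_end e p xs us r : cok e -> cconst K e p -> P p -> X xs -> Y us ->
  P r -> exists e' p' mid, [/\ cok e', cmid e' mid e, cconst K e' p' &
    [/\ P p', px e' < xs, pu e' < us & p' <= r \/ E p' r]].
Proof.
move=> oke ep Pp Xxs Yus Pr.
have fin e1 p1 : cok e1 -> cconst K e1 p1 -> P p1 -> p1 <= r \/ E p1 r ->
    exists e' p' mid, [/\ cok e', cmid e' mid e1, cconst K e' p' &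
    [/\ P p', px e' < xs, pu e' < us & p' <= r \/ E p' r]].
  move=> ok1 c1 P1 r1.
  have [d [e' [h1 h2 h3 h4 [h5 h6 h7]]]] := left_extend ok1 c1 P1 Xxs Yus.
  exists e', p1, [:: d]; split=> //; apply/cmid_cons; split=> //.
  exact/cmid_nil.
have app e1 : cok e1 -> cstep e1 e -> (exists e' p' mid,
    [/\ cok e', cmid e' mid e1, cconst K e' p' &
    [/\ P p', px e' < xs, pu e' < us & p' <= r \/ E p' r]]) ->
    exists e' p' mid, [/\ cok e', cmid e' mid e, cconst K e' p' &
    [/\ P p', px e' < xs, pu e' < us & p' <= r \/ E p' r]].
  move=> ok1 st [e' [p' [mid [h1 h2 h3 h4]]]]; exists e', p', (mid ++ [:: e1]).
  split=> //; apply: cmid_cat h2 ok1 _; exact/cmid_nil.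
have [rp|pr] := leP p r; first by apply: (fin e p) => //; left.
have [Epr|nEpr] := pselect (E r p).
  by apply: (fin e p) => //; right; exact: E_sym.
have [srp|srp] := boolP (s r == ~~ s p).
  have [e1 [h1 h2 h3]] := left_change oke ep (eqP srp) pr Pr.
  by apply: (app e1) => //; apply: (fin e1 r) => //; left.
have spr : s r = s p by move: srp; case: (s p); case: (s r).
have [r' [pr' r'r Pr' sr']] := alt Pr Pp pr nEpr spr.
rewrite spr in sr'.
have [e1 [h1 h2 h3]] := left_change oke ep sr' r'r Pr'.
have sr : s r = ~~ s r' by rewrite sr' negbK.
have [e2 [h4 h5 h6]] := left_change h1 h3 sr pr' Pr.
apply: (app e1) => //.
have [|e' [p' [mid [g1 g2 g3 g4]]]] := fin e2 r h4 h6 Pr; first by left.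
exists e', p', (mid ++ [:: e2]); split=> //.
by apply: cmid_cat g2 h4 _; exact/cmid_nil.
Qed.

End Ends.

Lemma sorted_trichotomy (T : eqType) (r : rel T) (l : seq T) : transitive r ->
  sorted r l -> forall x y, x \in l -> y \in l -> [\/ x = y, r x y | r y x].
Proof.
move=> rt; elim: l => [//|a l IH] /= pl x y; rewrite !inE.
have /allP al := order_path_min rt pl.
move=> /predU1P[->|xl] /predU1P[->|yl]; first by constructor 1.
- by constructor 2; exact: al.
- by constructor 3; exact: al.
- by apply: IH => //; exact: path_sorted pl.
Qed.

(** * The limit of the chains *)

Record cstate := CState {c0 : cpt; cm : seq cpt; c1 : cpt}.
Definition cpts c := c0 c :: rcons (cm c) (c1 c).

Section Limit.
Variables (f : autQ) (X Y P : set rat) (K : set autQ).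
Let s (p : rat) := p < f p.
Let E := same_orbital f.
Hypothesis X_int : open_interval X.
Hypothesis Y_int : open_interval Y.
Hypothesis P_int : open_interval P.
Hypothesis K_fin : finite_valued K.
Hypothesis KXY : forall k, K k -> forall x, X x <-> Y (k x).
Hypothesis alt : alternating_on E P s.

Local Notation cok := (cok X Y P s K).
Local Notation cstep := (cstep s K).
Local Notation cmid := (cmid X Y P s K).

Let E_refl := same_orbital_refl f.
Let E_sym := same_orbital_sym (f := f).

Let E_s p q : E p q -> s p = s q.
Proof. by move=> /same_orbital_sg; rewrite /s -!sg_at1 => ->. Qed.

(** Labels constant over [K] at both ends allow one new end point to serve all maps. *)
Definition cgood c := [/\ cok (c0 c), cok (c1 c), cmid (c0 c) (cm c) (c1 c),
  exists2 p, P p & cconst K (c0 c) p & exists2 p, P p & cconst K (c1 c) p].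

Definition ccovers t c := [/\ X t -> exists2 d, d \in cpts c & px d = t,
  Y t -> exists2 d, d \in cpts c & pu d = t &
  P t -> forall k, K k -> exists2 d, d \in cpts c & E (pl d k) t].

Lemma cgood_cok c d : cgood c -> d \in cpts c -> cok d.
Proof.
move=> [h0 h1 [_ hm] _ _]; rewrite inE mem_rcons inE.
by case/or3P => [/eqP ->|/eqP ->|/hm].
Qed.

Let sub_pts (e : cpt) mid mid' e' : {subset mid <= mid'} ->
  {subset e :: rcons mid e' <= e :: rcons mid' e'}.
Proof.
move=> h d; rewrite !inE !mem_rcons !inE => /or3P[->|->|/h ->]; by rewrite ?orbT.
Qed.

Let triv_mid d d' : cstep d d' -> cmid d [::] d'.
Proof. by move=> h; apply/cmid_nil. Qed.

Lemma refine_px (t : rat) e mid e' : cok e -> cok e' -> cmid e mid e' ->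
  px e <= t -> t <= px e' -> exists mid', [/\ cmid e mid' e',
    {subset mid <= mid'} & exists2 d, d \in e :: rcons mid' e' & px d = t].
Proof.
move=> oke oke' mP h1 h2.
have [|mid' [m1 m2 m3]] := @refine_all X Y P s K unit
    (fun _ d d' c => px d <= t -> t <= px d' -> px c = t) _ _ _ _ oke oke' mP.
  move=> d d' okd okd' st; have [dt|td] := ltP (px d) t; last first.
    exists [::]; first exact: triv_mid.
    by move=> _; exists d; rewrite ?inE ?eqxx// => dt _; apply/le_anti; rewrite td dt.
  have [td'|d't] := ltP t (px d'); last first.
    exists [::]; first exact: triv_mid.
    move=> _; exists d'; rewrite ?inE ?eqxx ?orbT// => _ h.
    by apply/le_anti; rewrite d't h.
  have [m mP' [c cm cx]] := insert_px X_int Y_int K_fin okd okd' st dt td'.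
  by exists m => // _; exists c => //; rewrite inE mem_rcons inE cm !orbT.
exists mid'; split=> //.
by have [d [d' [c [g1 g2 cc /(_ g1 g2)]]]] := m3 tt px t h1 h2; exists c.
Qed.

Lemma refine_pu (t : rat) e mid e' : cok e -> cok e' -> cmid e mid e' ->
  pu e <= t -> t <= pu e' -> exists mid', [/\ cmid e mid' e',
    {subset mid <= mid'} & exists2 d, d \in e :: rcons mid' e' & pu d = t].
Proof.
move=> oke oke' mP h1 h2.
have [|mid' [m1 m2 m3]] := @refine_all X Y P s K unit
    (fun _ d d' c => pu d <= t -> t <= pu d' -> pu c = t) _ _ _ _ oke oke' mP.
  move=> d d' okd okd' st; have [dt|td] := ltP (pu d) t; last first.
    exists [::]; first exact: triv_mid.
    by move=> _; exists d; rewrite ?inE ?eqxx// => dt _; apply/le_anti; rewrite td dt.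
  have [td'|d't] := ltP t (pu d'); last first.
    exists [::]; first exact: triv_mid.
    move=> _; exists d'; rewrite ?inE ?eqxx ?orbT// => _ h.
    by apply/le_anti; rewrite d't h.
  have [m mP' [c cm cx]] := insert_pu X_int Y_int K_fin okd okd' st dt td'.
  by exists m => // _; exists c => //; rewrite inE mem_rcons inE cm !orbT.
exists mid'; split=> //.
by have [d [d' [c [g1 g2 cc /(_ g1 g2)]]]] := m3 tt pu t h1 h2; exists c.
Qed.

Lemma refine_label t e mid e' : P t -> cok e -> cok e' -> cmid e mid e' ->
  (forall k, K k -> pl e k <= t \/ E (pl e k) t) ->
  (forall k, K k -> t <= pl e' k \/ E (pl e' k) t) -> exists mid',
    [/\ cmid e mid' e', {subset mid <= mid'} & forall k, K k ->
      exists2 d, d \in e :: rcons mid' e' & E (pl d k) t].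
Proof.
move=> Pt oke oke' mP h1 h2.
have [|mid' [m1 m2 m3]] := @refine_all X Y P s K autQ
    (fun k d d' c => K k -> pl d k <= t -> t <= pl d' k -> E (pl c k) t)
    _ _ _ _ oke oke' mP.
  move=> d d' okd okd' st.
  have [m mP' cP] := insert_label E_sym X_int Y_int K_fin alt Pt okd okd' st.
  exists m => // k.
  have [Kk|nKk] := pselect (K k); last by exists d; rewrite ?inE ?eqxx.
  have [dt|td] := ltP (pl d k) t; last first.
    exists d; rewrite ?inE ?eqxx// => _ dt _.
    suff -> : pl d k = t by exact: E_refl.
    by apply/le_anti; rewrite td dt.
  have [td'|d't] := ltP t (pl d' k); last first.
    exists d'; rewrite ?inE ?mem_rcons ?inE ?eqxx ?orbT// => _ _ h.
    suff -> : pl d' k = t by exact: E_refl.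
    by apply/le_anti; rewrite d't h.
  have [c cm cE] := cP _ Kk dt td'; exists c => // _ _ _.
  by case: cE => [//|->]; exact: E_refl.
exists mid'; split=> // k Kk.
case: (h1 _ Kk) => [g1|]; last by exists e; rewrite ?inE ?eqxx.
case: (h2 _ Kk) => [g2|]; last first.
  by exists e'; rewrite ?inE ?mem_rcons ?inE ?eqxx ?orbT.
by have [d [d' [c [i1 i2 cc /(_ Kk i1 i2)]]]] := m3 k (pl ^~ k) t g1 g2; exists c.
Qed.

Let pick_in (A : set rat) (a t : rat) : A a ->
  exists2 r, A r & A t -> r = t.
Proof.
by move=> Aa; have [At|nAt] := pselect (A t); [exists t|exists a].
Qed.

(** Prolonging both ends brings [t] into the range of abscissas, heights and labels; the discrete
    intermediate value principle then finds it inside. Labels are treated last because this needs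
    the ends to bound [t] for every map. *)
Lemma cnext t c : cgood c ->
  exists c', [/\ cgood c', {subset cpts c <= cpts c'} & ccovers t c'].
Proof.
case: c => e0 mid e1 [/= ok0 ok1 mP [p0 Pp0 l0] [p1 Pp1 l1]].
(* If [t] lies outside [X], a point of the chain is taken as target instead; likewise for [Y] and
   [P]. *)
have [xs Xxs xst] : exists2 r, X r & X t -> r = t.
  by have [Xe _ _] := ok0; exact: pick_in Xe.
have [us Yus ust] : exists2 r, Y r & Y t -> r = t.
  by have [_ Ye _] := ok0; exact: pick_in Ye.
have [r Pr rt] : exists2 r, P r & P t -> r = t by exact: pick_in Pp0.
have [e1' [p1' [m1 [ok1' m1P l1' [Pp1' x1 u1 r1]]]]] :=
  right_end X_int Y_int K_fin KXY alt ok1 l1 Pp1 Xxs Yus Pr.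
have [e0' [p0' [m0 [ok0' m0P l0' [Pp0' x0 u0 r0]]]]] :=
  left_end X_int Y_int K_fin KXY E_sym alt ok0 l0 Pp0 Xxs Yus Pr.
have M0 := cmid_cat m0P ok0 (cmid_cat mP ok1 m1P).
set M := m0 ++ _ in M0.
have [Ma [Ma1 Ma2 [da da1 da2]]] := refine_px ok0' ok1' M0 (ltW x0) (ltW x1).
have [Mb [Mb1 Mb2 [db db1 db2]]] := refine_pu ok0' ok1' Ma1 (ltW u0) (ltW u1).
have [||Mc [Mc1 Mc2 Mc3]] := refine_label Pr ok0' ok1' Mb1.
- by move=> k Kk; rewrite l0'.
- by move=> k Kk; rewrite l1'.
exists (CState e0' Mc e1'); split.
- by split=> //=; [exists p0'|exists p1'].
- move=> d; rewrite /cpts /= !inE !mem_rcons !inE => dd.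
  have : d \in M by rewrite /M mem_cat inE mem_cat inE; move: dd => /or3P[] ->; rewrite ?orbT.
  by move=> /Ma2/Mb2/Mc2 ->; rewrite !orbT.
- split=> [Xt|Yt|Pt k Kk].
  + exists da; last by rewrite da2 xst.
    by apply: (sub_pts Mc2); exact: (sub_pts Mb2).
  + by exists db; [exact: (sub_pts Mc2)|rewrite db2 ust].
  + by have [d dm] := Mc3 _ Kk; rewrite rt//; exists d.
Qed.

(* Maps that clear a box move its left (or right) side past the other one. *)
Definition cbelow (phi : autQ) d d' := `[< [/\ px d < px d', pu d < pu d' &
  forall k, K k -> pl d k <= pl d' k /\
    (E (pl d k) (pl d' k) -> same_orbital (phi^-1 * k)%g (px d) (px d'))] >].

Lemma cbelow_trans phi : transitive (cbelow phi).
Proof.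
move=> b a c /asboolP[x1 u1 h1] /asboolP[x2 u2 h2]; apply/asboolP.
split; [exact: lt_trans x2|exact: lt_trans u2|move=> k Kk].
have [g1 g1'] := h1 _ Kk; have [g2 g2'] := h2 _ Kk.
split=> [|Eac]; first exact: le_trans g2.
have Eab : E (pl a k) (pl b k).
  by apply: (same_orbital_convex Eac); rewrite g1 g2.
apply: (same_orbital_trans (g1' Eab)); apply: g2'.
exact: same_orbital_trans (E_sym Eab) Eac.
Qed.

(** A crossing joins labels of opposite signs, which are inequivalent, so only clearing maps
    contribute equal orbitals. *)
Lemma cstep_cbelow (phi : autQ) d d' : phi (px d) = pu d -> phi (px d') = pu d' ->
  cstep d d' -> cbelow phi d d'.
Proof.
move=> e1 e2 [xx uu [p [q h]]]; apply/asboolP; split=> // k Kk.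
have [[le cl]|[pe pe' pq sq]] := h _ Kk; last first.
  rewrite pe pe'; split=> [|/E_s spq]; first exact: ltW.
  by move: sq; rewrite spq; case: (s q).
split; first by rewrite le.
move=> _; case: ifP cl => _ cl.
  apply: same_orbital_convex; first exact: same_orbital_step.
  by rewrite (ltW xx) ltW// autQM autQ_gtV e2.
have st := same_orbital_step (phi^-1 * k)%g (px d').
apply/same_orbital_sym/(same_orbital_trans st).
apply: (same_orbital_convex (same_orbital_sym st)).
by rewrite (ltW xx) andbT ltW// autQM autQ_ltV e1.
Qed.

Lemma cgood_tri (phi : autQ) c : cgood c ->
  (forall d, d \in cpts c -> phi (px d) = pu d) ->
  forall d d', d \in cpts c -> d' \in cpts c ->
  [\/ d = d', cbelow phi d d' | cbelow phi d' d].
Proof.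
move=> [_ _ [pc _] _ _] h; apply: sorted_trichotomy; first exact: cbelow_trans.
rewrite /cpts /=; apply: (sub_in_path (P := [pred d | phi (px d) == pu d])) pc.
  move=> d d' /eqP h1 /eqP h2 /asboolP st; exact: cstep_cbelow.
by apply/allP => d /h /eqP.
Qed.

(** The part of [cbelow] that does not mention [phi]; it is needed while the graph of [phi] is still
    being assembled. *)
Definition cless d d' := `[< [/\ px d < px d', pu d < pu d' &
  forall k, K k -> pl d k <= pl d' k] >].

Lemma cgood_tri0 c : cgood c -> forall d d', d \in cpts c -> d' \in cpts c ->
  [\/ d = d', cless d d' | cless d' d].
Proof.
move=> [_ _ [pc _] _ _]; apply: sorted_trichotomy.
  move=> b a e /asboolP[x1 u1 h1] /asboolP[x2 u2 h2]; apply/asboolP.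
  split; [exact: lt_trans x2|exact: lt_trans u2|move=> k Kk].
  exact: le_trans (h1 _ Kk) (h2 _ Kk).
rewrite /cpts /=; apply: sub_path pc => d d' /asboolP[xx uu [p [q h]]].
apply/asboolP; split=> // k /h[[->]//|[-> -> /ltW]] //.
Qed.

(** The outcome on one interval: [H] is the graph of a piece of [phi], and [rho k] the matching of
    orbitals. The last clause speaks of every automorphism extending [H], because the actual [phi]
    is glued from many pieces later. *)
Definition local_catch (H : rat -> rat -> Prop) (rho : autQ -> rat -> rat -> Prop) :=
  [/\ forall x, X x -> exists u, H x u, forall u, Y u -> exists x, H x u,
      forall x u, H x u -> X x /\ Y u &
      forall x u x' u', H x u -> H x' u' -> (x < x') = (u < u')] /\
  forall k, K k ->
  [/\ forall x, X x -> exists p, rho k x p,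
      forall p, P p -> exists x, rho k x p,
      forall x p, rho k x p -> [/\ X x, P p &
        exists2 u, H x u & if p < f p then u < k x else k x < u],
      forall x p y q, rho k x p -> rho k y q -> x <= y ->
        p < q \/ same_orbital f p q &
      forall phi : autQ, (forall x u, H x u -> phi x = u) ->
        forall x p y q, rho k x p -> rho k y q -> x < y ->
        same_orbital f p q -> same_orbital (phi^-1 * k)%g x y].

Lemma cgood_init : exists c, cgood c.
Proof.
have [[x Xx] _ _ _] := X_int; have [[p Pp] _ _ _] := P_int.
have [vs vsP] := K_fin x.

have [u Yu uP] : exists2 u, Y u & forall k, K k -> if s p then u < k x else k x < u.
  case: (s p).
    have [u Yu uP] := open_interval_lb vs Y_int; exists u => // k Kk.
    by apply: uP; [have [] := vsP _ Kk|apply/(KXY Kk)].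
  have [u Yu uP] := open_interval_ub vs Y_int; exists u => // k Kk.
  by apply: uP; [have [] := vsP _ Kk|apply/(KXY Kk)].
have ok0 : cok (CPt x u (fun=> p)) by split=> // k Kk; split=> //; exact: uP.
have c0p : cconst K (CPt x u (fun=> p)) p by [].
have [d [e [okd oke st1 st2 [ce _ _]]]] :=
  right_extend X_int Y_int K_fin KXY ok0 c0p Pp Xx Yu.
exists (CState (CPt x u (fun=> p)) [:: d] e); split=> //=; last by exists p.
- by apply/cmid_cons; split=> //; apply/cmid_nil.
- by exists p.
Qed.

(** A back-and-forth along an enumeration of the rationals. All properties concern two points at a
    time, and any two points lie in a common chain. *)
Lemma local_catch_ex : exists H rho, local_catch H rho.
Proof.
have [c_ c_good] := cgood_init.
have [F FP] : exists F : rat * cstate -> cstate, forall tc, cgood tc.2 ->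
    [/\ cgood (F tc), {subset cpts tc.2 <= cpts (F tc)} & ccovers tc.1 (F tc)].
  have : forall tc : rat * cstate, exists c', cgood tc.2 ->
      [/\ cgood c', {subset cpts tc.2 <= cpts c'} & ccovers tc.1 c'].
    move=> [t c]; have [g|ng] := pselect (cgood c); last by exists c.
    by have [c' h] := cnext t g; exists c'.
  by move=> /choice[F FP]; exists F.
(* Step [m] treats the rational with code [m], or 0 if there is none; thus [t] is covered from step
   [(pickle t).+1] on. *)
pose S := fix S n := if n is m.+1 then F (odflt 0 (unpickle m), S m) else c_.
have Sg n : cgood (S n).
  by elim: n => [//|n /= IH]; have [] := FP (odflt 0 (unpickle n), S n) IH.
have Ss n : {subset cpts (S n) <= cpts (S n.+1)}.
  by have [] := FP (odflt 0 (unpickle n), S n) (Sg n).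
have Sle n m : (n <= m)%N -> {subset cpts (S n) <= cpts (S m)}.
  move=> /subnK <-; elim: (m - n)%N => [//|i IH] d /IH; exact: Ss.
have Sn n : S n.+1 = F (odflt 0 (unpickle n), S n) by [].
have Sc t : ccovers t (S (pickle t).+1).
  rewrite Sn pickleK; have [_ _ h] := FP (t, S (pickle t)) (Sg _); exact: h.
pose D d := exists n, d \in cpts (S n).
have D2 d d' : D d -> D d' -> exists n, d \in cpts (S n) /\ d' \in cpts (S n).
  move=> [n dn] [m dm]; exists (maxn n m).
  by split; [apply: Sle dn; exact: leq_maxl|apply: Sle dm; exact: leq_maxr].
have Dok d : D d -> cok d by move=> [n]; exact/cgood_cok/Sg.
have Dtri d d' : D d -> D d' -> [\/ d = d', cless d d' | cless d' d].
  by move=> h h'; have [n [g g']] := D2 _ _ h h'; exact: (cgood_tri0 (Sg n)).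
pose H x u := exists2 d, D d & px d = x /\ pu d = u.
pose rho k x p := P p /\ exists2 d, D d & px d = x /\ E (pl d k) p.
exists H, rho; split.
  split.
  - move=> x Xx; have [/(_ Xx)[d dd dx] _ _] := Sc x.
    by exists (pu d), d => //; exists (pickle x).+1.
  - move=> u Yu; have [_ /(_ Yu)[d dd dx] _] := Sc u.
    by exists (px d), d => //; exists (pickle u).+1.
  - by move=> x u [d /Dok[Xd Yd _] [<- <-]].
  - move=> x u x' u' [d Dd [<- <-]] [d' Dd' [<- <-]].
    case: (Dtri _ _ Dd Dd') => [->|/asboolP[h1 h2 _]|/asboolP[h1 h2 _]].
    + by rewrite !ltxx.
    + by rewrite h1 h2.
    + by rewrite !ltNge !ltW.
move=> k Kk; split.
- move=> x Xx; have [/(_ Xx)[d dd dx] _ _] := Sc x.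
  have Dd : D d by exists (pickle x).+1.
  have [_ _ /(_ _ Kk)[Pl _]] := Dok _ Dd.
  by exists (pl d k); split=> //; exists d => //; split=> //; exact: E_refl.
- move=> p Pp; have [_ _ /(_ Pp _ Kk)[d dd dE]] := Sc p.
  have Dd : D d by exists (pickle p).+1.
  by exists (px d); split=> //; exists d.
- move=> x p [Pp [d Dd [<- dE]]]; have [Xd Yd /(_ _ Kk)[_ sd]] := Dok _ Dd.
  split=> //; exists (pu d); first by exists d.
  by move: sd; rewrite (E_s dE).
- move=> x p y q [Pp [d Dd [<- dE]]] [Pq [d' Dd' [<- d'E]]] xy.
  have [h|h] := pselect (E p q); first by right.
  left; have le : pl d k <= pl d' k.
    case: (Dtri _ _ Dd Dd') => [->//|/asboolP[_ _]|/asboolP[h1 _ _]]; first exact.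
    by move: xy; rewrite leNgt h1.
  apply: (same_orbital_sep dE d'E).
    move=> h'; apply: h; apply: (same_orbital_trans (E_sym dE)).
    exact: same_orbital_trans h' d'E.
  rewrite lt_neqAle le andbT; apply/eqP => e; apply: h; move: d'E; rewrite -e.
  exact/same_orbital_trans/E_sym.
- move=> phi phiP x p y q [Pp [d Dd [<- dE]]] [Pq [d' Dd' [<- d'E]]] xy Epq.
  have [n [dn d'n]] := D2 _ _ Dd Dd'.
  have hphi c : c \in cpts (S n) -> phi (px c) = pu c.
    by move=> cc; apply: phiP; exists c => //; exists n.
  case: (cgood_tri (Sg n) hphi dn d'n) => [e|/asboolP[_ _ /(_ _ Kk)[_]]|/asboolP[h _ _]].
  + by move: xy; rewrite e ltxx.
  + apply; apply: (same_orbital_trans dE); apply: (same_orbital_trans Epq).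
    exact: E_sym.
  + by move: (lt_trans xy h); rewrite ltxx.
Qed.

End Limit.

(** * Gluing over the components off the fixed points *)

Section Components.
Variable f : autQ.

(** The maximal interval around [x] free of fixed points of [f]; it is empty if [x] itself is
    fixed. *)
Definition component (x : rat) : set rat :=
  [set y | forall z, (x <= z <= y) || (y <= z <= x) -> f z <> z].

Lemma component_refl x : f x <> x -> component x x.
Proof. by move=> fx z; rewrite orbb => /le_anti <-. Qed.

Lemma component_sym x y : component x y -> component y x.
Proof. by move=> h z hz; apply: h; rewrite orbC. Qed.

Lemma component_trans y x w : component x y -> component y w -> component x w.
Proof.
move=> h1 h2 z hz.
have [h|h] : ((x <= z <= y) || (y <= z <= x)) \/ ((y <= z <= w) || (w <= z <= y)).
  by case: (leP z y) hz => h; case: (leP x z) => h'; case: (leP z w) => h'';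
    case: (leP w z) => h3 /=; rewrite ?(ltW h) ?(ltW h') ?orbT; auto.
- exact: h1.
- exact: h2.
Qed.

Lemma component_eq x y : component x y -> component x = component y.
Proof.
move=> xy; apply/seteqP; split=> z; last exact: component_trans.
exact/component_trans/component_sym.
Qed.

Lemma component_nfix x y : component x y -> f y <> y.
Proof. by apply; rewrite lexx andbT le_total. Qed.

(** A fixed point of [f] between [y] and [g y] is fixed by [g] as well, and monotonicity of [g]
    squeezes it onto [y]. *)
Lemma component_move (g : autQ) y : f y <> y ->
  (forall p, f p = p -> g p = p) -> component y (g y).
Proof.
move=> fy gfix z hz fz; have gz := gfix _ fz; apply: fy.
suff <- : z = y by [].
move: hz; rewrite -{2 3}gz !autQ_le_mono => /orP[] /andP[h1 h2];
  by apply/le_anti; rewrite h1 h2.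
Qed.

Lemma component_step y : f y <> y -> component y (f y).
Proof. by move=> fy; exact: component_move. Qed.

Lemma component_stepV y : f y <> y -> component y ((f^-1)%g y).
Proof. by move=> fy; apply: component_move => // p fp; apply/autQ_eqV. Qed.

Lemma component_int x : f x <> x -> open_interval (component x).
Proof.
move=> fx; split.
- by exists x; exact: component_refl.
- move=> a y b xa xb /andP[ay yb] z /orP[] /andP[h1 h2].
    by apply: xb; rewrite h1 (le_trans h2 yb).
  by apply: xa; rewrite h2 (le_trans ay h1) orbT.
- move=> y xy; have fy := component_nfix xy.
  case: (ltgtP (f y) y) => // h.
    by exists (f y) => //; apply: component_trans (component_step fy).
  exists ((f^-1)%g y); last by rewrite autQ_ltV.
  exact: component_trans (component_stepV fy).
- move=> y xy; have fy := component_nfix xy.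
  case: (ltgtP y (f y)) => h; last by move: fy; rewrite -h.
    by exists (f y) => //; apply: component_trans (component_step fy).
  exists ((f^-1)%g y); last by rewrite autQ_gtV.
  exact: component_trans (component_stepV fy).
Qed.

Lemma component_alternating x : sign_alternating f -> f x <> x ->
  alternating_on (same_orbital f) (component x) (fun p => p < f p).
Proof.
move=> alt fx p q xp xq pq npq spq.
have fp := component_nfix xp; have fq := component_nfix xq.
have sgn y : f y <> y -> sg_at f y = if y < f y then 1 else -1.
  by move=> fy; case: (sg_at_ltP f y) => -[-> h]; rewrite ?h// ltNge (ltW h).
have [|| r [pr rq rsg]] := alt _ _ pq npq.
- by rewrite !sgn// spq.
- by rewrite sgn//; case: ifP.
exists r; have xr : component x r.
  by have [_ c _ _] := component_int fx; apply: (c p r q) => //; rewrite !ltW.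
split=> //; move: rsg; rewrite !sgn//; last exact: component_nfix xr.
by case: (p < f p); case: (r < f r).
Qed.

End Components.

Lemma open_interval_im (k : autQ) X : open_interval X ->
  open_interval [set u | X ((k^-1)%g u)].
Proof.
move=> [[x Xx] c lb ub]; split.
- by exists (k x); rewrite /= autQK.
- by move=> a y b Xa Xb h; apply: (c _ _ _ Xa Xb); rewrite !autQ_le_mono.
- move=> u /lb[y Xy yu]; exists (k y); first by rewrite /= autQK.
  by rewrite -autQ_gtV.
- move=> u /ub[y Xy yu]; exists (k y); first by rewrite /= autQK.
  by rewrite -autQ_ltV.
Qed.

Section Catch.
Variables (f : autQ) (K : set autQ) (k0 : autQ).
Hypothesis f_alt : sign_alternating f.
Hypothesis K_fin : finite_valued K.
Hypothesis K_agree : forall k, K k -> forall p, f p = p -> k p = k0 p.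

Let fxe x : {f x = x} + {f x <> x}.
Proof. exact: pselect. Qed.

(** Since all maps of [K] agree with [k0] on the fixed points, each sends a component [C] onto the
    image of [C] under [k0]. The local construction runs on every component separately. *)
Theorem catch : exists g : autQ, forall k, K k -> conjugacy_class f (g * k)%g.
Proof.
pose Y (C : set rat) := [set u | C ((k0^-1)%g u)].
have [HR HRP] : exists HR : set rat -> (rat -> rat -> Prop) *
    (autQ -> rat -> rat -> Prop), forall C, (exists x, f x <> x /\ C = component f x) ->
    local_catch f C (Y C) C K (HR C).1 (HR C).2.
  have : forall C, exists HR : (rat -> rat -> Prop) * (autQ -> rat -> rat -> Prop),
      (exists x, f x <> x /\ C = component f x) ->
      local_catch f C (Y C) C K HR.1 HR.2.
    move=> C; have [[x [fx ->]]|nC] := pselect (exists x, f x <> x /\ C = component f x);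
      last by exists (fun _ _ => False, fun _ _ _ => False).
    have Xi := component_int fx.
    have KXY k : K k -> forall y, component f x y <-> Y (component f x) (k y).
      move=> Kk y; rewrite /Y /=.
      have gfix p : f p = p -> (k0^-1 * k)%g p = p.
        by move=> fp; rewrite autQM (K_agree Kk fp) autQK.
      split=> h; first exact: component_trans h (component_move (component_nfix h) gfix).
      have [fy|fy] := fxe y; first by move: h; rewrite -autQM gfix.
      exact: component_trans h (component_sym (component_move fy gfix)).
    have [H [rho Hrho]] := local_catch_ex Xi (open_interval_im k0 Xi) Xi K_fin KXY
      (component_alternating f_alt fx).
    by exists (H, rho).
  by move=> /choice[HR HRP]; exists HR.
have HRx x : f x <> x -> local_catch f (component f x) (Y (component f x))
    (component f x) K (HR (component f x)).1 (HR (component f x)).2.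
  by move=> fx; apply: HRP; exists x.
(* On fixed points of [f] the map [phi] is [k0], so that [phi^-1 * k] fixes them for every [k] in
   [K]. *)
pose H x u := (f x = x /\ u = k0 x) \/ (f x <> x /\ (HR (component f x)).1 x u).
have Hfl x u z : H x u -> f z = z -> x < z -> u < k0 z.
  move=> [[fx ->]|[fx h]] fz xz; first by rewrite autQ_lt_mono.
  have [[_ _ /(_ _ _ h)[_ Yu] _] _] := HRx _ fx.
  rewrite ltNge -autQ_geV; apply/negP => zu; apply: (Yu z) => //.
  by rewrite (ltW xz) zu.
have Hfr x u z : H x u -> f z = z -> z < x -> k0 z < u.
  move=> [[fx ->]|[fx h]] fz xz; first by rewrite autQ_lt_mono.
  have [[_ _ /(_ _ _ h)[_ Yu] _] _] := HRx _ fx.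
  rewrite ltNge -autQ_leV; apply/negP => zu; apply: (Yu z) => //.
  by rewrite (ltW xz) zu orbT.
have Hfe x u : H x u -> f x = x -> u = k0 x by move=> [[]|[]].
(* Two points share a component or are separated by a fixed point. All order comparisons, first for
   [H] and then for [rho], split along this alternative. *)
have compP x y : x <= y -> component f x y \/ exists z, [/\ f z = z, x <= z & z <= y].
  move=> xy; have [h|nh] := pselect (exists z, [/\ f z = z, x <= z & z <= y]).
    by right.
  left=> z /orP[/andP[h1 h2]|/andP[h1 h2]] fz; apply: nh; exists z => //.
  by split=> //; [apply: le_trans xy h1|apply: le_trans h2 xy].
have Hlt x u x' u' : H x u -> H x' u' -> x < x' -> u < u'.
  move=> h h' xx'; have [c|[z [fz]]] := compP _ _ (ltW xx').
    have fx := component_nfix (component_sym c); have fx' := component_nfix c.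
    case: h => [[]//|[_ h]]; case: h' => [[]//|[_]]; rewrite -(component_eq c) => h'.
    by have [[_ _ _ m] _] := HRx _ fx; rewrite -(m _ _ _ _ h h').
  rewrite le_eqVlt => /predU1P[ex|xz]; rewrite le_eqVlt => /predU1P[ex'|zx'].
  - by move: xx'; rewrite ex ex' ltxx.
  - rewrite (Hfe _ _ h); last by rewrite ex.
    by rewrite ex; apply: Hfr zx'.
  - rewrite (Hfe _ _ h'); last by rewrite -ex'.
    by rewrite -ex'; apply: Hfl xz.
  - exact: lt_trans (Hfl _ _ _ h fz xz) (Hfr _ _ _ h' fz zx').
have Heq x u u' : H x u -> H x u' -> u = u'.
  move=> [[fx ->]|[fx h]] [[fx' ->]|[fx' h']] //.
  have [[_ _ _ m] _] := HRx _ fx; apply/eqP; rewrite eq_le !leNgt.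
  by rewrite -(m _ _ _ _ h h') -(m _ _ _ _ h' h) ltxx.
have [phi phiP] : exists phi : autQ, forall x u, H x u <-> phi x = u.
  apply: graph_autQ.
  - move=> x; have [fx|fx] := fxe x; first by exists (k0 x); left.
    have [[t _ _ _] _] := HRx _ fx; have [u h] := t _ (component_refl fx).
    by exists u; right.
  - move=> u; pose y := (k0^-1)%g u; have [fy|fy] := fxe y.
      by exists y; left; rewrite /y autQVK.
    have [[_ t Xx _] _] := HRx _ fy; have [|x h] := t u; first exact: component_refl.
    exists x; right; have [c _] := Xx _ _ h.
    by rewrite -(component_eq c); split=> //; exact: component_nfix c.
  - move=> x u x' u' h h'; apply/idP/idP; first exact: Hlt h h'.
    case: (ltgtP x x') => // [g|e].
      by have := Hlt _ _ _ _ h' h g => g1 /(lt_trans g1); rewrite ltxx.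
    by rewrite -e in h'; rewrite (Heq _ _ _ h h') ltxx.
exists (phi^-1)%g => k Kk.
pose rho x p := (f x = x /\ p = x) \/ (f x <> x /\ (HR (component f x)).2 k x p).
have rho_comp x p : rho x p -> f x <> x -> component f x p.
  move=> [[]//|[fx h] _]; have [_ /(_ _ Kk)[_ _ /(_ _ _ h)[_ //]]] := HRx _ fx.
have rho_fix x p : rho x p -> f x = x -> p = x by move=> [[]|[]].
have rfl x p z : rho x p -> f z = z -> x < z -> p < z.
  move=> h fz xz; have [fx|fx] := fxe x; first by rewrite (rho_fix _ _ h).
  rewrite ltNge; apply/negP => zp; apply: (rho_comp _ _ h fx z) => //.
  by rewrite (ltW xz) zp.
have rfr x p z : rho x p -> f z = z -> z < x -> z < p.
  move=> h fz xz; have [fx|fx] := fxe x; first by rewrite (rho_fix _ _ h).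
  rewrite ltNge; apply/negP => zp; apply: (rho_comp _ _ h fx z) => //.
  by rewrite (ltW xz) zp orbT.
have sep x p y q z : rho x p -> rho y q -> f z = z -> x <= z -> z <= y ->
    p < q \/ (p = q /\ x = y).
  move=> h h' fz; rewrite le_eqVlt => /predU1P[ex|xz]; rewrite le_eqVlt => /predU1P[ey|zy].
  - subst z; rewrite -ey in h' *; right.
    by rewrite (rho_fix _ _ h)// (rho_fix _ _ h').
  - by left; rewrite (rho_fix _ _ h) ?ex//; exact: rfr zy.
  - by left; rewrite (rho_fix _ _ h') -?ey//; exact: rfl xz.
  - by left; exact: lt_trans (rfl _ _ _ h fz xz) (rfr _ _ _ h' fz zy).
apply: (@conjugacy_criterion f _ rho) => //.
- move=> x; have [fx|fx] := fxe x; first by exists x; left.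
  have [_ /(_ _ Kk)[t _ _ _ _]] := HRx _ fx.
  by have [p h] := t _ (component_refl fx); exists p; right.
- move=> p; have [fp|fp] := fxe p; first by exists p; left.
  have [_ /(_ _ Kk)[_ t XX _ _]] := HRx _ fp.
  have [x h] := t _ (component_refl fp); exists x; right.
  have [c _ _] := XX _ _ h.
  by rewrite -(component_eq c); split=> //; exact: component_nfix c.
- move=> x p h; have [fx|fx] := fxe x.
    rewrite (rho_fix _ _ h fx); have -> := (sg_at0 f x).2 fx.
    apply/sg_at0; rewrite autQM; apply/autQ_eqV.
    by rewrite (K_agree Kk fx); apply/phiP; left.
  have fp := component_nfix (rho_comp _ _ h fx).
  case: h => [[]//|[_ h]]; have [_ /(_ _ Kk)[_ _ XX _ _]] := HRx _ fx.
  have [_ _ [u hu sg]] := XX _ _ h.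
  have pu : phi x = u by apply/phiP; right.
  apply: sg_at_eq; rewrite autQM ?autQ_gtV ?autQ_ltV pu.
    case: (ltgtP p (f p)) sg => [h1 h2|h1 h2|e]; last by case: fp.
      by rewrite h2.
    by apply/negbTE; rewrite -leNgt ltW.
  case: (ltgtP p (f p)) sg => [h1 h2|h1 h2|e]; last by case: fp.
    by apply/negbTE; rewrite -leNgt ltW.
  by rewrite h2.
- move=> x p y q h h' xy; have [c|[z [fz xz zy]]] := compP _ _ xy.
    have fx := component_nfix (component_sym c); have fy := component_nfix c.
    case: h => [[]//|[_ h]]; case: h' => [[]//|[_]]; rewrite -(component_eq c) => h'.
    by have [_ /(_ _ Kk)[_ _ _ le _]] := HRx _ fx; exact: le h h' xy.
  have [|[-> _]] := sep _ _ _ _ _ h h' fz xz zy; [by left|right].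
  exact: same_orbital_refl.
- move=> x p y q h h' xy so; have [c|[z [fz xz zy]]] := compP _ _ (ltW xy).
    have fx := component_nfix (component_sym c); have fy := component_nfix c.
    case: h => [[]//|[_ h]]; case: h' => [[]//|[_]]; rewrite -(component_eq c) => h'.
    have [_ /(_ _ Kk)[_ _ _ _ sm]] := HRx _ fx; apply: sm h h' xy so => x' u hu.
    apply/phiP; right; have [[_ _ /(_ _ _ hu)[c' _] _] _] := HRx _ fx.
    by rewrite -(component_eq c'); split=> //; exact: component_nfix c'.
  (* Labels of points separated by the fixed point [z] are separated by [z] too; were they
     equivalent, both would equal [z]. *)
  exfalso; have pz : p <= z.
    have [|[-> _]] := sep _ _ _ _ _ h (or_introl (conj fz erefl) : rho z z) fz xz (lexx z) => //.
    exact: ltW.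
  have zq : z <= q.
    have [|[-> _]] := sep _ _ _ _ _ (or_introl (conj fz erefl) : rho z z) h' fz (lexx z) zy => //.
    exact: ltW.
  have /same_orbital_sym/(same_orbital_fix fz) ep : same_orbital f p z.
    by apply: (same_orbital_convex so); rewrite pz zq.
  rewrite ep in so; have eq := same_orbital_fix fz so.
  have [h1|[_ h1]] := sep _ _ _ _ _ h h' fz xz zy.
    by move: h1; rewrite ep eq ltxx.
  by move: xy; rewrite h1 ltxx.
Qed.

End Catch.

(** * Tightness and non-Haar null classes *)

Definition orbital_of (f : autQ) (r : rat) : set rat := [set q | same_orbital f r q].

Lemma convex_hull_orbit (f : autQ) r :
  convex_hull [set zexpg f n r | n in [set: int]] = orbital_of f r.
Proof.
apply/seteqP; split.
  apply: smallest_sub; last by move=> _ [n _ <-]; exact: same_orbital_zexp.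
  move=> x y rx ry z xzy; apply: (same_orbital_trans rx).
  apply: (same_orbital_convex _ xzy).
  exact: same_orbital_trans (same_orbital_sym rx) ry.
move=> q [i [j ijq]] A [Aint Asub].
by apply: Aint ijq; apply: Asub; [exists i|exists j].
Qed.

Lemma orbitalsE f O : orbitals f O <-> exists r, O = orbital_of f r.
Proof.
split=> [[r _ <-]|[r ->]]; first by exists r; rewrite convex_hull_orbit.
by exists r => //; rewrite convex_hull_orbit.
Qed.

Lemma parity_orbital f r : parity f (orbital_of f r) = sg_at f r.
Proof.
rewrite /parity; case: (sg_at_ltP f r) => -[-> fr].
- rewrite asboolF; last first.
    move=> [p [Op fp]]; have : orbital_of f r r by exact: same_orbital_refl.
    by rewrite Op /= => rp; move: fr; rewrite rp fp ltxx.
  by rewrite asboolT// => p; exact: same_orbital_gt.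
- rewrite asboolF; last first.
    move=> [p [Op fp]]; have : orbital_of f r r by exact: same_orbital_refl.
    by rewrite Op /= => rp; move: fr; rewrite rp fp ltxx.
  rewrite asboolF// => h; have := h r (same_orbital_refl f r).
  by move=> /(lt_trans fr); rewrite ltxx.
- rewrite asboolT//; exists r; split=> //; apply/seteqP; split=> q /=.
    by move=> /(same_orbital_fix fr).
  by move=> ->; exact: same_orbital_refl.
Qed.

Lemma orbital_ltE f p q : orbital_lt (orbital_of f p) (orbital_of f q) <->
  p < q /\ ~ same_orbital f p q.
Proof.
split=> [[ne [p' [q' [pp' qq' p'q']]]]|[pq npq]].
  have npq : ~ same_orbital f p q.
    move=> pq; apply: ne; apply/seteqP; split=> r; last exact: same_orbital_trans.
    exact/same_orbital_trans/same_orbital_sym.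
  split=> //.
  apply: (same_orbital_sep (same_orbital_sym pp') (same_orbital_sym qq') _ p'q').
  move=> h; apply: npq; apply: same_orbital_trans pp' _.
  exact: same_orbital_trans h (same_orbital_sym qq').
split.
  move=> e; apply: npq; have : orbital_of f q q by exact: same_orbital_refl.
  by rewrite -e.
by exists p, q; split=> //; exact: same_orbital_refl.
Qed.

Lemma sign_alternatingE f : (forall O1 O2 : set rat,
    orbitals f O1 -> orbitals f O2 -> orbital_lt O1 O2 ->
    (parity f O1 = 1 /\ parity f O2 = 1) \/
    (parity f O1 = -1 /\ parity f O2 = -1) ->
    exists O3 : set rat, [/\ orbitals f O3, orbital_lt O1 O3, orbital_lt O3 O2 &
      parity f O3 <> parity f O1]) <-> sign_alternating f.
Proof.
split=> [h p q pq npq spq sp0|h O1 O2 /orbitalsE[p ->] /orbitalsE[q ->]].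
  have [||||O3 [/orbitalsE[r ->]]] := h (orbital_of f p) (orbital_of f q).
  - by apply/orbitalsE; exists p.
  - by apply/orbitalsE; exists q.
  - exact/orbital_ltE.
  - rewrite !parity_orbital -spq.
    by move: sp0; case: (sg_at_ltP f p) => -[-> _] // _; [left|right].
  rewrite !parity_orbital => /orbital_ltE[pr _] /orbital_ltE[rq _] /eqP srp.
  by exists r.
move=> /orbital_ltE[pq npq]; rewrite !parity_orbital => sgn.
have [||r [pr rq srp]] := h _ _ pq npq.
- by case: sgn => -[-> ->].
- by case: sgn => -[-> _].
have spq : sg_at f q = sg_at f p by case: sgn => -[-> ->].
exists (orbital_of f r); split.
- by apply/orbitalsE; exists r.
- apply/orbital_ltE; split=> // /same_orbital_sg e.
  by rewrite e eqxx in srp.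
- apply/orbital_ltE; split=> // /same_orbital_sg e.
  by rewrite e spq eqxx in srp.
- by rewrite !parity_orbital; apply/eqP.
Qed.

(** * Topology of the group; biters and catchers *)

Lemma near_agree (k : autQ) (ps : seq rat) :
  nbhs k [set g : autQ | forall p, p \in ps -> g p = k p].
Proof.
elim: ps => [|p ps IH]; first by apply: filterS filterT => g _ q.
apply: filterS (filterI (autQ_near k p) IH) => g [gp gps] q.
by rewrite inE => /predU1P[->|/gps].
Qed.

Lemma open_agree (k : autQ) (ps : seq rat) :
  open [set g : autQ | forall p, p \in ps -> g p = k p].
Proof.
rewrite openE => g gk; apply: filterS (near_agree g ps) => h hg p pps.
by rewrite hg// gk.
Qed.

Lemma open_eval (q : rat) (A : set rat) : open [set g : autQ | A (g q)].
Proof. by rewrite openE => g Ag; apply: filterS (autQ_near g q) => h /= ->. Qed.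

Lemma open_evalV (q : rat) (A : set rat) : open [set g : autQ | A ((g^-1)%g q)].
Proof.
rewrite openE => g Ag; apply: filterS (autQ_near g ((g^-1)%g q)) => h /=.
by rewrite autQVK => hq; rewrite /= (_ : (h^-1)%g q = (g^-1)%g q)//; apply/autQ_eqV.
Qed.

(** The sets of maps with a prescribed value at [q], or a prescribed preimage of [q], form open
    covers; finite subcovers list the values. *)
Lemma compact_finite_valued (K : set autQ) : compact K -> finite_valued K.
Proof.
rewrite compact_cover => cK q.
have [||D1 _ D1P] := cK rat setT (fun v => [set g : autQ | g q = v]).
- by move=> v _; exact: (open_eval q [set v]).
- by move=> k _; exists (k q).
have [||D2 _ D2P] := cK rat setT (fun v => [set g : autQ | (g^-1)%g q = v]).
- by move=> v _; exact: (open_evalV q [set v]).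
- by move=> k _; exists ((k^-1)%g q).
exists (finmap.enum_fset D1 ++ finmap.enum_fset D2) => k Kk; rewrite !mem_cat.
have [v vD /= kv] := D1P _ Kk.
by have [w wD /= kw] := D2P _ Kk; rewrite kv kw vD wD orbT.
Qed.

Lemma finite_valuedS (K K' : set autQ) : K' `<=` K -> finite_valued K ->
  finite_valued K'.
Proof. by move=> s h q; have [vs vsP] := h q; exists vs => k /s/vsP. Qed.

Lemma catch_finite (f : autQ) (K : set autQ) (k0 : autQ) ps : sign_alternating f ->
  fixed_points f `<=` [set` (ps : seq rat)] ->
  finite_valued K -> (forall k, K k -> forall p, p \in ps -> k p = k0 p) ->
  exists g : autQ, translate g 1%g K `<=` conjugacy_class f.
Proof.
move=> alt fps Kf Ka; have [|g gP] := catch alt Kf (k0 := k0).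
  by move=> k Kk p fp; apply: Ka => //; exact: fps.
by exists g => _ [k Kk <-]; rewrite mulg1; exact: gP.
Qed.

(** Agreement with one element [k0] of [K] at finitely many points is an open condition, and this is
    the open set that the biter uses. *)
Lemma compact_biter_class f : finite_set (fixed_points f) ->
  sign_alternating f -> compact_biter (conjugacy_class f).
Proof.
move=> /finite_seqP[ps psE] alt K [k0 Kk0] cK.
pose U := [set g : autQ | forall p, p \in ps -> g p = k0 p].
have [|||g gP] := @catch_finite f (U `&` K) k0 ps alt.
- by rewrite psE.
- apply: finite_valuedS (compact_finite_valued cK); exact: subIsetr.
- by move=> k [].
by exists U, g, 1%g; split=> //; [exact: open_agree|exists k0].
Qed.

Lemma compact_catcher_class f : fixed_points f = set0 ->
  sign_alternating f -> compact_catcher (conjugacy_class f).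
Proof.
move=> fix0 alt K cK.
have [|||g gP] := @catch_finite f K 1%g [::] alt.
- by rewrite fix0.
- exact: compact_finite_valued.
- by [].
by exists g, 1%g.
Qed.

Lemma translateE (g h : autQ) B :
  translate g h B = [set x | B (g^-1 * x * h^-1)%g].
Proof.
apply/seteqP; split=> [_ [x Bx <-]|x Bx] /=.
  by rewrite !mulgA mulVg mul1g mulgK.
by exists (g^-1 * x * h^-1)%g => //; rewrite !mulgA mulgV mul1g mulgVK.
Qed.

Lemma borel_preimage (phi : autQ -> autQ) : continuous phi ->
  forall B, borel B -> borel (phi @^-1` B).
Proof.
move=> cphi; apply: smallest_sub; last first.
  move=> U oU; apply: sub_sigma_algebra; apply: open_comp => // x _; exact: cphi.
split.
- by rewrite preimage_set0; exact: sigma_algebra0.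
- move=> A bA; rewrite setTD preimage_setC -setTD; exact: sigma_algebraCD.
- move=> F bF; rewrite preimage_bigcup; exact: sigma_algebra_bigcup.
Qed.

Lemma borel_translate (g h : autQ) B : borel B -> borel (translate g h B).
Proof.
move=> bB; rewrite translateE.
apply: (borel_preimage (phi := fun x => (g^-1 * x * h^-1)%g)) bB.
move=> x; apply/cvg_autQP => [|q]; first exact/fmap_filter/nbhs_filter.
apply: filterS (autQ_near x ((h^-1)%g q)) => y yx.
exact: (congr1 (autQ_fun (g^-1)%g) yx).
Qed.

(** * Measures charge finite-valued sets *)

Section Tightness.
Variables (R : realType).
Local Notation T := (g_sigma_algebraType (@open autQ)).
Variable mu : probability T R.

Lemma open_measurable_autQ (U : set autQ) : open U -> measurable (U : set T).
Proof. exact: sub_sigma_algebra. Qed.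

(** The maps for which the code of the value or of the preimage of [q] is at least [n] form a
    decreasing sequence with empty intersection. *)
Lemma tight_at (q : rat) (e : R) : 0 < e -> exists vs : seq rat,
  (mu [set k : T | ~ (k q \in vs /\ (k^-1)%g q \in vs)] <= e%:E)%E.
Proof.
move=> e0; pose G n : set T := [set k : autQ | (n <= pickle (k q))%N \/
  (n <= pickle ((k^-1)%g q))%N].
have mG n : measurable (G n).
  apply: measurableU; apply: open_measurable_autQ.
    exact: (open_eval q [set v | (n <= pickle v)%N]).
  exact: (open_evalV q [set v | (n <= pickle v)%N]).
have G0 : \bigcap_n G n = set0.
  apply/seteqP; split=> // k Gk.
  have /= := Gk (maxn (pickle (k q)) (pickle ((k^-1)%g q))).+1 I.
  by case; rewrite ltnNge ?leq_maxl ?leq_maxr.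
have cG : mu \o G @ \oo --> mu (\bigcap_n G n).
  apply: nonincreasing_cvg_mu => //.
  - by apply: (le_lt_trans (probability_le1 _ _)) => //; rewrite ltry.
  - by rewrite G0.
  - move=> n m nm; apply/subsetPset => k [h|h]; [left|right]; exact: leq_trans h.
have [n nP] : exists n, (mu (G n) <= e%:E)%E.
  apply: contrapT => h; have : (e%:E <= lim (mu \o G @ \oo))%E.
    apply: lime_ge; first by apply/cvg_ex; exists (mu (\bigcap_n G n)).
    apply: nearW => n; rewrite leNgt; apply/negP => /ltW h'; apply: h.
    by exists n.
  by rewrite (cvg_lim _ cG)// G0 measure0 lee_fin leNgt e0.
exists (pmap unpickle (iota 0 n)).
have memn (v : rat) : (pickle v < n)%N -> v \in pmap unpickle (iota 0 n).
  by move=> h; rewrite mem_pmap -(pickleK v) map_f// mem_iota.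
apply: le_trans nP; apply: le_measure; rewrite ?inE//.
  apply: measurableC; apply: measurableI; apply: open_measurable_autQ.
    exact: (open_eval q [set v | v \in pmap unpickle (iota 0 n)]).
  exact: (open_evalV q [set v | v \in pmap unpickle (iota 0 n)]).
move=> k /= h; apply: contrapT => nG; apply: h.
split; apply: memn; rewrite ltnNge; apply/negP => h; apply: nG.
  by left.
by right.
Qed.

Lemma tight : exists K : set autQ, [/\ measurable (K : set T), finite_valued K &
  (0 < mu K)%E].
Proof.
(* These errors sum to at most 1/2, so the complement of the exceptional sets has positive mass. *)
pose e n : R := (1 / 2) / (2 ^ n.+1)%:R.
have e0 n : 0 < e n by rewrite /e divr_gt0// ltr0n expn_gt0.
pose qn (n : nat) : rat := odflt 0 (unpickle n).
have [vs vsP] := choice (fun n => tight_at (qn n) (e0 n)).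
pose A n : set T := [set k : autQ | ~ (k (qn n) \in vs n /\ (k^-1)%g (qn n) \in vs n)].
have mA n : measurable (A n).
  apply: measurableC; apply: measurableI; apply: open_measurable_autQ.
    exact: (open_eval _ [set v | v \in vs n]).
  exact: (open_evalV _ [set v | v \in vs n]).
have mU : measurable (\bigcup_n A n) by apply: bigcup_measurable.
have leU : (mu (\bigcup_n A n) <= (1 / 2)%:E)%E.
  have sub : \bigcup_n A n `<=` \bigcup_n A n by [].
  apply: (le_trans (measure_sigma_subadditive mu mA mU sub)).
  have h12 : 0 <= (1 / 2 : R) by rewrite divr_ge0.
  apply: (le_trans _ (epsilon_trick0 xpredT h12)).
  by apply: lee_nneseries => // n _; exact: vsP.
exists (~` \bigcup_n A n); split.
- exact: measurableC.
- move=> q; exists (vs (pickle q)) => k nk; apply: contrapT => h; apply: nk.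
  by exists (pickle q) => //; rewrite /A /= /qn pickleK.
- rewrite probability_setC// sube_gt0; apply: le_lt_trans leU _.
  by rewrite lte_fin ltr_pdivrMr// mul1r ltr1n.
Qed.

(** The value at [p] splits the set into countably many pieces, one of which has positive measure;
    repeat over the list. *)
Lemma concentrate (K : set autQ) (ps : seq rat) : measurable (K : set T) ->
  (0 < mu K)%E -> exists K' : set autQ, [/\ K' `<=` K, measurable (K' : set T),
    (0 < mu K')%E & forall k k', K' k -> K' k' -> forall p, p \in ps -> k p = k' p].
Proof.
move=> mK K0; elim: ps => [|p ps [K' [sK mK' K'0 agree]]]; first by exists K; split.
pose F n : set T := K' `&` [set k : autQ | k p = odflt 0 (unpickle n)].
have mF n : measurable (F n).
  apply: measurableI => //; apply: open_measurable_autQ.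
  exact: (open_eval p [set odflt 0 (unpickle n)]).
have [n Fn] : exists n, (0 < mu (F n))%E.
  apply: contrapT => h; move: K'0; apply/negP; rewrite -leNgt.
  have sub : K' `<=` \bigcup_n F n.
    by move=> k Kk; exists (pickle (k p)) => //; split=> //=; rewrite pickleK.
  apply: (le_trans (measure_sigma_subadditive mu mF mK' sub)).
  rewrite eseries0// => n _ _; apply/eqP; rewrite eq_le measure_ge0 andbT leNgt.
  by apply/negP => h'; apply: h; exists n.
exists (F n); split=> //; first by move=> k [/sK].
move=> k k' [Kk kp] [Kk' kp'] r; rewrite inE => /predU1P[->|]; first by rewrite kp kp'.
exact: agree.
Qed.

End Tightness.

(** A piece of positive measure is carried into the class by a left translation, hence lies in a
    translate of [B], which was to have measure zero. *)
Lemma class_not_haar_null (R : realType) f : finite_set (fixed_points f) ->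
  sign_alternating f -> ~ haar_null R (conjugacy_class f).
Proof.
move=> /finite_seqP[ps psE] alt [B [[bB [mu muB]] sub]].
have [K [mK Kf K0]] := tight mu.
have [K' [sK mK' K'0 agree]] := concentrate ps mK K0.
have [k0 Kk0] : K' !=set0.
  by apply/set0P/eqP => e; move: K'0; rewrite e measure0 ltxx.
have [|||g gP] := @catch_finite f K' k0 ps alt.
- by rewrite psE.
- exact: finite_valuedS Kf.
- by move=> k Kk; exact: agree.
have : (mu K' <= mu (translate (g^-1)%g 1%g B))%E.
  apply: le_measure; rewrite ?inE//; first exact: borel_translate.
  move=> k Kk; rewrite translateE /= invgK; apply: sub; apply: gP.
  by exists k => //; rewrite invg1.
by rewrite muB leNgt K'0.
Qed.

(** * A random automorphism *)

(* A point [(rx, ry)] of the random graph together with the next point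
   [(alt_x, alt_y)] of its staircase, which lies weakly below and to the right.
   The point protects the box on its left when [alt_y < ry] and the box on its
   right when [rx < alt_x]. *)
Definition rpt := ((rat * rat) * (rat * rat))%type.
Definition rx (e : rpt) := e.1.1.
Definition ry (e : rpt) := e.1.2.
Definition alt_x (e : rpt) := e.2.1.
Definition alt_y (e : rpt) := e.2.2.

Definition lcap e := rx e < alt_x e.
Definition rcap e := alt_y e < ry e.

Definition rstate (s : seq rpt) := forall e e', e \in s -> e' \in s ->
  (rx e < rx e') = (ry e < ry e') /\ (rx e = rx e' -> e = e').

Definition stair := nat -> rat * rat.

Definition xincr (g : stair) := forall l, (g l).1 < (g l.+1).1.
Definition ydecr (g : stair) := forall l, (g l.+1).2 < (g l).2.

(** Staircases strictly to the right of a new target [v], before its next neighbour [b], and above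
    the alternative height of [b] when [b] protects its left. *)
Definition spec0 (v : rat) (s : seq rpt) (g : stair) := [/\ xincr g, ydecr g &
  forall l, [/\ v < (g l).1,
    forall e, e \in s -> rx e < v -> ry e < (g l).2,
    forall e, e \in s -> v < rx e -> (g l).1 < rx e /\ (g l).2 < ry e &
    forall b, b \in s -> v < rx b ->
      (forall e, e \in s -> v < rx e -> rx b <= rx e) -> rcap b -> alt_y b < (g l).2]].

(** The target itself. Its abscissa is prescribed, so only the height varies and a protected
    abscissa of the left neighbour cannot be respected. *)
Definition spec1 (v : rat) (s : seq rpt) (g : stair) := [/\ ydecr g &
  forall l, [/\ (g l).1 = v,
    forall e, e \in s -> rx e < v -> ry e < (g l).2,
    forall e, e \in s -> v < rx e -> (g l).2 < ry e &
    forall b, b \in s -> v < rx b ->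
      (forall e, e \in s -> v < rx e -> rx b <= rx e) -> rcap b -> alt_y b < (g l).2]].

(** Staircases to the left of the target, free in both coordinates and thus able to respect the
    point [w] over [v] as well as the left neighbour [a]. *)
Definition spec2 (v : rat) (s : seq rpt) (g : stair) := [/\ xincr g, ydecr g &
  exists w, [/\ w \in s, rx w = v & forall l, [/\ (g l).1 < v /\ (g l).2 < ry w,
    forall e, e \in s -> rx e < v -> rx e < (g l).1 /\ ry e < (g l).2,
    rcap w -> alt_y w < (g l).2 &
    forall a, a \in s -> rx a < v ->
      (forall e, e \in s -> rx e < v -> rx e <= rx a) -> lcap a -> (g l).1 < alt_x a]]].

Definition in_dom (v : rat) (s : seq rpt) := v \in map rx s.

Definition spec (ph : nat) v s (o : option stair) :=
  match ph with
  | 0 => (in_dom v s /\ o = None) \/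
         (~ in_dom v s /\ exists2 g, o = Some g & spec0 v s g)
  | 1 => (in_dom v s /\ o = None) \/
         (~ in_dom v s /\ exists2 g, o = Some g & spec1 v s g)
  | _ => (~ in_dom v s /\ o = None) \/
         (in_dom v s /\ exists2 g, o = Some g & spec2 v s g)
  end.

Definition ins s (o : option stair) l : seq rpt :=
  if o is Some g then (g l, g l.+1) :: s else s.

Lemma incr_seq (a b : rat) : a < b -> exists xi : nat -> rat,
  (forall l, a < xi l /\ xi l < b) /\ forall l, xi l < xi l.+1.
Proof.
(* The denominator starts at 2, which keeps the first term above [a]. *)
move=> ab; exists (fun l => b - (b - a) / l.+2%:R).
have d0 : 0 < b - a by rewrite subr_gt0.
split=> l; last first.
  rewrite ltrD2l ltrN2 ltr_pM2l// ltf_pV2 ?posrE ?ltr0n// ltr_nat//.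
have h : 0 < (b - a) / l.+2%:R by rewrite divr_gt0// ltr0n.
split; last by rewrite ltrBlDr ltrDl.
by rewrite ltrBrDl addrC -ltrBrDl ltr_pdivrMr ?ltr0n// ltr_pMr// ltr1n.
Qed.

Lemma decr_seq (a b : rat) : a < b -> exists xi : nat -> rat,
  (forall l, a < xi l /\ xi l < b) /\ forall l, xi l.+1 < xi l.
Proof.
rewrite -ltrN2 => /incr_seq[xi [h1 h2]]; exists (fun l => - xi l); split=> l.
  by have [k1 k2] := h1 l; split; [rewrite ltrNr|rewrite ltrNl].
by rewrite ltrN2.
Qed.

Lemma seq_max (s : seq rat) : s = [::] \/
  exists2 m, m \in s & forall a, a \in s -> a <= m.
Proof.
elim: s => [|x s [->|[m ms mP]]]; [by left|right; exists x; rewrite ?inE//|right].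
  by move=> a; rewrite inE => /eqP ->.
have [h|h] := leP x m.
  exists m; first by rewrite inE ms orbT.
  by move=> a; rewrite inE => /predU1P[->//|/mP].
exists x; first by rewrite inE eqxx.
by move=> a; rewrite inE => /predU1P[->//|/mP/le_trans]; apply; exact: ltW.
Qed.

Lemma seq_min (s : seq rat) : s = [::] \/
  exists2 m, m \in s & forall a, a \in s -> m <= a.
Proof.
have [e|[m ms mP]] := seq_max (map -%R s).
  by left; move: e; case: s.
move: ms => /mapP[x xs ->] in mP *; right; exists x => // a as_.
by rewrite -lerN2; apply: mP; exact: map_f.
Qed.

Lemma gap (lo hi : seq rat) : (forall a b, a \in lo -> b \in hi -> a < b) ->
  exists c d : rat, [/\ c < d, forall a, a \in lo -> a <= c &
    forall b, b \in hi -> d <= b].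
Proof.
move=> lh; have [->|[c cl cP]] := seq_max lo; have [->|[d dh dP]] := seq_min hi.
- by exists 0, 1; split.
- by exists (d - 1), d; split=> //; rewrite ltrBlDr ltrDl.
- by exists c, (c + 1); split=> //; rewrite ltrDl.
- by exists c, d; split=> //; exact: lh.
Qed.

(** The constraints are finitely many bounds on each coordinate. A protected value is compatible
    with the others because only the nearest neighbour contributes one, and its alternative is on
    the near side of it. *)
Lemma spec_ex ph v s : rstate s -> exists o, spec ph v s o.
Proof.
move=> st; have [vd|vd] := pselect (in_dom v s); last first.
  have nv e : e \in s -> rx e != v.
    by move=> es; apply/eqP => h; apply: vd; rewrite -h; exact: map_f.
  pose nb b := `[< forall e, e \in s -> v < rx e -> rx b <= rx e >].
  pose loy := [seq ry e | e <- s & rx e < v] ++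
    [seq alt_y b | b <- s & [&& v < rx b, nb b & alt_y b < ry b]].
  pose hiy := [seq ry e | e <- s & v < rx e].
  have [|y0 [y1 [y01 y0P y1P]]] := @gap loy hiy.
    move=> a b; rewrite mem_cat => /orP[] /mapP[e + ->] /mapP[e' + ->];
      rewrite !mem_filter.
      move=> /andP[ev es] /andP[ve' e's]; have [<- _] := st _ _ es e's.
      exact: lt_trans ve'.
    move=> /andP[/and3P[ve /asboolP ne ae] es] /andP[ve' e's].
    apply: (lt_le_trans ae); rewrite leNgt; have [<- _] := st _ _ e's es.
    by rewrite -leNgt; exact: ne.
  have [eta [eta1 eta2]] := decr_seq y01.
  have lo1 l e : e \in s -> rx e < v -> ry e < eta l.
    move=> es ev; apply: le_lt_trans (eta1 l).1; apply: y0P; rewrite mem_cat.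
    by apply/orP; left; apply: map_f; rewrite mem_filter ev.
  have lo2 l b : b \in s -> v < rx b -> (forall e, e \in s -> v < rx e ->
      rx b <= rx e) -> rcap b -> alt_y b < eta l.
    move=> bs vb nbb rb; apply: le_lt_trans (eta1 l).1; apply: y0P.
    rewrite mem_cat; apply/orP; right; apply: map_f; rewrite mem_filter vb bs.
    by rewrite -/(rcap b) rb !andbT; apply/asboolP.
  have hi1 l e : e \in s -> v < rx e -> eta l < ry e.
    move=> es ve; apply: lt_le_trans (eta1 l).2 _; apply: y1P; apply: map_f.
    by rewrite mem_filter ve.
  case: ph => [|[|ph]]; last by exists None; left.
    have [|x0 [x1 [x01 x0P x1P]]] := @gap [:: v] [seq rx e | e <- s & v < rx e].
      move=> a b; rewrite inE => /eqP -> /mapP[e].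
      by rewrite mem_filter => /andP[ve _] ->.
    have [xi [xi1 xi2]] := incr_seq x01.
    exists (Some (fun l => (xi l, eta l))); right; split=> //.
    exists (fun l => (xi l, eta l)) => //; split=> // l; split=> //.
    - by apply: le_lt_trans (xi1 l).1; apply: x0P; rewrite inE.
    - exact: lo1.
    - move=> e es ve; split; last exact: hi1.
      apply: lt_le_trans (xi1 l).2 _; apply: x1P; apply: map_f.
      by rewrite mem_filter ve.
    - exact: lo2.
  exists (Some (fun l => (v, eta l))); right; split=> //.
  exists (fun l => (v, eta l)) => //; split=> // l; split=> //.
  - exact: lo1.
  - exact: hi1.
  - exact: lo2.
case: ph => [|[|ph]]; [by exists None; left|by exists None; left|].
have /mapP[w ws wv] := vd.
pose nb a := `[< forall e, e \in s -> rx e < v -> rx e <= rx a >].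
pose lox := [seq rx e | e <- s & rx e < v].
pose hix := v :: [seq alt_x a | a <- s & [&& rx a < v, nb a & rx a < alt_x a]].
have [|x0 [x1 [x01 x0P x1P]]] := @gap lox hix.
  move=> a b /mapP[e + ->]; rewrite mem_filter inE => /andP[ev es].
  move=> /predU1P[->//|/mapP[c + ->]]; rewrite mem_filter.
  by move=> /andP[/and3P[cv /asboolP nc ac] cs]; apply: le_lt_trans ac; exact: nc.
pose loy := [seq ry e | e <- s & rx e < v] ++ (if rcap w then [:: alt_y w] else [::]).
have [|y0 [y1 [y01 y0P y1P]]] := @gap loy [:: ry w].
  move=> a b; rewrite mem_cat [b \in _]inE => /orP[/mapP[e + ->]|+] /eqP ->.
    rewrite mem_filter => /andP[ev es]; have [<- _] := st _ _ es ws.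
    by rewrite -wv.
  by case: ifP => // rw; rewrite inE => /eqP ->.
have [xi [xi1 xi2]] := incr_seq x01.
have [eta [eta1 eta2]] := decr_seq y01.
exists (Some (fun l => (xi l, eta l))); right; split=> //.
exists (fun l => (xi l, eta l)) => //; split=> //; exists w; split=> // l; split=> /=.
- split; first by apply: lt_le_trans (xi1 l).2 _; apply: x1P; rewrite inE eqxx.
  by apply: lt_le_trans (eta1 l).2 _; apply: y1P; rewrite inE.
- move=> e es ev; split.
    apply: le_lt_trans (xi1 l).1; apply: x0P; apply: map_f.
    by rewrite mem_filter ev.
  apply: le_lt_trans (eta1 l).1; apply: y0P; rewrite mem_cat.
  by apply/orP; left; apply: map_f; rewrite mem_filter ev.
- move=> rw; apply: le_lt_trans (eta1 l).1; apply: y0P; rewrite mem_cat.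
  by rewrite rw inE eqxx orbT.
- move=> a as_ av na la; apply: lt_le_trans (xi1 l).2 _; apply: x1P.
  rewrite inE; apply/orP; right; apply: map_f; rewrite mem_filter av as_.
  by rewrite -/(lcap a) la !andbT; apply/asboolP.
Qed.

Lemma rstate_cons s (p q : rat * rat) : rstate s ->
  (forall e, e \in s -> (rx e < p.1 /\ ry e < p.2) \/ (p.1 < rx e /\ p.2 < ry e)) ->
  rstate ((p, q) :: s).
Proof.
move=> st h e e'; rewrite !inE => /predU1P[->|es] /predU1P[->|e's].
- by rewrite /rx /ry /= !ltxx.
- rewrite /rx /ry /=; case: (h _ e's) => -[h1 h2]; split.
  + by rewrite !ltNge !ltW.
  + by move=> e0; move: h1; rewrite /rx /= e0 ltxx.
  + by rewrite h1 h2.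
  + by move=> e0; move: h1; rewrite /rx /= e0 ltxx.
- rewrite /rx /ry /=; case: (h _ es) => -[h1 h2]; split.
  + by rewrite h1 h2.
  + by move=> e0; move: h1; rewrite /rx /= e0 ltxx.
  + by rewrite !ltNge !ltW.
  + by move=> e0; move: h1; rewrite /rx /= e0 ltxx.
- exact: st.
Qed.

Lemma spec_rstate ph v s o l : rstate s -> spec ph v s o -> rstate (ins s o l).
Proof.
move=> st; case: ph => [|[|ph]] /=.
- move=> [[_ ->]//|[vd [g -> [_ _ gP]]]]; apply: rstate_cons => // e es.
  have [h1 h2 h3 _] := gP l.
  case: (ltgtP (rx e) v) => [ev|ve|ev]; last first.
  + by case: vd; rewrite -ev; exact: map_f.
  + by right; exact: h3.
  + by left; split; [exact: lt_trans h1|exact: h2].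
- move=> [[_ ->]//|[vd [g -> [_ gP]]]]; apply: rstate_cons => // e es.
  have [h1 h2 h3 _] := gP l; rewrite h1.
  case: (ltgtP (rx e) v) => [ev|ve|ev]; last first.
  + by case: vd; rewrite -ev; exact: map_f.
  + by right; split=> //; exact: h3.
  + by left; split=> //; exact: h2.
- move=> [[_ ->]//|[vd [g -> [_ _ [w [ws wv gP]]]]]]; apply: rstate_cons => // e es.
  have [[h1 h1'] h2 _ _] := gP l.
  have [ev|ve] := ltP (rx e) v; [left; exact: h2|right].
  split; first exact: lt_le_trans ve.
  apply: lt_le_trans h1' _; rewrite leNgt; have [<- _] := st _ _ es ws.
  by rewrite -leNgt wv.
Qed.

(** * The two neighbours of a cut *)

Section Cut.
Variable lft : rpt -> Prop.

Definition sep_cut (s : seq rpt) := forall e e', e \in s -> e' \in s ->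
  lft e -> ~ lft e' -> rx e < rx e'.

Definition nbrs (s : seq rpt) a b := [/\ a \in s /\ b \in s, lft a, ~ lft b,
  forall e, e \in s -> lft e -> rx e <= rx a &
  forall e, e \in s -> ~ lft e -> rx b <= rx e].

(** What the absence of hits yields near an invariant cut at which points move up: alternatives of
    points on one side do not reach past points on the other side. *)
Definition not_hit (s : seq rpt) a b := forall e e', e \in s -> e' \in s ->
  lft e -> ~ lft e' -> rx a <= rx e -> rx e' <= rx b ->
  ry e < alt_y e' /\ alt_x e < rx e'.

(** Either nothing changes, or one neighbour is replaced by a protecting point while the other,
    which stays, does not protect its side. A protecting neighbour blocks replacement of the
    opposite one, so the relation is transitive and one side is frozen. *)
Definition progress a b a' b' := [\/ a' = a /\ b' = b,
  [/\ a' = a, ~~ lcap a & rcap b'] | [/\ b' = b, ~~ rcap b & lcap a']].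

Lemma progress_trans a b a1 b1 a2 b2 :
  progress a b a1 b1 -> progress a1 b1 a2 b2 -> progress a b a2 b2.
Proof.
move=> [[-> ->]//|[-> h1 h2]|[-> h1 h2]].
- case=> [[-> ->]|[-> h3 h4]|[_ h3 h4]].
  + by constructor 2.
  + by constructor 2.
  + by rewrite h2 in h3.
- case=> [[-> ->]|[_ h3 h4]|[-> h3 h4]].
  + by constructor 3.
  + by rewrite h2 in h3.
  + by constructor 3.
Qed.

Definition macro_result a b s' := exists a' b', [/\ nbrs s' a' b',
  rx a <= rx a', rx b' <= rx b & progress a b a' b'].

(** The new point matters only if [v] is the abscissa of the right neighbour [b]. On either side of
    the cut it respects the protection of the opposite neighbour, which [not_hit] then excludes. *)
Lemma macro_dom v s o l a b : rstate s -> in_dom v s -> spec 2 v s o ->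
  sep_cut (ins s o l) -> not_hit (ins s o l) a b -> nbrs s a b ->
  macro_result a b (ins s o l).
Proof.
move=> st vd /= [[]//|[_ [g -> [xg yg [w [ws wv gP]]]]]] /=.
set z : rpt := (g l, g l.+1) => sc nh [[as_ bs] la lb amax bmin].
have [[zv zw] zlo zcap zcap'] := gP l.
have zz : z \in z :: s by rewrite inE eqxx.
have up e : e \in s -> e \in z :: s by rewrite inE orbC => ->.
have ab := sc _ _ (up _ as_) (up _ bs) la lb.
have same (h1 : lft z -> rx z <= rx a) (h2 : ~ lft z -> rx b <= rx z) :
    macro_result a b (z :: s).
  exists a, b; split=> //; last by constructor 1.
  split=> //; first by split; exact: up.
    by move=> e; rewrite inE => /predU1P[->//|/amax].
  by move=> e; rewrite inE => /predU1P[->//|/bmin].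
have [lw|lw] := pselect (lft w).
  have za : rx z < rx a by apply: lt_le_trans zv _; rewrite -wv; exact: amax.
  apply: same => [_|nz]; first exact: ltW.
  by move: (sc _ _ (up _ as_) zz la nz) => /(lt_trans za); rewrite ltxx.
have bw := bmin _ ws lw.
move: bw; rewrite le_eqVlt => /predU1P[bw|bw]; last first.
  have bz : rx b < rx z by apply: (zlo _ bs _).1; rewrite -wv.
  apply: same => [lz|_]; last exact: ltW.
  by move: (sc _ _ zz (up _ bs) lz lb) => /(lt_trans bz); rewrite ltxx.
have {bw} ebw : b = w by have [_] := st _ _ bs ws; exact.
subst w.
have av : rx a < v by rewrite -wv.
have anb e : e \in s -> rx e < v -> rx e <= rx a.
  move=> es ev; have [le|le] := pselect (lft e); first exact: amax.
  by move: (bmin _ es le); rewrite leNgt wv ev.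
have [azx _] := zlo _ as_ av.
have zb : rx z < rx b by rewrite wv.
have [lz|lz] := pselect (lft z).
  have [h _] := nh _ _ zz (up _ bs) lz lb (ltW azx) (lexx _).
  exists z, b; split=> //; [|exact: ltW|].
    split=> //; first by split=> //; exact: up.
      move=> e; rewrite inE => /predU1P[->//|es le].
      by rewrite (le_trans (amax _ es le))// ltW.
    by move=> e; rewrite inE => /predU1P[->//|/bmin].
  constructor 3; split=> //; last exact: xg.
  by apply/negP => /zcap /(lt_trans h); rewrite ltxx.
have [_ h] := nh _ _ (up _ as_) zz la lz (lexx _) (ltW zb).
exists a, z; split=> //; [|exact: ltW|].
  split=> //; first by split=> //; exact: up.
    by move=> e; rewrite inE => /predU1P[->//|/amax].
  move=> e; rewrite inE => /predU1P[->//|es le].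
  by rewrite (le_trans _ (bmin _ es le))// ltW.
constructor 2; split=> //; last exact: yg.
by apply/negP => /(zcap' _ as_ av anb) /(lt_trans h); rewrite ltxx.
Qed.

(** In the essential case the target lies between [a] and [b] and receives [z] on its right, itself
    as [t], and [z'] on its left. If [z] is left of the cut, it becomes the left neighbour;
    otherwise protection pushes [t] and then [z'] to the right as well, and [z'] becomes the right
    neighbour. So [t] never becomes a neighbour itself. *)
Lemma macro v s0 o0 o1 o2 l0 l1 l2 a b : rstate s0 ->
  let s1 := ins s0 o0 l0 in let s2 := ins s1 o1 l1 in let s3 := ins s2 o2 l2 in
  spec 0 v s0 o0 -> spec 1 v s1 o1 -> spec 2 v s2 o2 ->
  sep_cut s3 -> not_hit s3 a b -> nbrs s0 a b -> macro_result a b s3.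
Proof.
move=> st s1 s2 s3 sp0 sp1 sp2 sc nh nb.
have [vd|vd] := pselect (in_dom v s0).
  have e1 : s1 = s0 by rewrite /s1; case: sp0 => [[_ ->]|[]].
  have e2 : s2 = s0.
    by rewrite /s2; move: sp1; rewrite e1 => -[[_ ->]//|[]].
  rewrite /s3 e2 in sp2 sc nh *.
  exact: macro_dom sp2 sc nh nb.
case: sp0 => [[]//|[_ [g0 e0 [xg0 yg0 g0P]]]].
have [z1 z2 z3 z4] := g0P l0.
pose z : rpt := (g0 l0, g0 l0.+1).
have es1 : s1 = z :: s0 by rewrite /s1 e0.
have vd1 : ~ in_dom v s1.
  rewrite es1 /in_dom /= inE => /predU1P[vz|//].
  by move: z1; rewrite vz ltxx.
have st1 : rstate s1.
  by apply: (@spec_rstate 0 v) => //; right; split=> //; exists g0.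
case: sp1 => [[]//|[_ [g1 e1 [yg1 g1P]]]].
have [t1 t2 t3 t4] := g1P l1.
pose t : rpt := (g1 l1, g1 l1.+1).
have es2 : s2 = t :: s1 by rewrite /s2 e1.
have st2 : rstate s2.
  by apply: (@spec_rstate 1 v) => //; right; split=> //; exists g1.
have vd2 : in_dom v s2 by rewrite es2 /in_dom /= inE -t1 eqxx.
case: sp2 => [[]//|[_ [g2 e2 [xg2 yg2 [w [ws wv g2P]]]]]].
have [[u1 u2] u3 u4 u5] := g2P l2.
pose z' : rpt := (g2 l2, g2 l2.+1).
have es3 : s3 = z' :: s2 by rewrite /s3 e2.
have ts2 : t \in s2 by rewrite es2 inE eqxx.
have wt : w = t by have [_] := st2 _ _ ws ts2; apply; rewrite wv -t1.
rewrite wt in u2 u4.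
have in0 e : e \in s0 -> e \in s3.
  by rewrite es3 es2 es1 !inE => ->; rewrite !orbT.
have in1 e : e \in s0 -> e \in s1 by rewrite es1 !inE => ->; rewrite !orbT.
have in2 e : e \in s0 -> e \in s2 by rewrite es2 es1 !inE => ->; rewrite !orbT.
have zs3 : z \in s3 by rewrite es3 es2 es1 !inE eqxx !orbT.
have ts3 : t \in s3 by rewrite es3 es2 es1 !inE eqxx !orbT.
have z's3 : z' \in s3 by rewrite es3 !inE eqxx.
have zs1 : z \in s1 by rewrite es1 !inE eqxx.
have s3P e : e \in s3 -> [\/ e = z', e = t, e = z | e \in s0].
  by rewrite es3 es2 es1 !inE => /or4P[/eqP|/eqP|/eqP|]; [constructor 1|
    constructor 2|constructor 3|constructor 4].
have vt : rx t = v := t1.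
have vz : v < rx z := z1.
have z'v : rx z' < v := u1.
have [[as_ bs] la lb amax bmin] := nb.
have ab := sc _ _ (in0 _ as_) (in0 _ bs) la lb.
have asym e e' : e \in s3 -> e' \in s3 -> lft e -> rx e' <= rx e -> lft e'.
  move=> h h' le ee'; apply: contrapT => le'.
  by move: (sc _ _ h h' le le'); rewrite ltNge ee'.
have same : (forall e, e \in [:: z'; t; z] -> lft e -> rx e <= rx a) ->
    (forall e, e \in [:: z'; t; z] -> ~ lft e -> rx b <= rx e) ->
    macro_result a b s3.
  move=> h1 h2; exists a, b; split=> //; last by constructor 1.
  split=> //; first by split; exact: in0.
    by move=> e /s3P[->|->|->|/amax//]; apply: h1; rewrite !inE eqxx ?orbT.
  by move=> e /s3P[->|->|->|/bmin//]; apply: h2; rewrite !inE eqxx ?orbT.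
case: (ltgtP v (rx a)) => [va|av|va]; last by case: vd; rewrite va; exact: map_f.
  have [za _] := z3 _ as_ va.
  have lt e : e \in [:: z'; t; z] -> rx e < rx a.
    rewrite !inE => /or3P[] /eqP -> //; last by rewrite vt.
    exact: lt_trans va.
  apply: same => e ee; first by move=> _; exact/ltW/lt.
  case; apply: asym la (ltW (lt _ ee)); last first.
    by move: ee; rewrite !inE => /or3P[] /eqP ->.
  exact: in0.
case: (ltgtP v (rx b)) => [vb|bv|vb]; last by case: vd; rewrite vb; exact: map_f.
  2: {
  have [bz' _] := u3 _ (in2 _ bs) bv.
  have lt e : e \in [:: z'; t; z] -> rx b < rx e.
    rewrite !inE => /or3P[] /eqP -> //; first by rewrite vt.
    exact: lt_trans vz.
  apply: same => e ee; last by move=> _; exact/ltW/lt.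
  move=> le; case: lb; apply: asym le (ltW (lt _ ee)); last exact: in0.
  by move: ee; rewrite !inE => /or3P[] /eqP ->. }
have bnb e : e \in s0 -> v < rx e -> rx b <= rx e.
  move=> es ve; have [le|le] := pselect (lft e); last exact: bmin.
  by move: (lt_le_trans ve (amax _ es le)) => /(lt_trans av); rewrite ltxx.
have anb e : e \in s0 -> rx e < v -> rx e <= rx a.
  move=> es ev; have [le|le] := pselect (lft e); first exact: amax.
  by move: (le_lt_trans (bmin _ es le) ev) => /(lt_trans vb); rewrite ltxx.
have [zb _] : rx z < rx b /\ ry z < ry b := z3 _ bs vb.
have az : rx a < rx z := lt_trans av vz.
have [lz|lz] := pselect (lft z).
  have [h _] := nh _ _ zs3 (in0 _ bs) lz lb (ltW az) (lexx _).
  exists z, b; split=> //; [|exact: ltW|].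
    split=> //; first by split=> //; exact: in0.
      move=> e /s3P[->|->|->|es le] //.
      - by rewrite (ltW (lt_trans z'v vz)).
      - by rewrite vt ltW.
      - by rewrite (le_trans (amax _ es le))// ltW.
    move=> e /s3P[->|->|->|es le] //; last exact: bmin.
    - by case; apply: asym lz _ => //; rewrite ltW// (lt_trans z'v).
    - by case; apply: asym lz _ => //; rewrite ltW// vt.
  constructor 3; split=> //; last exact: xg0.
  by apply/negP => /(z4 _ bs vb bnb) /(lt_trans h); rewrite ltxx.
(* [z] is the nearest point to the right of [v] and protects its left, so [t] was placed above its
   alternative; with [not_hit] this forbids [t] to be left of the cut. *)
have tz : alt_y z < ry t.
  apply: (t4 z zs1 vz); last exact: yg0.
  move=> e; rewrite es1 inE => /predU1P[->//|es ve].
  by have [/ltW] := z3 _ es ve.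
have lt : ~ lft t.
  move=> lt; have [|h _] := nh _ _ ts3 zs3 lt lz _ (ltW zb).
    by rewrite vt ltW.
  by move: (lt_trans h tz); rewrite ltxx.
have lz' : ~ lft z'.
  have [az' _] : rx a < rx z' /\ ry a < ry z' := u3 _ (in2 _ as_) av.
  move=> lz'; have [||h _] := nh _ _ z's3 ts3 lz' lt.
  - exact: ltW.
  - by rewrite vt ltW.
  have := u4 (yg1 l1); rewrite -/(alt_y t) => /(lt_trans h).
  by rewrite ltxx.
have z'b : rx z' < rx b := lt_trans z'v vb.
have [_ h] := nh _ _ (in0 _ as_) z's3 la lz' (lexx _) (ltW z'b).
exists a, z'; split=> //; [|exact: ltW|].
  split=> //; first by split=> //; exact: in0.
    by move=> e /s3P[->|->|->|es le] //; exact: amax.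
  move=> e /s3P[->|->|->|es le] //.
  - by rewrite vt ltW.
  - by rewrite ltW// (lt_trans z'v).
  - by rewrite (le_trans _ (bmin _ es le))// ltW.
constructor 2; split=> //; last exact: yg2.
(* If [a] protected its right, [z'] would have been placed before [alt_x a], against [not_hit]. *)
apply/negP => /(u5 _ (in2 _ as_) av) h'.
have /h' : forall e, e \in s2 -> rx e < v -> rx e <= rx a.
  move=> e; rewrite es2 es1 !inE => /or3P[/eqP ->|/eqP ->|es ev].
  - by rewrite vt ltxx.
  - by move=> /(lt_trans vz); rewrite ltxx.
  - exact: anb.
by move=> /(lt_trans h); rewrite ltxx.
Qed.

End Cut.

(** The sign change keeps staircases descending to the right, which a plain exchange of coordinates
    would not; it also turns the order around, so the two sides of a cut, and of the protection, are
    interchanged. *)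
Definition refl (e : rpt) : rpt := ((- ry e, - rx e), (- alt_y e, - alt_x e)).
Definition refl_stair (g : stair) : stair := fun l => (- (g l).2, - (g l).1).

Lemma reflK : involutive refl.
Proof. by move=> [[x y] [x' y']]; rewrite /refl /rx /ry /alt_x /alt_y /= !opprK. Qed.

Lemma refl_stairK : involutive refl_stair.
Proof.
move=> g; apply/funext => l; rewrite /refl_stair /= !opprK.
by case: (g l).
Qed.

Lemma mem_refl s e : (refl e \in map refl s) = (e \in s).
Proof. by rewrite mem_map//; exact: can_inj reflK. Qed.

Lemma refl_ins s o l :
  map refl (ins s o l) = ins (map refl s) (omap refl_stair o) l.
Proof. by case: o. Qed.

Lemma rstate_refl s : rstate s -> rstate (map refl s).
Proof.
move=> st _ _ /mapP[e es ->] /mapP[e' e's ->].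
rewrite /refl /rx /ry /= -/(rx e) -/(rx e') -/(ry e) -/(ry e') !ltrN2.
have [h1 h2] := st _ _ e's es; split; first by rewrite h1.
move=> /oppr_inj he; congr refl; apply/esym/h2; apply/eqP.
rewrite eq_le !leNgt h1; have [-> _] := st _ _ es e's.
by rewrite he ltxx.
Qed.

Lemma rstate_le s e e' : rstate s -> e \in s -> e' \in s ->
  (rx e <= rx e') = (ry e <= ry e').
Proof. by move=> st h h'; rewrite !leNgt; have [-> _] := st _ _ h' h. Qed.

Section Reflection.
Variable lft : rpt -> Prop.
Let lft' e := ~ lft (refl e).

Lemma sep_cut_refl s : rstate s -> sep_cut lft s -> sep_cut lft' (map refl s).
Proof.
move=> st sc _ _ /mapP[e es ->] /mapP[e' e's ->]; rewrite /lft' !reflK.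
move=> h1 /contrapT h2; rewrite /rx /= ltrN2.
by have [<- _] := st _ _ e's es; exact: sc.
Qed.

Lemma nbrs_refl s a b : rstate s -> nbrs lft s a b <->
  nbrs lft' (map refl s) (refl b) (refl a).
Proof.
move=> st; rewrite /nbrs /lft' !reflK; split=> -[[h1 h2] h3 h4 h5 h6].
  split; rewrite ?mem_refl//.
    move=> _ /mapP[e es ->]; rewrite reflK /rx /= lerN2 => le.
    by rewrite -(rstate_le st)//; exact: h6.
  move=> _ /mapP[e es ->]; rewrite reflK /rx /= lerN2 => /contrapT le.
  by rewrite -(rstate_le st)//; exact: h5.
rewrite !mem_refl in h1 h2; split=> //; first exact: contrapT.
  move=> e es le; rewrite (rstate_le st)// -lerN2.
  by apply: (h6 (refl e)); rewrite ?mem_refl// reflK.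
move=> e es le; rewrite (rstate_le st)// -lerN2.
by apply: (h5 (refl e)); rewrite ?mem_refl// reflK.
Qed.

Lemma not_hit_refl s a b : rstate s -> a \in s -> b \in s ->
  not_hit lft s a b -> not_hit lft' (map refl s) (refl b) (refl a).
Proof.
move=> st as_ bs nh _ _ /mapP[e es ->] /mapP[e' e's ->]; rewrite /lft' !reflK.
move=> h1 /contrapT h2; rewrite /rx /ry /alt_x /alt_y /= !lerN2 !ltrN2 => h3 h4.
have [||g1 g2] := nh _ _ e's es h2 h1; last by [].
  by rewrite (rstate_le st).
by rewrite (rstate_le st).
Qed.

End Reflection.

Lemma progress_refl a b a' b' :
  progress (refl b) (refl a) (refl b') (refl a') -> progress a b a' b'.
Proof.
have cap e : lcap (refl e) = rcap e by rewrite /lcap /rcap /rx /alt_x /= ltrN2.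
have cap' e : rcap (refl e) = lcap e by rewrite /lcap /rcap /ry /alt_y /= ltrN2.
have inj := can_inj reflK.
rewrite /progress !cap !cap'; case=> [[/inj -> /inj ->]|[/inj -> h1 h2]|[/inj -> h1 h2]].
- by constructor 1.
- by constructor 3.
- by constructor 2.
Qed.

Definition target (n : nat) : rat := odflt 0 (unpickle n).
Arguments target : simpl never.

Lemma target_pickle x : target (pickle x) = x.
Proof. by rewrite /target pickleK. Qed.

(* Three consecutive stages put one target into the domain or, after the
   reflection [(x, y) -> (- y, - x)], into the range. *)
Definition stage (i : nat) s (o : option stair) :=
  if odd (i %/ 3) then
    spec (i %% 3) (target (i %/ 3)./2) (map refl s) (omap refl_stair o)
  else spec (i %% 3) (target (i %/ 3)./2) s o.

Lemma stage_ex i s : rstate s -> exists o, stage i s o.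
Proof.
move=> st; rewrite /stage; case: (odd (i %/ 3)); last exact: spec_ex.
have [g gP] := spec_ex (i %% 3) (target (i %/ 3)./2) (rstate_refl st).
exists (omap refl_stair g); case: g gP => //= g.
by rewrite refl_stairK.
Qed.

Lemma stage_rstate i s o l : rstate s -> stage i s o -> rstate (ins s o l).
Proof.
move=> st; rewrite /stage; case: ifP => _ h; last exact: spec_rstate h.
rewrite -[ins s o l](mapK reflK) refl_ins; apply: rstate_refl.
exact: spec_rstate (rstate_refl st) h.
Qed.

Definition stair_ok (g : stair) := forall l, [/\ (g l).1 <= (g l.+1).1,
  (g l.+1).2 <= (g l).2 & (g l).1 < (g l.+1).1 \/ (g l.+1).2 < (g l).2].

Lemma spec_stair_ok ph v s g : spec ph v s (Some g) -> stair_ok g.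
Proof.
have dual h : xincr h -> ydecr h -> stair_ok h.
  by move=> xh yh l; split; [exact/ltW/xh|exact/ltW/yh|left; exact: xh].
case: ph => [|[|ph]] /=.
- by move=> [[]//|[_ [_ [<-] [xg yg _]]]]; exact: dual.
- move=> [[]//|[_ [_ [<-] [yg gP]]]] l; split; [|exact/ltW/yg|right; exact: yg].
  by have [-> _ _ _] := gP l; have [-> _ _ _] := gP l.+1.
- by move=> [[]//|[_ [_ [<-] [xg yg _]]]]; exact: dual.
Qed.

Lemma stage_stair_ok i s g : stage i s (Some g) -> stair_ok g.
Proof.
rewrite /stage; case: ifP => _ /spec_stair_ok // h l.
have [h1 h2 h3] := h l; rewrite /= !lerN2 !ltrN2 in h1 h2 h3; split=> //.
by case: h3; [right|left].
Qed.

(** The graph of [psi] passes on or below the chosen point and strictly above the next one. *)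
Definition hit (psi : autQ) (g : stair) l :=
  psi (g l).1 <= (g l).2 /\ (g l.+1).2 < psi (g l.+1).1.

(** After the passage the staircase descends while [psi] increases, so the later points stay below
    its graph. *)
Lemma hit_uniq psi g l l' : stair_ok g -> hit psi g l -> hit psi g l' -> l = l'.
Proof.
move=> gok; suff wl a b : (a < b)%N -> hit psi g a -> ~ hit psi g b.
  by move=> h h'; case: (ltngtP l l') => // /wl; [move=> /(_ h)|move=> /(_ h')].
have mono n m : (n <= m)%N -> (g n).1 <= (g m).1 /\ (g m).2 <= (g n).2.
  move=> /subnK <-; elim: (m - n)%N => [|j [IH1 IH2]] //.
  rewrite addSn; have [h1 h2 _] := gok (j + n)%N.
  by split; [exact: le_trans h1|exact: le_trans IH2].
move=> ab [_ h1] [h2 _]; have [h3 h4] := mono _ _ ab.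
have : psi (g a.+1).1 <= psi (g b).1 by rewrite autQ_le_mono.
move=> /(lt_le_trans h1) /lt_le_trans /(_ h2) /lt_le_trans /(_ h4).
by rewrite ltxx.
Qed.

(** * Properties of a single run *)

Section Run.
Variables (S : nat -> seq rpt) (o : nat -> option stair) (l : nat -> nat).
Hypothesis S0 : S 0 = [::].
Hypothesis SS : forall i, S i.+1 = ins (S i) (o i) (l i).
Hypothesis Sst : forall i, stage i (S i) (o i).

Lemma run_rstate i : rstate (S i).
Proof.
elim: i => [|i IH]; first by rewrite S0.
by rewrite SS; exact: stage_rstate (Sst i).
Qed.

Lemma run_sub i j : (i <= j)%N -> {subset S i <= S j}.
Proof.
move=> /subnK <-; elim: (j - i)%N => [|n IH] // e /IH h.
by rewrite addSn SS; case: (o _) => [g|] //=; rewrite inE h orbT.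
Qed.

Lemma run_new N i e : e \in S i -> e \in S N \/
  exists j g, [/\ (N <= j)%N, o j = Some g & e = (g (l j), g (l j).+1)].
Proof.
elim: i => [|i IH]; first by rewrite S0.
rewrite SS; case E : (o i) => [g|] //=.
rewrite inE => /predU1P[->|//].
have [Ni|iN] := leqP N i; first by right; exists i, g.
by left; apply: (run_sub iN); rewrite SS E inE eqxx.
Qed.

Let st3 m ph : (ph < 3)%N -> if odd m
  then spec ph (target m./2) (map refl (S (3 * m + ph))) (omap refl_stair (o (3 * m + ph)))
  else spec ph (target m./2) (S (3 * m + ph)) (o (3 * m + ph)).
Proof.
move=> ph3; have := Sst (3 * m + ph)%N; rewrite /stage mulnC.
by rewrite divnMDl// divn_small// addn0 modnMDl modn_small.
Qed.

(** Even rounds treat the domain: [x] enters in phase 1 of round [(pickle x).*2] at the latest. The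
    range is served by the odd rounds, with target [- y]. *)
Lemma run_dom x : exists i e, e \in S i /\ rx e = x.
Proof.
have [m [mo mt]] : exists m, odd m = false /\ target m./2 = x.
  by exists (pickle x).*2; rewrite odd_double doubleK target_pickle.
have : in_dom x (S (3 * m + 2)).
  have := @st3 m 1 isT; rewrite mo mt.
  have -> : (3 * m + 2 = (3 * m + 1).+1)%N by rewrite addnS.
  rewrite SS => -[[xd ->]//|[_ [g -> [_ gP]]]].
  by rewrite /in_dom /= inE; have [h _ _ _] := gP (l (3 * m + 1)); rewrite /rx /= h eqxx.
by move=> /mapP[e es ->]; exists (3 * m + 2)%N, e.
Qed.

Lemma run_ran y : exists i e, e \in S i /\ ry e = y.
Proof.
have [m [mo mt]] : exists m, odd m = true /\ target m./2 = - y.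
  exists (pickle (- y)).*2.+1; split; first by rewrite oddS odd_double.
  by rewrite -[_./2]/(uphalf _) uphalf_double target_pickle.
have : in_dom (- y) (map refl (S (3 * m + 2))).
  have := @st3 m 1 isT; rewrite mo mt.
  have -> : (3 * m + 2 = (3 * m + 1).+1)%N by rewrite addnS.
  rewrite SS refl_ins => -[[xd]|[_ [g -> [_ gP]]]].
    by case: (o _) => [?//|] _.
  by rewrite /in_dom /= inE; have [h _ _ _] := gP (l (3 * m + 1)); rewrite /rx /= h eqxx.
move=> /mapP[_ /mapP[e es ->]]; rewrite /rx /= => /oppr_inj ->.
by exists (3 * m + 2)%N, e.
Qed.

Lemma run_graph : exists k : autQ, forall i e, e \in S i -> k (rx e) = ry e.
Proof.
pose H x y := exists i e, [/\ e \in S i, rx e = x & ry e = y].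
have [||| k kP] := @graph_autQ H.
- by move=> x; have [i [e [es <-]]] := run_dom x; exists (ry e), i, e.
- by move=> y; have [i [e [es <-]]] := run_ran y; exists (rx e), i, e.
- move=> x y x' y' [i [e [es <- <-]]] [j [e' [e's <- <-]]].
  have h : e \in S (maxn i j) by apply: run_sub es; exact: leq_maxl.
  have h' : e' \in S (maxn i j) by apply: run_sub e's; exact: leq_maxr.
  by have [] := run_rstate h h'.
by exists k => i e es; apply/kP; exists i, e.
Qed.

Lemma run_macro lft m a b : sep_cut lft (S (3 * m.+1)) ->
  not_hit lft (S (3 * m.+1)) a b -> nbrs lft (S (3 * m)) a b ->
  macro_result lft a b (S (3 * m.+1)).
Proof.
have e3 : (3 * m.+1 = (3 * m + 2).+1)%N by rewrite mulnS addnC addnS.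
have e2 : (3 * m + 2 = (3 * m + 1).+1)%N by rewrite addnS.
have e1 : (3 * m + 1 = (3 * m + 0).+1)%N by rewrite addnS.
have S1 : S (3 * m + 1) = ins (S (3 * m)) (o (3 * m)) (l (3 * m)).
  by rewrite e1 SS addn0.
have S2 : S (3 * m + 2) = ins (S (3 * m + 1)) (o (3 * m + 1)) (l (3 * m + 1)).
  by rewrite e2 SS.
have S3 : S (3 * m.+1) = ins (S (3 * m + 2)) (o (3 * m + 2)) (l (3 * m + 2)).
  by rewrite e3 SS.
have sp0 := @st3 m 0 isT; have sp1 := @st3 m 1 isT; have sp2 := @st3 m 2 isT.
have r0 := @run_rstate (3 * m)%N; have r3 := @run_rstate (3 * m.+1)%N.
rewrite addn0 in sp0; move=> sc nh nb.
move: sp0 sp1 sp2; case: ifP => _ sp0 sp1 sp2; last first.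
  rewrite S3 S2 S1 in sc nh *; rewrite S2 S1 in sp2; rewrite S1 in sp1.
  exact: macro sp0 sp1 sp2 sc nh nb.
have [[as_ bs] _ _ _ _] := nb.
have sub3 e : e \in S (3 * m) -> e \in S (3 * m.+1).
  by apply: run_sub; rewrite leq_mul2l leqnSn.
have sc' := sep_cut_refl r3 sc.
have nh' := not_hit_refl r3 (sub3 _ as_) (sub3 _ bs) nh.
move/(nbrs_refl _ _ _ r0) : nb => nb'.
rewrite S1 refl_ins in sp1; rewrite S2 S1 !refl_ins in sp2.
rewrite S3 S2 S1 !refl_ins in sc' nh'.
have [a' [b' [nbr h1 h2 pr]]] := macro (rstate_refl r0) sp0 sp1 sp2 sc' nh' nb'.
rewrite -!refl_ins -S1 -S2 -S3 -(reflK a') -(reflK b') in nbr.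
rewrite -(reflK a') -(reflK b') in pr.
move/(nbrs_refl _ _ _ r3) : nbr => nbr.
have [[i1 i2] _ _ _ _] := nbr.
exists (refl b'), (refl a'); split=> //; last exact: progress_refl pr.
- by move: h2; rewrite (rstate_le r3 (sub3 _ as_) i1) /rx /ry /= => h; rewrite lerNr.
- by move: h1; rewrite (rstate_le r3 i2 (sub3 _ bs)) /rx /ry /= => h; rewrite lerNl.
Qed.

(* One of the two neighbours of the cut never changes. *)
Lemma run_escape lft N a b : (forall i, sep_cut lft (S i)) ->
  nbrs lft (S (3 * N)) a b ->
  (forall i, (3 * N <= i)%N -> not_hit lft (S i) a b) ->
  (exists i e, [/\ e \in S i, lft e & rx a < rx e]) ->
  (exists i e, [/\ e \in S i, ~ lft e & rx e < rx b]) -> False.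
Proof.
move=> sc nb nh [i [e [es le ae]]] [j [e' [e's le' e'b]]].
have mr m : macro_result lft a b (S (3 * (m + N))).
  elim: m => [|m [a' [b' [nb' h1 h2 pr]]]].
    by exists a, b; split=> //; constructor 1.
  have [|a2 [b2 [nb2 h3 h4 pr2]]] := run_macro (sc _) _ nb'.
    have nhm : not_hit lft (S (3 * (m + N).+1)) a b.
      by apply: nh; rewrite leq_mul2l -addSn leq_addl.
    move=> d d' ds d's ld ld' ad d'b; apply: nhm => //; first exact: le_trans ad.
    exact: le_trans h2.
  rewrite addSn; exists a2, b2; split=> //; [exact: le_trans h3|exact: le_trans h2|].
  exact: progress_trans pr pr2.
have [a' [b' [[_ _ _ amax bmin] _ _ pr]]] := mr (maxn i j).
have up n d : (n <= maxn i j)%N -> d \in S n -> d \in S (3 * (maxn i j + N)).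
  move=> nm; apply: run_sub; apply: leq_trans nm _.
  by rewrite (leq_trans (leq_addr N _))// leq_pmull.
have ha := amax _ (up _ _ (leq_maxl _ _) es) le.
have hb := bmin _ (up _ _ (leq_maxr _ _) e's) le'.
by case: pr => [[ea eb]|[ea _ _]|[eb _ _]];
  [move: ha; rewrite ea leNgt ae|move: ha; rewrite ea leNgt ae|
   move: hb; rewrite eb leNgt e'b].
Qed.

Lemma nbrs_ex lft (s : seq rpt) : (exists2 e, e \in s & lft e) ->
  (exists2 e, e \in s & ~ lft e) -> exists a b, nbrs lft s a b.
Proof.
move=> [e es le] [e' e's le'].
have [h|[_ /mapP[a + ->] amax]] := seq_max [seq rx d | d <- s & `[< lft d >]].
  suff : rx e \in [seq rx d | d <- s & `[< lft d >]] by rewrite h.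
  by apply: map_f; rewrite mem_filter es andbT; apply/asboolP.
rewrite mem_filter => /andP[/asboolP la as_].
have [h|[_ /mapP[b + ->] bmin]] := seq_min [seq rx d | d <- s & `[< ~ lft d >]].
  suff : rx e' \in [seq rx d | d <- s & `[< ~ lft d >]] by rewrite h.
  by apply: map_f; rewrite mem_filter e's andbT; apply/asboolP.
rewrite mem_filter => /andP[/asboolP lb bs].
exists a, b; split=> // d ds ld.
  by apply: amax; apply: map_f; rewrite mem_filter ds andbT; apply/asboolP.
by apply: bmin; apply: map_f; rewrite mem_filter ds andbT; apply/asboolP.
Qed.

Variables (k psi : autQ) (N : nat).
Hypothesis kS : forall i e, e \in S i -> k (rx e) = ry e.
Hypothesis nohit : forall i g, (N <= i)%N -> o i = Some g -> ~ hit psi g (l i).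

Local Notation f' := (psi^-1 * k)%g.

(** Without hits from stage [N] on, a later point on or above the graph of [psi] has its alternative
    on or above it too. *)
Let new_alt i e : e \in S i -> e \notin S N ->
  [/\ rx e <= alt_x e, alt_y e <= ry e, rx e < alt_x e \/ alt_y e < ry e &
      psi (rx e) <= ry e -> psi (alt_x e) <= alt_y e].
Proof.
move=> es eN; have [h|[j [g [Nj oj ->]]]] := run_new N es; first by rewrite h in eN.
have := Sst j; rewrite oj => /stage_stair_ok /(_ (l j))[h1 h2 h3].
split=> // h; rewrite leNgt; apply/negP => h'; exact: nohit Nj oj (conj h h').
Qed.

(** At a fixed point [k] and [psi] agree. A later graph point on the graph of [psi] would have its
    alternative on or above that graph, but the alternative is lower or further right. So fixed
    points come from the finitely many early points. *)
Lemma run_fix_finite : finite_set (fixed_points f').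
Proof.
apply/finite_seqP; suff sub : fixed_points f' `<=` [set` map rx (S N)].
  by have /finite_seqP : finite_set (fixed_points f') by apply: sub_finite_set sub _.
move=> x fx; have psix : psi x = k x by apply/autQ_eqV; exact: fx.
have [i [e [es ex_]]] := run_dom x.
have [eN|eN] := boolP (e \in S N); first by rewrite -ex_; exact: map_f.
have [h1 h2 h3 h4] := new_alt es eN.
have pe : psi (rx e) = ry e by rewrite ex_ psix -ex_ (kS es).
have := h4 (_ : psi (rx e) <= ry e); rewrite pe => /(_ (lexx _)) h5.
have h6 : ry e <= psi (alt_x e) by rewrite -pe autQ_le_mono.
case: h3 => h3.
  have : ry e < psi (alt_x e) by rewrite -pe autQ_lt_mono.
  by move=> /lt_le_trans /(_ h5) /lt_le_trans /(_ h2); rewrite ltxx.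
by move: (le_lt_trans h6 (le_lt_trans h5 h3)); rewrite ltxx.
Qed.

Lemma run_no_touch p1 p2 : p1 < p2 -> ~ same_orbital f' p1 p2 ->
  (forall r, p1 <= r <= p2 -> r < f' r) -> False.
Proof.
move=> p12 nso up.
have up1 : p1 < f' p1 by apply: up; rewrite lexx ltW.
(* The cut at the supremum of the orbital of [p1]; it is invariant under [f']. *)
pose L r := exists2 q, same_orbital f' p1 q & r < q.
have Ldown r r' : r' <= r -> L r -> L r'.
  by move=> h [q pq rq]; exists q => //; exact: le_lt_trans rq.
have Lp1 : L p1 by exists (f' p1) => //; exact: same_orbital_step.
have Lp2 : ~ L p2.
  move=> [q pq p2q]; apply: nso; apply: (same_orbital_convex pq).
  by rewrite !ltW.
have Lf r : L r -> L (f' r).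
  move=> [q pq rq]; exists (f' q); last by rewrite autQ_lt_mono.
  exact/(same_orbital_trans pq)/same_orbital_step.
have Lmax r : L r -> exists2 r', L r' & r < r'.
  move=> [q pq rq]; exists q => //; exists (f' q); last exact: same_orbital_gt up1 pq.
  exact/(same_orbital_trans pq)/same_orbital_step.
have Lsep r r' : L r -> ~ L r' -> r < r'.
  by move=> h h'; rewrite ltNge; apply/negP => /Ldown /(_ h).
(* Below [p2] the inverse of [f'] moves points down, and it cannot enter [L], since [f'] preserves
   [L]. *)
have Lmin r : ~ L r -> exists2 r', ~ L r' & r' < r.
  move=> nr; have [rp2|p2r] := leP r p2; last by exists p2.
  exists ((f'^-1)%g r); first by move=> /Lf; rewrite autQVK.
  by rewrite autQ_ltV up// rp2 andbT ltW//; exact: Lsep.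
pose lft e := L (rx e).
have sc i : sep_cut lft (S i) by move=> e e' _ _; exact: Lsep.
(* a new left neighbour above [p1], a new right neighbour below [p2] *)
have [r1 Lr1 r1P] : exists2 r, L r & p1 < r /\ forall e, e \in S N -> lft e -> rx e < r.
  have [//|[m + mP]] := seq_max (p1 :: [seq rx e | e <- S N & `[< lft e >]]).
  move=> ml; have [|r Lr mr] := Lmax m.
    move: ml; rewrite inE => /predU1P[->//|/mapP[e + ->]].
    by rewrite mem_filter => /andP[/asboolP].
  exists r => //; split.
    by apply: le_lt_trans mr; apply: mP; rewrite inE eqxx.
  move=> e eN le; apply: le_lt_trans mr; apply: mP; rewrite inE; apply/orP; right.
  by apply: map_f; rewrite mem_filter eN andbT; apply/asboolP.
have [r2 Lr2 r2P] : exists2 r, ~ L r & r < p2 /\ forall e, e \in S N -> ~ lft e -> r < rx e.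
  have [//|[m + mP]] := seq_min (p2 :: [seq rx e | e <- S N & `[< ~ lft e >]]).
  move=> ml; have [|r Lr mr] := Lmin m.
    move: ml; rewrite inE => /predU1P[->//|/mapP[e + ->]].
    by rewrite mem_filter => /andP[/asboolP].
  exists r => //; split.
    by apply: lt_le_trans mr _; apply: mP; rewrite inE eqxx.
  move=> e eN le; apply: lt_le_trans mr _; apply: mP; rewrite inE; apply/orP; right.
  by apply: map_f; rewrite mem_filter eN andbT; apply/asboolP.
have [i1 [e1 [e1s e1r]]] := run_dom r1; have [i2 [e2 [e2s e2r]]] := run_dom r2.
pose M := maxn i1 i2.
have upM n d : (n <= M)%N -> d \in S n -> d \in S (3 * M).
  by move=> nm; apply: run_sub; apply: leq_trans nm _; rewrite leq_pmull.
have e1M := upM _ _ (leq_maxl _ _) e1s; have e2M := upM _ _ (leq_maxr _ _) e2s.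
have [||a [b nb]] := @nbrs_ex lft (S (3 * M)).
- by exists e1 => //; rewrite /lft e1r.
- by exists e2 => //; rewrite /lft e2r.
have [[as_ bs] la lb amax bmin] := nb.
have ra : r1 <= rx a by rewrite -e1r; apply: amax => //; rewrite /lft e1r.
have rb : rx b <= r2 by rewrite -e2r; apply: bmin => //; rewrite /lft e2r.
apply: (run_escape sc nb).
(* Both points are later than stage [N] and lie on or above the graph of [psi], hence so do their
   alternatives. Moreover [f' (rx e)] is still below the cut, hence below [rx e']; applying [psi]
   bounds [ry e] by [alt_y e'], and [alt_x e] is at most [f' (rx e)]. *)
- move=> i _ e e' es e's le le' ae e'b.
  have ee' := Lsep _ _ le le'.
  have eN : e \notin S N.
    apply/negP => eN; move: (r1P.2 _ eN le).
    by rewrite ltNge (le_trans ra ae).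
  have e'N : e' \notin S N.
    apply/negP => eN'; move: (r2P.2 _ eN' le').
    by rewrite ltNge (le_trans e'b rb).
  have pe : p1 < rx e by apply: lt_le_trans r1P.1 (le_trans ra ae).
  have e'p : rx e' < p2 by apply: le_lt_trans (le_trans e'b rb) r2P.1.
  have low d : d \in S i -> p1 < rx d -> rx d < p2 -> psi (rx d) <= ry d.
    move=> ds pd dp; have : rx d < f' (rx d) by apply: up; rewrite (ltW pd) (ltW dp).
    by rewrite autQM autQ_gtV (kS ds); exact: ltW.
  have [g1 g2 _ /(_ (low _ es pe (lt_trans ee' e'p))) g4] := new_alt es eN.
  have [h1 h2 _ /(_ (low _ e's (lt_trans pe ee') e'p)) h4] := new_alt e's e'N.
  have fe : f' (rx e) < rx e' by apply: Lsep => //; exact: Lf.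
  split.
    move: fe; rewrite autQM autQ_ltV (kS es) => /lt_le_trans; apply.
    by apply: le_trans h4; rewrite autQ_le_mono.
  apply: le_lt_trans fe; rewrite autQM autQ_geV (kS es).
  exact: le_trans g4 g2.
- have [r Lr ar] := Lmax _ la; have [i [e [es er]]] := run_dom r.
  by exists i, e; split=> //; rewrite /lft er.
- have [r Lr ar] := Lmin _ lb; have [i [e [es er]]] := run_dom r.
  by exists i, e; split=> //; rewrite /lft er.
Qed.

End Run.

(** The filter generated by agreement with [k] on finite lists converges to [k], so it contains
    every neighbourhood of [k]. *)
Lemma nbhs_agree (k : autQ) (U : set autQ) : nbhs k U ->
  exists ps : seq rat, [set g : autQ | forall p, p \in ps -> g p = k p] `<=` U.
Proof.
pose F : set_system autQ := [set A | exists ps : seq rat,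
  [set g : autQ | forall p, p \in ps -> g p = k p] `<=` A].
have FF : Filter F.
  split.
  - by exists [::].
  - move=> A B [ps h] [qs h']; exists (ps ++ qs) => g gP; split.
      by apply: h => p pp; apply: gP; rewrite mem_cat pp.
    by apply: h' => p pp; apply: gP; rewrite mem_cat pp orbT.
  - by move=> A B AB [ps h]; exists ps; exact: subset_trans AB.
have Fk : F --> k.
  apply/cvg_autQP => q; exists [:: q] => g /= gP.
  by apply: gP; rewrite inE.
exact: Fk.
Qed.

Definition cylinder (w : seq (rat * rat)) : set autQ :=
  [set g | forall pv, pv \in w -> g pv.1 = pv.2].

Lemma open_cylinders (U : set autQ) : open U ->
  U = \bigcup_(w in [set w | cylinder w `<=` U]) cylinder w.
Proof.
move=> oU; apply/seteqP; split=> [k Uk|k [w wU wk]]; last exact: wU.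
have [ps psU] := nbhs_agree (open_nbhs_nbhs (conj oU Uk)).
exists [seq (p, k p) | p <- ps].
  move=> g gP; apply: psU => p pps; apply: (gP (p, k p)).
  by apply/mapP; exists p.
by move=> _ /mapP[p pps ->].
Qed.

(** * The tree of runs, parametrized by the unit interval *)

Section Tree.

Lemma stages : exists O : nat -> seq rpt -> option stair,
  forall i s, rstate s -> stage i s (O i s).
Proof.
have : forall is_ : nat * seq rpt, exists g, rstate is_.2 -> stage is_.1 is_.2 g.
  move=> [i s]; have [st|nst] := pselect (rstate s); last by exists None.
  by have [g h] := stage_ex i st; exists g.
by move=> /choice[nx nxP]; exists (fun i s => nx (i, s)) => i s; exact: (nxP (i, s)).
Qed.

(** The staircase depends on the stage and the state alone, so the state at depth [i] takes
    countably many values and measurability reduces to cells. *)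
Definition next_stage := projT1 (cid stages).
Definition next_stageP := projT2 (cid stages).

(** Exponent [i.+2] makes a hit at stage [i] have probability at most 1 over [2 ^ i.+1], which is
    summable; the spare factor 2 absorbs the right end point of the unit interval. *)
Definition branching (i : nat) := (2 ^ i.+2)%N.

Fixpoint cells (i : nat) := if i is j.+1 then (cells j * branching j)%N else 1%N.

(** [n] is read in mixed radix: its last digit is the choice at stage [j], the quotient codes the
    earlier choices. *)
Fixpoint tree (i n : nat) : seq rpt :=
  if i is j.+1 then let s := tree j (n %/ branching j) in
    ins s (next_stage j s) (n %% branching j)
  else [::].

Lemma branching_gt0 i : (0 < branching i)%N.
Proof. by rewrite expn_gt0. Qed.

Lemma cells_gt0 i : (0 < cells i)%N.
Proof. by elim: i => //= i IH; rewrite muln_gt0 IH branching_gt0. Qed.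

End Tree.

Section RandomAutomorphism.
Variable R : realType.
Implicit Types t : R.

Definition cell i t : nat := Num.truncn (t * (cells i)%:R).

Lemma cellS i t : (cell i.+1 t %/ branching i)%N = cell i t.
Proof.
have b0 := branching_gt0 i.
(* [kappa] is defined on the whole line; a negative [t] is truncated to cell 0 at every depth. *)
have [t0|t0] := ltP (t * (cells i)%:R) 0.
  rewrite /cell [in RHS](_ : Num.truncn _ = 0%N); last first.
    by apply/truncn0Pn; rewrite -ltNge (lt_trans t0).
  rewrite (_ : Num.truncn _ = 0%N) ?div0n//.
  apply/truncn0Pn; rewrite -ltNge /= natrM mulrA (@lt_trans _ _ 0)//.
  by rewrite pmulr_llt0// ltr0n.
apply/esym/truncn_def; set q := (_ %/ _)%N.
have b0' : 0 < (branching i)%:R :> R by rewrite ltr0n.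
have h0 : 0 <= t * (cells i.+1)%:R.
  by rewrite /= natrM mulrA mulr_ge0// ltW.
have /andP[h1 h2] := truncn_itv h0.
rewrite -(ler_pM2r b0') -(ltr_pM2r b0') -!mulrA -!natrM.
apply/andP; split.
  by apply: le_trans h1; rewrite ler_nat; exact: leq_divM.
apply: lt_le_trans h2 _; rewrite ler_nat /q; exact: ltn_ceil.
Qed.

Definition digit i t := (cell i.+1 t %% branching i)%N.
Definition path_state t i := tree i (cell i t).
Definition path_stair t i := next_stage i (path_state t i).

Lemma path_stateS t i :
  path_state t i.+1 = ins (path_state t i) (path_stair t i) (digit i t).
Proof. by rewrite /path_state /= cellS. Qed.

Lemma path_state_rstate t i : rstate (path_state t i).
Proof.
elim: i => [//|i IH]; rewrite path_stateS.
by apply: stage_rstate => //; exact: next_stageP.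
Qed.

Lemma path_stage t i : stage i (path_state t i) (path_stair t i).
Proof. by apply: next_stageP; exact: path_state_rstate. Qed.

Lemma random_ex : exists kappa : R -> autQ, forall t i e,
  e \in path_state t i -> kappa t (rx e) = ry e.
Proof.
have h t : exists k : autQ, forall i e, e \in path_state t i -> k (rx e) = ry e.
  exact: (run_graph (S := path_state t) erefl (path_stateS t) (path_stage t)).
by have [kappa kP] := choice h; exists kappa.
Qed.

Definition kappa := projT1 (cid random_ex).
Definition kappaP := projT2 (cid random_ex).

Local Notation T := (g_sigma_algebraType (@open autQ)).
Local Notation mR := (measurableTypeR R).

Lemma measurable_cell i (A : set nat) : measurable (cell i @^-1` A : set mR).
Proof.
have gt n : measurable [set t : mR | (n < cell i t)%N].
  rewrite (_ : [set _ | _] = [set` `[(n.+1)%:R / (cells i)%:R, +oo[]).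
    exact: measurable_itv.
  apply/seteqP; split=> t /=; rewrite truncn_gt_nat in_itv /= andbT;
    by rewrite ler_pdivrMr// ltr0n cells_gt0.
have eq n : measurable [set t : mR | cell i t = n].
  rewrite (_ : [set _ | _] = ~` [set t | (n < cell i t)%N] `&`
      (if n is m.+1 then [set t | (m < cell i t)%N] else setT)).
    by apply: measurableI; [exact: measurableC|case: n].
  apply/seteqP; split=> t /=; first by move=> cn; rewrite cn ltnn; split=> //; case: n cn => //= m ->.
  move=> [/negP]; rewrite -leqNgt => h1 h2; apply/eqP; rewrite eqn_leq h1.
  by case: n h1 h2.
rewrite (_ : _ @^-1` _ = \bigcup_(n in A) [set t | cell i t = n]).
  by apply: bigcup_measurable => n _; exact: eq.
apply/seteqP; split=> [t At|t [n An /= cn]]; first by exists (cell i t).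
by rewrite /preimage /= cn.
Qed.

Lemma measurable_kappa_eval (p v : rat) : measurable [set t : mR | kappa t p = v].
Proof.
rewrite (_ : [set _ | _] = \bigcup_i (cell i @^-1`
    [set n | exists2 e, e \in tree i n & rx e = p /\ ry e = v])).
  by apply: bigcupT_measurable => i; exact: measurable_cell.
apply/seteqP; split=> [t kt|t [i _ [e es [<- <-]]]]; last exact: kappaP es.
have [i [e [es ep]]] := run_dom (path_stateS t) (path_stage t) p.
by exists i => //; exists e => //; split=> //; rewrite -(kappaP es) ep.
Qed.

(** Every open set is a union of cylinders, and there are only countably many, so evaluations at
    rationals suffice. *)
Lemma measurable_kappa : measurable_fun setT (kappa : mR -> T).
Proof.
apply: (@measurability _ _ mR T setT (kappa : mR -> T) (@open autQ)) => // _ [U oU <-].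
rewrite setTI.
rewrite (open_cylinders oU) preimage_bigcup bigcup_mkcond.
apply: countable_bigcupT_measurable; first exact: countableP.
move=> w; case: ifP => // _; elim: w => [|[p v] w IH].
  by rewrite (_ : _ @^-1` _ = setT)//; apply/seteqP; split.
rewrite (_ : _ @^-1` _ = [set t | kappa t p = v] `&` kappa @^-1` cylinder w).
  by apply: measurableI => //; exact: measurable_kappa_eval.
apply/seteqP; split=> [t h|t [h1 h2] pv].
  split; first by apply: (h (p, v)); rewrite inE eqxx.
  by move=> pv pw; apply: h; rewrite inE pw orbT.
by rewrite inE => /predU1P[->//|/h2].
Qed.

Definition P01 : probability mR R := uniform_prob (ltr01 : 0 < 1 :> R).

Lemma P01E (A : set mR) : measurable A -> P01 A = lebesgue_measure (A `&` `[0, 1]).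
Proof.
move=> mA; rewrite /P01 /= /uniform_prob integral_uniform_pdf.
rewrite (eq_integral (cst 1%:E)); last first.
  move=> x; rewrite inE => -[_ /=]; rewrite in_itv /= /uniform_pdf => ->.
  by rewrite subr0 invr1.
by rewrite integral_cst ?mul1e//; apply: measurableI.
Qed.

Definition hits (psi : autQ) i : set mR := cell i.+1 @^-1` [set n |
  exists2 g, next_stage i (tree i (n %/ branching i)) = Some g &
    hit psi g (n %% branching i)].

(** Given the earlier choices, at most one digit hits, so the hits within each parent cell fill at
    most one child cell. Counting these intervals replaces independence of the digits. *)
Lemma P01_hits psi i : (P01 (hits psi i) <= (1 / (2 ^ i.+1)%:R)%:E)%E.
Proof.
have mh : measurable (hits psi i) by exact: measurable_cell.
rewrite P01E//.
have [r rP] : exists r : nat -> nat, forall q g l,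
    next_stage i (tree i q) = Some g -> stair_ok g -> hit psi g l -> l = r q.
  have : forall q, exists r : nat, forall g l,
      next_stage i (tree i q) = Some g -> stair_ok g -> hit psi g l -> l = r.
    move=> q; have [[g [l [h1 h2 h3]]]|nh] := pselect (exists g l,
        [/\ next_stage i (tree i q) = Some g, stair_ok g & hit psi g l]).
      exists l => g' l'; rewrite h1 => -[<-] _ h'; exact: hit_uniq h2 h' h3.
    by exists 0%N => g l h1 h2 h3; exfalso; apply: nh; exists g, l.
  by move=> /choice[r rP]; exists r => q g l; exact: rP.
pose c := (cells i.+1)%:R : R.
have c0 : 0 < c by rewrite ltr0n cells_gt0.
pose n q := (q * branching i + r q)%N.
pose I q : set mR := [set` `[(n q)%:R / c, (n q).+1%:R / c[].
have mI q : measurable (I q) by exact: measurable_itv.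
have Iq q : lebesgue_measure (I q) = (c^-1)%:E.
  rewrite /I lebesgue_measure_itv /= lte_fin ltr_pM2r ?invr_gt0// ltr_nat ltnSn.
  by rewrite -EFinB -mulrBl -natrB// subSnn mul1r.
(* The upper limit [(cells i).+1] is due to [t = 1], whose cell number is [cells i]. *)
have sub : hits psi i `&` `[0, 1] `<=` \big[setU/set0]_(q < (cells i).+1) I q.
  move=> t [/= [g gE gh]]; rewrite in_itv /= => /andP[t0 t1].
  rewrite -bigcup_mkord; exists (cell i t).
    rewrite /= ltnS /cell.
    have : t * (cells i)%:R <= (cells i)%:R by rewrite ler_piMl.
    by move=> /le_truncn; rewrite natrK.
  have gok : stair_ok g.
    move: gE; rewrite cellS => gE; have := path_stage t i.
    by rewrite /path_stair /path_state gE => /stage_stair_ok.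
  have e := rP _ _ _ gE gok gh; rewrite cellS in e.
  have tc : 0 <= t * c by rewrite mulr_ge0// ltW.
  have -> : I (cell i t) = [set` `[(cell i.+1 t)%:R / c, (cell i.+1 t).+1%:R / c[].
    by rewrite /I (_ : n (cell i t) = cell i.+1 t)// /n -e -(cellS i t) -divn_eq.
  rewrite /= in_itv /= ler_pdivrMr// ltr_pdivlMr//.
  exact: truncn_itv.
have mA : measurable (hits psi i `&` `[0, 1] : set mR) by apply: measurableI.
apply: (le_trans (content_subadditive lebesgue_measure (fun k _ => mI k) mA sub)).
rewrite (eq_bigr (fun=> (c^-1)%:E))//; last by move=> q _; exact: Iq.
rewrite sumEFin sumr_const card_ord lee_fin -[_ *+ _]mulr_natl.
(* Holds because [(cells i).+1] is at most twice [cells i], while [branching i] is twice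
   [2 ^ i.+1]. *)
have key : ((cells i).+1 * 2 ^ i.+1 <= cells i.+1)%N.
  rewrite /= /branching (expnS 2 i.+1) mulnA leq_mul2r; apply/orP; right.
  by rewrite muln2 -addnn -addn1 leq_add2l cells_gt0.
rewrite ler_pdivrMr// mulrAC ler_pdivlMr ?ltr0n ?expn_gt0// mul1r -natrM.
by rewrite ler_nat.
Qed.

Lemma P01_hits_limsup psi : P01 (lim_sup_set (hits psi)) = 0%E.
Proof.
apply: lim_sup_set_cvg0; first by move=> i; exact: measurable_cell.
apply: (@le_lt_trans _ _ 1%:E); last by rewrite ltry.
have h01 : 0 <= (1 : R) by [].
apply: (le_trans _ (epsilon_trick0 xpredT h01)).
by apply: lee_nneseries => // i _; exact: P01_hits.
Qed.

Lemma not_limsup_hits psi t : ~ lim_sup_set (hits psi) t -> exists N,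
  forall i g, (N <= i)%N -> path_stair t i = Some g -> ~ hit psi g (digit i t).
Proof.
move=> nls; apply: contrapT => h; apply: nls => N _; apply: contrapT => nN.
apply: h; exists N => i g Ni gE gh; apply: nN; exists i => //=.
by exists g => //; rewrite cellS.
Qed.

End RandomAutomorphism.

(** * Haar null classes *)

(* The supremum of the orbit of [p1] is then an invariant cut near which [g]
   moves all points up. *)
Definition touching (g : autQ) := exists p1 p2 : rat, [/\ p1 < p2,
  forall n, iter n g p1 < p2 & forall r, p1 <= r <= p2 -> r < g r].

Definition bad (g : autQ) := ~ finite_set (fixed_points g) \/ touching g.

Lemma zexpg_nat (g : autQ) n p : zexpg g n%:Z p = iter n g p.
Proof. by elim: n => //= n IH; rewrite -IH /= expgS. Qed.

(** Forward iterates describe leaving the orbital by countably many conditions, each on finitely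
    many values, which makes [touching] Borel. *)
Lemma touchingP (g : autQ) p1 p2 : p1 < p2 -> p1 < g p1 ->
  (forall n, iter n g p1 < p2) <-> ~ same_orbital g p1 p2.
Proof.
move=> p12 gp; split=> [h [i [j /andP[_ p2j]]]|h n].
  move: p2j; apply/negP; rewrite -ltNge; case: j => j; first by rewrite zexpg_nat.
  apply: le_lt_trans p12; apply: (zexpg_mono_ge (ltW gp) (m := 0)); lia.
rewrite ltNge; apply/negP => p2n; apply: h; exists 0, n%:Z.
by rewrite zexpg_nat p2n andbT ltW.
Qed.

Lemma fixed_points_conj (h z : autQ) :
  fixed_points (h^-1 * z * h)%g = (h^-1)%g @` fixed_points z.
Proof.
apply/seteqP; split=> [x fx|_ [x fx <-]].
  exists (h x); last exact: autQK.
  by have := congr1 h (fx : (h^-1)%g (z (h x)) = x); rewrite autQVK.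
by rewrite /fixed_points /mkset !autQM autQVK fx.
Qed.

Lemma bad_conj (h z : autQ) : bad z -> bad (h^-1 * z * h)%g.
Proof.
move=> [nf|[p1 [p2 [p12 it up]]]]; [left|right].
  rewrite fixed_points_conj => f; apply: nf.
  rewrite (_ : fixed_points z = h @` ((h^-1)%g @` fixed_points z)).
    exact: finite_image.
  apply/seteqP; split=> [x fx|_ [_ [x fx <-] <-]].
    by exists ((h^-1)%g x); [exists x|exact: autQVK].
  by rewrite autQVK.
exists ((h^-1)%g p1), ((h^-1)%g p2); split.
- by rewrite autQ_lt_mono.
- move=> n; suff -> : iter n (h^-1 * z * h)%g ((h^-1)%g p1) = (h^-1)%g (iter n z p1).
    by rewrite autQ_lt_mono.
  by elim: n => //= n ->; rewrite autQVK.
- move=> r; rewrite autQ_leV autQ_geV => hr.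
  by rewrite !autQM autQ_gtV; exact: up.
Qed.

(** Both products are conjugate. This brings [g * kappa * h] to [h * g * kappa], so a single
    comparison map, the inverse of [h * g], covers two-sided translates. *)
Lemma bad_mulC (x y : autQ) : bad (x * y)%g -> bad (y * x)%g.
Proof. by move=> /(bad_conj x); rewrite mulgA mulVg mul1g. Qed.

Lemma infinite_fixE (g : autQ) : ~ finite_set (fixed_points g) <->
  forall n, exists x : rat, (n <= pickle x)%N /\ g x = x.
Proof.
split=> [nf n|h /finite_seqP[ps psE]].
  apply: contrapT => h; apply: nf.
  apply: (@sub_finite_set _ _ [set` pmap unpickle (iota 0 n)]) => // x fx /=.
  rewrite mem_pmap -(pickleK x) map_f// mem_iota /= add0n ltnNge.
  by apply/negP => nx; apply: h; exists x.
have [x [xn gx]] := h (\max_(p <- ps) pickle p).+1.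
have : x \in ps by have : fixed_points g x by []; rewrite psE.
move=> xps; suff : (pickle x <= \max_(p <- ps) pickle p)%N by rewrite leqNgt xn.
exact: leq_bigmax_seq.
Qed.

(** Infinitely many fixed points means one of code at least [n] for every [n], a countable
    intersection of open sets; the touching condition combines evaluations over rational
    parameters. *)
Lemma borel_bad : borel bad.
Proof.
have op U : open U -> measurable (U : set (g_sigma_algebraType (@open autQ))).
  exact: open_measurable_autQ.
rewrite (_ : bad = (\bigcap_n [set g : autQ | exists x : rat, (n <= pickle x)%N /\ g x = x])
    `|` \bigcup_(p1 : rat) \bigcup_(p2 : rat) ((if p1 < p2 then setT else set0) `&`
      ((\bigcap_n [set g : autQ | iter n g p1 < p2]) `&`
       ~` \bigcup_(r : rat) ((if p1 <= r <= p2 then setT else set0) `&`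
          [set g : autQ | ~ (r < g r)])))).
  apply: (@measurableU _ (g_sigma_algebraType (@open autQ))).
    apply: bigcapT_measurable => n; apply: op; rewrite openE => g [x [nx gx]].
    by apply: filterS (autQ_near g x) => h /= hx; exists x; rewrite hx.
  apply: bigcupT_measurable_rat => p1; apply: bigcupT_measurable_rat => p2.
  apply: measurableI; first by case: ifP.
  apply: measurableI.
    apply: bigcapT_measurable => n; apply: op; rewrite openE => g gn.
    apply: filterS (near_agree g [seq iter m g p1 | m <- iota 0 n]) => h hg.
    suff e m : (m <= n)%N -> iter m h p1 = iter m g p1 by rewrite /= e.
    elim: m => //= m IH mn; rewrite IH ?(ltnW mn)// hg//.
    by apply: map_f; rewrite mem_iota.
  apply: measurableC; apply: bigcupT_measurable_rat => r.
  apply: measurableI; first by case: ifP.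
  apply: op; exact: (open_eval r [set v | ~ (r < v)]).
apply/seteqP; split=> g.
  move=> [/infinite_fixE h|[p1 [p2 [p12 it up]]]]; first by left=> n _; exact: h.
  right; exists p1 => //; exists p2 => //; rewrite p12; split=> //; split.
    by move=> n _; exact: it.
  by move=> [r _]; case: ifP => [/up h [_ /=]|_ []].
move=> [h|[p1 _ [p2 _]]]; first by left; apply/infinite_fixE => n; exact: (h n).
case: ifP => [p12|_ []//] [_ [it up]]; right; exists p1, p2; split=> //.
  by move=> n; exact: (it n).
by move=> r pr; apply: contrapT => nr; apply: up; exists r => //; rewrite pr.
Qed.

Section HaarNullBad.
Variable R : realType.
Local Notation T := (g_sigma_algebraType (@open autQ)).
Local Notation mR := (measurableTypeR R).
Local Notation kappa := (@kappa R).

Lemma kappa_not_bad (psi : autQ) (t : R) : ~ lim_sup_set (hits psi) t ->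
  ~ bad (psi^-1 * kappa t)%g.
Proof.
move=> /not_limsup_hits[N nohit].
have kP i e : e \in path_state t i -> kappa t (rx e) = ry e by exact: kappaP.
move=> [|[p1 [p2 [p12 it up]]]].
  apply; exact: (run_fix_finite erefl (path_stateS t) (path_stage t) kP nohit).
have gp : p1 < (psi^-1 * kappa t)%g p1 by apply: up; rewrite lexx ltW.
move/(touchingP p12 gp) : it => nso.
exact: (run_no_touch erefl (path_stateS t) (path_stage t) kP nohit p12 nso up).
Qed.

Lemma measurable_kappa_bad (g h : autQ) :
  measurable ([set t | bad (g * kappa t * h)%g] : set mR).
Proof.
have := measurable_kappa (R := R) measurableT (borel_translate (g^-1)%g (h^-1)%g borel_bad).
by rewrite setTI translateE !invgK.
Qed.

Lemma P01_kappa_bad (g h : autQ) : P01 R [set t | bad (g * kappa t * h)%g] = 0%E.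
Proof.
pose psi := ((h * g)^-1)%g.
apply/eqP; rewrite eq_le measure_ge0 andbT -(P01_hits_limsup R psi).
apply: le_measure; rewrite ?inE.
- exact: measurable_kappa_bad.
- apply: bigcapT_measurable => n; apply: bigcup_measurable => i _.
  exact: measurable_cell.
move=> t /bad_mulC; rewrite !mulgA => b; apply: contrapT => /kappa_not_bad; apply.
by rewrite /psi invgK.
Qed.

Lemma distributionE (X : mR -> T) : measurable_fun setT X ->
  exists mu : probability T R, forall A, mu A = P01 R (X @^-1` A).
Proof. by move=> mX; exists (distribution (P01 R) (mfun_Sub (mem_set mX))). Qed.

Lemma haar_null_bad : borel_haar_null R bad.
Proof.
split; first exact: borel_bad.
have [mu muE] := distributionE (measurable_kappa (R := R)).
by exists mu => g h; rewrite muE translateE; exact: P01_kappa_bad.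
Qed.

Lemma continuous_inv_borel (B : set autQ) : borel B -> borel [set x | B (x^-1)%g].
Proof. by move=> bB; exact: (borel_preimage autQ_inv_continuous bB). Qed.

(** The distribution of the inverse of [kappa] is used: inverting turns its translate by [g], [h]
    into a translate of [kappa] with the two factors exchanged. *)
Lemma haar_null_badV : borel_haar_null R [set x | bad (x^-1)%g].
Proof.
split; first exact: continuous_inv_borel borel_bad.
have [|mu muE] := @distributionE (fun t => (kappa t)^-1)%g.
  move=> _ B bB; rewrite setTI.
  have := measurable_kappa (R := R) measurableT (continuous_inv_borel bB).
  by rewrite setTI.
exists mu => g h; rewrite muE translateE -(P01_kappa_bad h g).
congr (P01 R _); apply/seteqP; split=> t /=;
  by rewrite !invgM !invgK mulgA.
Qed.

Lemma haar_null_class f :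
  ~ (finite_set (fixed_points f) /\ sign_alternating f) ->
  haar_null R (conjugacy_class f).
Proof.
have classP (B : set autQ) : borel_haar_null R B ->
    (forall h, B (h^-1 * f * h)%g) -> haar_null R (conjugacy_class f).
  by move=> nB BP; exists B; split=> // _ [h _ <-]; rewrite /conjg mulgA.
move=> /not_andP[nf|nalt].
  by apply: (classP bad haar_null_bad) => h; apply: bad_conj; left.
(* Failure of alternation leaves a whole segment of constant nonzero sign whose ends lie in
   different orbitals. Sign 1 makes [f] touching, sign -1 makes the inverse of [f] touching. *)
have [p [q [pq npq [spq sp0] mid]]] : exists p q, [/\ p < q, ~ same_orbital f p q,
    sg_at f p = sg_at f q /\ sg_at f p != 0 &
    forall r, p <= r <= q -> sg_at f r = sg_at f p].
  apply: contrapT => h; apply: nalt => p q pq npq spq sp0.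
  apply: contrapT => nr; apply: h; exists p, q; split=> // r /andP[].
  rewrite le_eqVlt => /predU1P[<-//|pr]; rewrite le_eqVlt => /predU1P[->//|rq].
  apply/eqP; apply: contrapT => /negP rp; apply: nr; exists r; split=> //.
have [e|e] : sg_at f p = 1 \/ sg_at f p = -1.
  by move: sp0; case: (sg_at_ltP f p) => -[-> _]; [left|right|].
- apply: (classP bad haar_null_bad) => h; apply: bad_conj; right; exists p, q.
  have up r : p <= r <= q -> r < f r by move=> /mid; rewrite e -sg_at1 => ->.
  by split=> //; apply/touchingP => //; apply: up; rewrite lexx ltW.
- apply: (classP _ haar_null_badV) => h.
  rewrite /mkset !invgM invgK mulgA; apply: bad_conj; right; exists p, q.
  have up r : p <= r <= q -> r < (f^-1)%g r.
    by move=> /mid; rewrite e autQ_gtV -sg_atN1 => ->.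
  split=> //; apply/touchingP => //; first by apply: up; rewrite lexx ltW.
  by move=> /same_orbitalV.
Qed.

End HaarNullBad.

Theorem theorem3p4 (R : realType) (f : autQ) :
  (~ haar_null R (conjugacy_class f) <->
     finite_set (fixed_points f) /\
     forall O1 O2 : set rat,
       orbitals f O1 -> orbitals f O2 -> orbital_lt O1 O2 ->
       (parity f O1 = 1 /\ parity f O2 = 1) \/
       (parity f O1 = -1 /\ parity f O2 = -1) ->
       exists O3 : set rat,
         [/\ orbitals f O3, orbital_lt O1 O3, orbital_lt O3 O2 &
             parity f O3 <> parity f O1])
  /\ (~ haar_null R (conjugacy_class f) -> compact_biter (conjugacy_class f))
  /\ (~ haar_null R (conjugacy_class f) ->
      (forall g : autQ, conjugacy_class f g -> fixed_points g = set0) ->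
      compact_catcher (conjugacy_class f)).
Proof.
have nnull : ~ haar_null R (conjugacy_class f) <->
    finite_set (fixed_points f) /\ sign_alternating f.
  split=> [h|[ff alt]]; last exact: class_not_haar_null.
  by apply: contrapT => /haar_null_class /h.
split; last split.
- rewrite nnull; split=> -[ff h]; split=> //; exact/sign_alternatingE.
- by move=> /nnull[ff alt]; exact: compact_biter_class.
- move=> /nnull[_ alt] nofix; apply: compact_catcher_class => //.
  by apply: nofix; exists 1%g => //; rewrite conjg1.
Qed.
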